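(* Let $\mathbb{K}$ be a field of characteristic zero. Let $F:1Cob\rightarrow Mat_{\mathbb{K}}$ be a strict $1$-dimensional topological quantum field theory such that $F(+)=p\geq 2$, and let $B:1Cob\rightarrow Mat_{\mathbb{K}}$ be the Brauerian representation with parameter $p$. Then there is a monoidal natural isomorphism $\theta:B\Rightarrow F$.
   Context: **The category $1Cob$.** Objects are closed oriented $0$-manifolds presented as pairs $(n,\varepsilon)$, where $n=\{0,\ldots,n-1\}$ is a natural number and $\varepsilon:n\to\{-1,1\}$; equivalently, finite (possibly empty) words $a_1\ldots a_n$ in the letters $+,-$. The empty word is denoted $\emptyset$. A $1$-cobordism from $(n,\varepsilon_0)$ to $(m,\varepsilon_1)$ is a triple $(M,f_0:(n,\varepsilon_0)\to M,f_1:(m,\varepsilon_1)\to M)$, where $M$ is a compact oriented $1$-dimensional manifold whose boundary is a disjoint union $\partial M=\Sigma_0\sqcup\Sigma_1$, $f_0$ is an orientation preserving embedding with image $\Sigma_0$ (ingoing boundary), and $f_1$ is an orientation reversing embedding with image $\Sigma_1$ (outgoing boundary). The boundary convention is that the initial point of an oriented interval has sign $+$ and its terminal point has sign $-$ as points of $\partial M$; thus $[0,1]$ with its standard orientation gives cobordisms $+\to+$ (with $0$ ingoing), $-\to-$ (with $1$ ingoing), $+-\to\emptyset$ and $\emptyset\to-+$. Cobordisms $(M,f_0,f_1)$ and $(M',f_0',f_1')$ are equivalent if there is an orientation preserving homeomorphism $\Phi:M\to M'$ with $\Phi f_0=f_0'$ and $\Phi f_1=f_1'$. Morphisms of $1Cob$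 are equivalence classes of $1$-cobordisms; composition is gluing along the common boundary; identities are cylinders. $1Cob$ is strict monoidal: the tensor product is concatenation of words on objects and ''putting side by side'' (disjoint union) on morphisms, with unit $\emptyset$. It is symmetric via the cobordisms $\tau_{a,b}:ab\to ba$ ($a$ of length $n$, $b$ of length $m$) consisting of intervals joining the ingoing point $i$ to the outgoing point $m+i$ ($0\le i<n$) and the ingoing point $n+j$ to the outgoing point $j$ ($0\le j<m$). **The category $Mat_{\mathbb{K}}$.** Objects are natural numbers; morphisms $n\to m$ are the $m\times n$ matrices over $\mathbb{K}$; composition is matrix multiplication. It is symmetric strict monoidal with multiplication on objects, Kronecker product on morphisms, unit $1$, and symmetry the $mn\times nm$ commutation matrices $S_{n,m}$, where $S_{n,m}$ represents the linear map $\mathbb{K}^n\otimes\mathbb{K}^m\to\mathbb{K}^m\otimes\mathbb{K}^n$, $e_i\otimes f_j\mapsto f_j\otimes e_i$, in the standard (lexicographically ordered) bases. **Strict $1$-dimensional topological quantum field theory (strict $1$-TQFT):** a strict symmetric monoidal functor $F:1Cob\to Mat_{\mathbb{K}}$. **The Brauerian representation (Brauerian functor) $B$ with parameter $p\ge2$.** For a cobordism $K:(n,\varepsilon_0)\to(m,\varepsilon_1)$ with underlying manifold $M$, label the ingoing boundary points $(0,0),\ldots,(n-1,0)$ and the outgoing ones $(0,1),\ldots,(m-1,1)$, and let $R_K$ be the equivalence relation on $(n\times\{0\})\cup(m\times\{1\})$ relating two points iff they lie in the same connected component of $M$. Let $A(K)$ be the $p^m\times p^n$ matrix whose rows are indexed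 by the functions $f_i:m\to\{0,\ldots,p-1\}$ and columns by the functions $g_j:n\to\{0,\ldots,p-1\}$ (both viewed as sequences, ordered lexicographically), with $A(K)[i,j]=1$ if the combined function $[g_j,f_i]$, given by $(u,0)\mapsto g_j(u)$, $(v,1)\mapsto f_i(v)$, is constant on each equivalence class of $R_K$, and $A(K)[i,j]=0$ otherwise. Then $B(n,\varepsilon)=p^n$ on objects and $B(K)=p^{a}\cdot A(K)$ on morphisms, where $a$ is the number of connected components of $K$ homeomorphic to the circle $S^1$. $B$ is a strict symmetric monoidal functor $1Cob\to Mat_{\mathbb{K}}$. A natural transformation $\theta$ between strict monoidal functors is monoidal if $\theta_\emptyset$ is the identity of $1$ and $\theta_{ab}=\theta_a\otimes\theta_b$ for all objects $a,b$. *)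

(* Defs.v *)
From HB Require Import structures.
From mathcomp Require Import all_boot all_order all_algebra.
From mathcomp Require Import finmap.
From mathcomp Require Import all_classical all_reals.
From mathcomp Require Import topology normedtype.
From mathcomp Require Import mxtens.

Set Implicit Arguments.
Unset Strict Implicit.
Unset Printing Implicit Defensive.

Import Order.TTheory GRing.Theory Num.Theory.
Import numFieldTopology.Exports.

Local Open Scope classical_set_scope.
Local Open Scope ring_scope.

(* Objects of 1Cob: words in the letters + and -, with + encoded as [true];
   tensor product of objects is concatenation. *)
Definition word := seq bool.

Definition letter (a : word) (i : 'I_(size a)) : bool := tnth (in_tuple a) i.

Definition lcat (a b : word) (i : 'I_(size a)) : 'I_(size (a ++ b)) :=
  cast_ord (esym (size_cat a b)) (lshift (size b) i).

Definition rcat (a b : word) (j : 'I_(size b)) : 'I_(size (a ++ b)) :=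
  cast_ord (esym (size_cat a b)) (rshift (size a) j).

Definition swap_ord (a b : word) (k : 'I_(size (a ++ b))) :
    'I_(size (b ++ a)) :=
  match fintype.split (cast_ord (size_cat a b) k) with
  | inl i => rcat b i
  | inr j => lcat a j
  end.

Definition homeomorphic_sets (S T : topologicalType) (A : set S) (B : set T) :=
  exists (f : S -> T) (g : T -> S),
    [/\ {within A, continuous f} /\ set_fun A B f,
        {within B, continuous g} /\ set_fun B A g,
        forall x, A x -> g (f x) = x
      & forall y, B y -> f (g y) = y].

Section Cobordisms.
Variable R : realType.

(* In dimension 1 one needs both half-lines as models in order to have
   orientation-compatible charts at all boundary points: at the origin of
   [0,+oo) ([true]) an interval begins, at the origin of (-oo,0]
   ([false]) it ends. *)
Definition half_line (s : bool) : set R :=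
  if s then [set t | 0 <= t] else [set t | t <= 0].

Record chart (M : topologicalType) := Chart {
  chart_dom : set M ;
  chart_map : M -> R ;
  chart_side : bool
}.

(* [chart_map c] is a homeomorphism from the open set [chart_dom c] onto an open subset
   of a half-line; its values outside [chart_dom c] are irrelevant. *)
Definition is_chart (M : topologicalType) (c : chart M) : Prop :=
  [/\ open (chart_dom c),
      {within chart_dom c, continuous (chart_map c)},
      set_inj (chart_dom c) (chart_map c)
    & forall W : set M, open W -> W `<=` chart_dom c ->
        exists2 O : set R,
          open O & chart_map c @` W = O `&` half_line (chart_side c)].

Definition locally_increasing (M N : topologicalType) (f : M -> N)
    (c : chart M) (d : chart N) : Prop :=
  forall x, chart_dom c x -> chart_dom d (f x) ->
    exists2 W : set M, nbhs x W & forall y z, W y -> W z ->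
      chart_map c y < chart_map c z -> chart_map d (f y) < chart_map d (f z).

(* Compact oriented 1-manifolds with boundary; an orientation is an atlas with
   locally increasing transition maps.  Second countability is automatic. *)
Record omanifold := OManifold {
  carrier :> topologicalType ;
  atlas : set (chart carrier) ;
  omanifold_compact : compact [set: carrier] ;
  omanifold_hausdorff : hausdorff_space carrier ;
  atlas_chart : forall c, atlas c -> is_chart c ;
  atlas_cover : forall x, exists2 c, atlas c & chart_dom c x ;
  atlas_oriented : forall c d, atlas c -> atlas d ->
    locally_increasing id c d
}.

Definition orientation_preserving (M N : omanifold) (f : M -> N) : Prop :=
  forall c d, atlas c -> atlas d -> locally_increasing f c d.

(* x is a boundary point with sign s: initial points are positive. *)
Definition boundary_sign (M : omanifold) (x : M) (s : bool) : Prop :=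
  exists c : chart M,
    [/\ atlas c, chart_dom c x, chart_side c = s & chart_map c x = 0].

Definition boundary (M : omanifold) : set M :=
  [set x | exists s, boundary_sign x s].

Definition ends (I J M : Type) (f0 : I -> M) (f1 : J -> M) (x : I + J) : M :=
  match x with inl i => f0 i | inr j => f1 j end.

Record cob (a b : word) := Cob {
  mfd :> omanifold ;
  ingoing : 'I_(size a) -> mfd ;
  outgoing : 'I_(size b) -> mfd ;
  ends_inj : injective (ends ingoing outgoing) ;
  ends_boundary : range (ends ingoing outgoing) = @boundary mfd ;
  ingoing_sign : forall i, boundary_sign (ingoing i) (letter i) ;
  outgoing_sign : forall j, boundary_sign (outgoing j) (~~ letter j)
}.

(* Morphisms of 1Cob are cobordisms up to [cob_equiv]. *)
Definition cob_equiv (a b : word) (K L : cob a b) : Prop :=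
  exists (f : K -> L) (g : L -> K),
    [/\ cancel f g /\ cancel g f,
        continuous f /\ continuous g,
        orientation_preserving f,
        forall i, f (ingoing K i) = ingoing L i
      & forall j, f (outgoing K j) = outgoing L j].

(* The compact oriented manifold N carries the final topology and the
   orientation coming from M1 and M2, and i1, i2 are injective and jointly
   surjective. *)
Definition is_glued_from (M1 M2 N : omanifold) (i1 : M1 -> N) (i2 : M2 -> N) :=
  [/\ injective i1 /\ injective i2,
      range i1 `|` range i2 = [set: N],
      forall O : set N, open O <-> open (i1 @^-1` O) /\ open (i2 @^-1` O)
    & orientation_preserving i1 /\ orientation_preserving i2].

(* N represents the composite of K : a -> b and L : b -> c.  The operations of
   1Cob are given as relations between cobordisms; each determines its result
   up to [cob_equiv]. *)
Definition is_composite (a b c : word) (K : cob a b) (L : cob b c)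
    (N : cob a c) : Prop :=
  exists (i1 : K -> N) (i2 : L -> N),
    [/\ is_glued_from i1 i2,
        forall x y, i1 x = i2 y <->
          exists k, x = outgoing K k /\ y = ingoing L k,
        forall i, ingoing N i = i1 (ingoing K i)
      & forall j, outgoing N j = i2 (outgoing L j)].

Definition is_tensor (a b c d : word) (K : cob a b) (L : cob c d)
    (N : cob (a ++ c) (b ++ d)) : Prop :=
  exists (i1 : K -> N) (i2 : L -> N),
    [/\ is_glued_from i1 i2,
        forall x y, i1 x <> i2 y,
        (forall i, ingoing N (lcat c i) = i1 (ingoing K i)) /\
        (forall i, ingoing N (rcat a i) = i2 (ingoing L i))
      & (forall j, outgoing N (lcat d j) = i1 (outgoing K j)) /\
        (forall j, outgoing N (rcat b j) = i2 (outgoing L j))].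

(* K consists of intervals joining the ingoing point k to the outgoing point
   s k.  A continuous bijection from the compact space {k} x [0,1] onto K is a
   homeomorphism, and the orientation of each interval is forced by the sign
   of its ingoing end. *)
Definition consists_of_intervals (a b : word) (K : cob a b)
    (s : 'I_(size a) -> 'I_(size b)) : Prop :=
  exists h : 'I_(size a) -> R -> K,
    [/\ forall k, {within `[0, 1], continuous (h k)},
        forall k l t u, 0 <= t <= 1 -> 0 <= u <= 1 -> h k t = h l u ->
          k = l /\ t = u,
        forall x, exists k t, 0 <= t <= 1 /\ h k t = x,
        forall k, h k 0 = ingoing K k
      & forall k, h k 1 = outgoing K (s k)].

Definition is_identity (a : word) (K : cob a a) : Prop :=
  consists_of_intervals K id.

Definition is_symmetry (a b : word) (K : cob (a ++ b) (b ++ a)) : Prop :=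
  consists_of_intervals K (@swap_ord a b).

Definition circle : set (R * R)%type := [set z | z.1 ^+ 2 + z.2 ^+ 2 = 1].

Definition num_circles (a b : word) (K : cob a b) : nat :=
  #|` fset_set [set C : set K |
       (exists x, C = connected_component [set: K] x) /\
       homeomorphic_sets C circle]|%fset.

Definition same_component (a b : word) (K : cob a b)
    (x y : 'I_(size a) + 'I_(size b)) : Prop :=
  connected_component [set: K] (ends (ingoing K) (outgoing K) x)
    (ends (ingoing K) (outgoing K) y).

End Cobordisms.

Section TQFT.
Variables (R : realType) (F : fieldType).

(* The matrix of e_i (x) f_j |-> f_j (x) e_i; [mxtens_index] is the
   lexicographic numbering of pairs used by the Kronecker product [tensmx]. *)
Definition commutation_mx (n m : nat) : 'M[F]_(m * n, n * m) :=
  \matrix_(r, c)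
    (((mxtens_unindex r).1 == (mxtens_unindex c).2) &&
     ((mxtens_unindex r).2 == (mxtens_unindex c).1))%:R.

(* Data of a strict monoidal functor 1Cob -> Mat. *)
Record functor_data := FunctorData {
  ob : word -> nat ;
  mor : forall a b : word, cob R a b -> 'M[F]_(ob b, ob a) ;
  ob_unit : ob [::] = 1%N ;
  ob_cat : forall a b, ob (a ++ b) = (ob a * ob b)%N
}.

Record is_strict_symmetric_monoidal (T : functor_data) : Prop := {
  mor_equiv : forall (a b : word) (K L : cob R a b),
    cob_equiv K L -> mor T K = mor T L ;
  mor_identity : forall (a : word) (K : cob R a a),
    is_identity K -> mor T K = 1%:M ;
  mor_composite : forall (a b c : word)
      (K : cob R a b) (L : cob R b c) (N : cob R a c),
    is_composite K L N -> mor T N = mor T L *m mor T K ;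
  mor_tensor : forall (a b c d : word)
      (K : cob R a b) (L : cob R c d) (N : cob R (a ++ c) (b ++ d)),
    is_tensor K L N ->
    mor T N = castmx (esym (ob_cat T b d), esym (ob_cat T a c))
                (tensmx (mor T K) (mor T L)) ;
  mor_symmetry : forall (a b : word) (K : cob R (a ++ b) (b ++ a)),
    is_symmetry K ->
    mor T K = castmx (esym (ob_cat T b a), esym (ob_cat T a b))
                (commutation_mx (ob T a) (ob T b))
}.

Record strict_tqft := StrictTQFT {
  tqft_data :> functor_data ;
  tqft_axioms : is_strict_symmetric_monoidal tqft_data
}.

Record is_monoidal_natural_iso (S T : functor_data)
    (theta : forall a : word, 'M[F]_(ob T a, ob S a)) : Prop := {
  theta_natural : forall (a b : word) (K : cob R a b),
    theta b *m mor S K = mor T K *m theta a ;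
  theta_iso : forall a, exists theta' : 'M[F]_(ob S a, ob T a),
    theta' *m theta a = 1%:M /\ theta a *m theta' = 1%:M ;
  theta_unit : castmx (ob_unit T, ob_unit S) (theta [::]) = 1%:M ;
  theta_cat : forall a b : word,
    theta (a ++ b) = castmx (esym (ob_cat T a b), esym (ob_cat S a b))
                       (tensmx (theta a) (theta b))
}.

Section Brauer.
Variable p : nat.

(* The value at u of the i-th function n -> {0,...,p-1} in lexicographic
   order: the u-th of the n base-p digits of i, most significant first. *)
Definition lex_fun (n i u : nat) : nat := (i %/ p ^ (n - u.+1)) %% p.

Definition brauer_label (n m j i : nat) (x : 'I_n + 'I_m) : nat :=
  match x with inl u => lex_fun n j u | inr v => lex_fun m i v end.

Definition brauer_incidence (a b : word) (K : cob R a b) :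
    'M[F]_(p ^ size b, p ^ size a) :=
  \matrix_(i, j)
    `[< forall x y : 'I_(size a) + 'I_(size b), same_component K x y ->
          brauer_label j i x = brauer_label j i y >]%:R.

Definition brauer_mor (a b : word) (K : cob R a b) :
    'M[F]_(p ^ size b, p ^ size a) :=
  (p%:R ^+ num_circles K) *: brauer_incidence K.

Lemma brauer_ob_cat (a b : word) :
  (p ^ size (a ++ b) = p ^ size a * p ^ size b)%N.
Proof. by rewrite size_cat expnD. Qed.

Definition brauer : functor_data :=
  @FunctorData (fun a => p ^ size a)%N brauer_mor (expn0 p) brauer_ob_cat.

End Brauer.
End TQFT.

(* Main.v *)
(** A compact oriented 1-manifold is a finite disjoint union of arcs and loops: charts
    give a finite cover by oriented edges, which becomes a graph after cutting all edges
    at all endpoints, and in a graph with the least number of edges no two edges meet,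
    since otherwise one could be dropped or two be joined.  Collars allow boundary points
    to be permuted by composing with a permutation cobordism, so that any edge can be
    brought to the front and split off as a tensor factor, which is a strand, a cap, a
    cup, or a circle (a cup followed by a twisted cap).  A strict symmetric monoidal
    functor is therefore determined by its values on the cap and the cup.  Write these
    values of F as matrices E and H.  The snake identities say E H = 1 and H E = 1, so
    theta_+ = 1 and theta_- = H extend multiplicatively to an invertible theta, and the
    functor theta^-1 F theta sends cap and cup to the standard pairing and copairing of
    K^p, as B does. *)
Require Import Defs.
From mathcomp Require Import all_boot all_order all_algebra all_reals.
From mathcomp Require Import finmap all_classical topology normedtype realfun mxtens.
From mathcomp Require Import lra zify.

Set Implicit Arguments.
Unset Strict Implicit.
Unset Printing Implicit Defensive.

Import Order.TTheory GRing.Theory Num.Theory.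
Import numFieldNormedType.Exports.

Local Open Scope classical_set_scope.
Local Open Scope ring_scope.

(** * Oriented edges in 1-manifolds *)

(** Composition and tensor product are relations between cobordisms, so no quotient manifold is ever
    formed: every decomposition is given by maps into a manifold that is already at hand, either the
    given cobordism or a standard one. Collars exist for the same purpose: they show a cobordism to
    be the composite of a permutation with a relabelled copy of itself. Loops are removed before
    arcs. A loop splits off as a left factor between empty words, without moving any boundary point,
    while the collars are built for manifolds all of whose components are arcs. The choice of
    theta_- is forced: with theta_+ = 1, naturality at the cup reads theta_- = H. The induction over
    edges does not compare two functors. It proves the entry formula defining B for an arbitrary [G]
    with the functor axioms and the standard cap and cup, and is then applied to theta^-1 F theta.
    Since [ob (a ++ b)] equals [ob a * ob b] only propositionally, matrices carry casts; reading
    entries at natural numbers removes them, and base-p digit strings turn Kronecker products into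
    concatenation. *)

Lemma nbhs_distP (R : realType) (t : R) (P : set R) :
  nbhs t P <-> exists2 e, 0 < e & forall u, `|u - t| < e -> P u.
Proof.
split.
  move/nbhs_ballP => [e /= e0 He]; exists e => // u ut; apply: He.
  by rewrite /ball /= distrC.
case=> e e0 He; apply/nbhs_ballP; exists e => //= u; rewrite /ball /= => tu.
by apply: He; rewrite distrC.
Qed.

Lemma itv01P (R : realType) (s : R) : 0 <= s <= 1 -> [\/ s = 0, s = 1 | 0 < s < 1].
Proof.
move=> s01; have [->|s0] := eqVneq s 0; first by constructor.
have [->|s1] := eqVneq s 1; first by constructor.
by constructor; rewrite !lt_neqAle eq_sym s0 s1.
Qed.

Lemma half_lt (R : realType) (x : R) : 0 < x / 2 -> x / 2 < x.
Proof. lra. Qed.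

Section Edges.
Variable R : realType.
Implicit Type M : omanifold R.

(** Orientation is tested in every chart of the atlas, but only locally in the parameter, so that a
    closed loop can be rising as well. Parameters outside [0,1] are left free. *)
Definition rising M (h : R -> M) : Prop :=
  forall t c, 0 <= t <= 1 -> atlas c -> chart_dom c (h t) ->
    exists2 W : set R, nbhs t W & forall u v, W u -> W v ->
      0 <= u <= 1 -> 0 <= v <= 1 -> u < v ->
      chart_map c (h u) < chart_map c (h v).

Lemma chart_continuous M (c : chart R M) (x : M) :
  atlas c -> chart_dom c x -> {for x, continuous (chart_map c)}.
Proof.
move=> ac dx; have [od cc _ _] := atlas_chart ac.
rewrite continuous_open_subspace // in cc.
exact: (cc x (mem_set dx)).
Qed.

Lemma chart_dom_nbhs M (c : chart R M) (x : M) :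
  atlas c -> chart_dom c x -> nbhs x (chart_dom c).
Proof.
by move=> ac dx; have [od _ _ _] := atlas_chart ac; apply: open_nbhs_nbhs.
Qed.

Lemma chart_map_inj M (c : chart R M) (x y : M) :
  atlas c -> chart_dom c x -> chart_dom c y ->
  chart_map c x = chart_map c y -> x = y.
Proof.
move=> ac dx dy; have [_ _ ci _] := atlas_chart ac.
by apply: ci; rewrite inE.
Qed.

Lemma chart_map_open M (c : chart R M) (x : M) (W : set M) :
  atlas c -> chart_dom c x -> nbhs x W ->
  exists2 O : set R, nbhs (chart_map c x) O & forall r, O r ->
    half_line (chart_side c) r -> exists2 y, W y /\ chart_dom c y & chart_map c y = r.
Proof.
move=> ac dx; have [od _ _ op] := atlas_chart ac.
rewrite nbhsE => -[V [oV Vx] VW].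
have [|O oO OE] := op (V `&` chart_dom c) _ (@subIsetr _ _ _).
  exact: openI.
exists O.
  apply: open_nbhs_nbhs; split => //.
  have : (chart_map c @` (V `&` chart_dom c)) (chart_map c x) by exists x.
  by rewrite OE => -[].
move=> r Or hr; have : (O `&` half_line (chart_side c)) r by [].
rewrite -OE => -[y [Vy dy] yr]; exists y => //; split => //; exact: VW.
Qed.

Lemma chart_half_line M (c : chart R M) (x : M) :
  atlas c -> chart_dom c x -> half_line (chart_side c) (chart_map c x).
Proof.
move=> ac dx; have [od _ _ op] := atlas_chart ac.
have [O oO OE] := op (chart_dom c) od (@subset_refl _ _).
have : (chart_map c @` (chart_dom c)) (chart_map c x) by exists x.
by rewrite OE => -[].
Qed.

Lemma rising_box M (h : R -> M) (t : R) (c : chart R M) :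
  continuous h -> rising h -> 0 <= t <= 1 -> atlas c -> chart_dom c (h t) ->
  exists2 e, 0 < e & (forall u, `|u - t| < e -> chart_dom c (h u)) /\
    (forall u v, `|u - t| < e -> `|v - t| < e -> 0 <= u <= 1 -> 0 <= v <= 1 ->
       u < v -> chart_map c (h u) < chart_map c (h v)).
Proof.
move=> ch rh t01 ac dt; have [W Wt WP] := rh _ _ t01 ac dt.
have : nbhs t (W `&` (h @^-1` chart_dom c)).
  by apply: filterI => //; apply: ch; apply: chart_dom_nbhs.
move/nbhs_distP => [e e0 eP]; exists e => //; split => [u /eP[]//|].
by move=> u v /eP[Wu _] /eP[Wv _]; apply: WP.
Qed.

Lemma chart_IVT M (h : R -> M) (c : chart R M) (a b r : R) :
  continuous h -> atlas c -> a <= b ->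
  (forall u, a <= u <= b -> chart_dom c (h u)) ->
  chart_map c (h a) <= r <= chart_map c (h b) ->
  exists2 u, a <= u <= b & chart_map c (h u) = r.
Proof.
move=> ch ac ab hd /andP[ar rb].
have [||u] := @IVT R (chart_map c \o h) a b r ab.
- apply: continuous_in_subspaceT => u; rewrite inE /= in_itv /= => uab.
  apply: continuous_comp; first exact: ch.
  by apply: chart_continuous => //; apply: hd.
- have le := le_trans ar rb.
  by rewrite /= minEle maxEle le ar rb.
by rewrite in_itv /= => uab <-; exists u.
Qed.

(* In the chart at [h t], the path [h] runs through all intermediate values. *)
Lemma rising_nbhs M (h : R -> M) (t e : R) :
  continuous h -> rising h -> 0 < t < 1 -> 0 < e ->
  nbhs (h t) (h @` [set u | 0 < u < 1 /\ `|u - t| < e]).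
Proof.
move=> ch rh /andP[t0 t1] e0.
have t01 : 0 <= t <= 1 by rewrite !ltW.
have [c ac dt] := atlas_cover (h t).
have [d d0 [dP incr]] := rising_box ch rh t01 ac dt.
pose m := Num.min (Num.min e d) (Num.min t (1 - t)) / 2.
have m0 : 0 < m by rewrite divr_gt0 // !lt_min e0 d0 t0 subr_gt0 t1.
have mm : m < Num.min (Num.min e d) (Num.min t (1 - t)) by apply: half_lt.
move: mm; rewrite !lt_min => /andP[/andP[me md] /andP[mt mt1]].
have lo : chart_map c (h (t - m)) < chart_map c (h t).
  apply: incr; rewrite ?subrr ?normr0 //; try lra.
  by rewrite addrC addKr normrN gtr0_norm.
have hi : chart_map c (h t) < chart_map c (h (t + m)).
  apply: incr; rewrite ?subrr ?normr0 //; try lra.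
  by rewrite addrC addKr gtr0_norm.
have : nbhs (h t) (chart_dom c `&` (chart_map c @^-1`
   `]chart_map c (h (t - m)), chart_map c (h (t + m))[%classic)).
  apply: filterI; first exact: chart_dom_nbhs.
  apply: (chart_continuous ac dt).
  apply: open_nbhs_nbhs; split; first exact: itv_open.
  by rewrite /= in_itv /= lo hi.
apply: filterS => y [dy /=]; rewrite in_itv /= => /andP[y1 y2].
have [|||u ut uy] := @chart_IVT _ h c (t - m) (t + m) (chart_map c y) ch ac.
- lra.
- by move=> u ut; apply: dP; rewrite ltr_norml; lra.
- by rewrite !ltW.
exists u; first by split; [lra|rewrite ltr_norml; lra].
apply: (chart_map_inj ac) => //; apply: dP; rewrite ltr_norml; lra.
Qed.

(** In a chart at the common start both paths climb. The value of the lower one at a small time [m]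
    is attained by the other one before [m], by the intermediate value theorem, and charts are
    injective. *)
Lemma rising_meet0 M (g h : R -> M) :
  continuous g -> rising g -> continuous h -> rising h -> g 0 = h 0 ->
  exists t u, [/\ 0 < t < 1, 0 < u < 1 & g t = h u].
Proof.
move=> cg rg ch rh gh.
have [c ac dg] := atlas_cover (g 0).
have z01 : 0 <= (0 : R) <= 1 by rewrite lexx ler01.
have dh : chart_dom c (h 0) by rewrite -gh.
have [d d0 [dP dI]] := rising_box cg rg z01 ac dg.
have [e e0 [eP eI]] := rising_box ch rh z01 ac dh.
pose m := Num.min (Num.min e d) 1 / 2.
have m0 : 0 < m by rewrite divr_gt0 // !lt_min e0 d0 ltr01.
have mm : m < Num.min (Num.min e d) 1 by apply: half_lt.
move: mm; rewrite !lt_min => /andP[/andP[me md] m1].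
have gm : chart_map c (g 0) < chart_map c (g m).
  by apply: dI; rewrite ?subrr ?subr0 ?normr0 ?gtr0_norm //; lra.
have hm : chart_map c (h 0) < chart_map c (h m).
  by apply: eI; rewrite ?subrr ?subr0 ?normr0 ?gtr0_norm //; lra.
case: (lerP (chart_map c (g m)) (chart_map c (h m))) => [le|/ltW le].
- have [|||u um uy] := @chart_IVT _ h c 0 m (chart_map c (g m)) ch ac.
  + lra.
  + by move=> u ut; apply: eP; rewrite ltr_norml; lra.
  + by rewrite -gh ltW.
  have un0 : u != 0.
    by apply/eqP => u0; move: uy; rewrite u0 -gh => uy; rewrite uy ltxx in gm.
  have u0 : 0 < u by rewrite lt_neqAle eq_sym un0; lra.
  exists m, u; split; [lra|lra|]; apply/esym/(chart_map_inj ac) => //.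
    by apply: eP; rewrite ltr_norml; lra.
  by apply: dP; rewrite ltr_norml; lra.
- have [|||u um uy] := @chart_IVT _ g c 0 m (chart_map c (h m)) cg ac.
  + lra.
  + by move=> u ut; apply: dP; rewrite ltr_norml; lra.
  + by rewrite gh ltW.
  have un0 : u != 0.
    by apply/eqP => u0; move: uy; rewrite u0 gh => uy; rewrite uy ltxx in hm.
  have u0 : 0 < u by rewrite lt_neqAle eq_sym un0; lra.
  exists u, m; split; [lra|lra|]; apply/(chart_map_inj ac) => //.
    by apply: dP; rewrite ltr_norml; lra.
  by apply: eP; rewrite ltr_norml; lra.
Qed.

(** Mirror image of [rising_meet0]: shortly before the common stop, the value of the higher path is
    still to be attained by the lower one. *)
Lemma rising_meet1 M (g h : R -> M) :
  continuous g -> rising g -> continuous h -> rising h -> g 1 = h 1 ->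
  exists t u, [/\ 0 < t < 1, 0 < u < 1 & g t = h u].
Proof.
move=> cg rg ch rh gh.
have [c ac dg] := atlas_cover (g 1).
have z01 : 0 <= (1 : R) <= 1 by rewrite lexx ler01.
have dh : chart_dom c (h 1) by rewrite -gh.
have [d d0 [dP dI]] := rising_box cg rg z01 ac dg.
have [e e0 [eP eI]] := rising_box ch rh z01 ac dh.
pose m := 1 - Num.min (Num.min e d) 1 / 2.
have m0 : m < 1.
  by rewrite ltrBlDr ltrDl divr_gt0 // !lt_min e0 d0 ltr01.
have mm : 1 - m < Num.min (Num.min e d) 1.
  by rewrite /m opprB addrC subrK half_lt //; move: m0; rewrite /m; lra.
move: mm; rewrite !lt_min => /andP[/andP[me md] m1].
have gm : chart_map c (g m) < chart_map c (g 1).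
  by apply: dI => //; rewrite ?subrr ?normr0 ?ltr_norml //; lra.
have hm : chart_map c (h m) < chart_map c (h 1).
  by apply: eI => //; rewrite ?subrr ?normr0 ?ltr_norml //; lra.
case: (lerP (chart_map c (h m)) (chart_map c (g m))) => [le|/ltW le].
- have [|||u um uy] := @chart_IVT _ h c m 1 (chart_map c (g m)) ch ac.
  + lra.
  + by move=> u ut; apply: eP; rewrite ltr_norml; lra.
  + by rewrite -gh le ltW.
  have un0 : u != 1.
    by apply/eqP => u0; move: uy; rewrite u0 -gh => uy; rewrite uy ltxx in gm.
  have u0 : u < 1 by rewrite lt_neqAle un0; lra.
  exists m, u; split; [lra|lra|]; apply/esym/(chart_map_inj ac) => //.
    by apply: eP; rewrite ltr_norml; lra.
  by apply: dP; rewrite ltr_norml; lra.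
- have [|||u um uy] := @chart_IVT _ g c m 1 (chart_map c (h m)) cg ac.
  + lra.
  + by move=> u ut; apply: dP; rewrite ltr_norml; lra.
  + by rewrite gh le ltW.
  have un0 : u != 1.
    by apply/eqP => u0; move: uy; rewrite u0 gh => uy; rewrite uy ltxx in hm.
  have u0 : u < 1 by rewrite lt_neqAle un0; lra.
  exists u, m; split; [lra|lra|]; apply/(chart_map_inj ac) => //.
    by apply: dP; rewrite ltr_norml; lra.
  by apply: eP; rewrite ltr_norml; lra.
Qed.

End Edges.

(** * Finite covers by edges and their subdivision *)

Section Subdivision.
Variable R : realType.
Implicit Type M : omanifold R.

Lemma comp_continuous (X Y Z : topologicalType) (f : X -> Y) (g : Y -> Z) :
  continuous f -> continuous g -> continuous (g \o f).
Proof. by move=> fc gc x; apply: continuous_comp; [exact: fc|exact: gc]. Qed.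

(** Makes paths on [0,1] total and continuous on the whole line, so that ordinary continuity can be
    used instead of subspace continuity. *)
Definition clamp (t : R) : R := Num.max 0 (Num.min t 1).

Lemma clamp_itv t : 0 <= clamp t <= 1.
Proof. by rewrite /clamp le_max ge_max ge_min ler01 !lexx ?orbT. Qed.

Lemma clamp_id t : 0 <= t <= 1 -> clamp t = t.
Proof. by case/andP=> t0 t1; rewrite /clamp min_l // max_r. Qed.

Lemma clamp_continuous : continuous clamp.
Proof.
move=> t; apply: (@continuous_max _ _ (fun=> 0) (fun t : R => Num.min t 1)).
  exact: cst_continuous.
by apply: (@continuous_min _ _ id (fun=> 1)); [exact: cvg_id|exact: cst_continuous].
Qed.

Definition trace M (h : R -> M) : set M := [set x | exists2 t, 0 <= t <= 1 & h t = x].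

(** In [edge_inj] only [t] is interior. This leaves open whether [h 0 = h 1], so arcs and loops are
    treated alike. *)
Record edge M (h : R -> M) : Prop := Edge {
  edge_continuous : continuous h;
  edge_rising : rising h;
  edge_inj : forall t u, 0 < t < 1 -> 0 <= u <= 1 -> h t = h u -> t = u }.

Lemma affine_continuous (a b : R) : continuous (fun t : R => a + t * b).
Proof.
move=> t; apply: (@continuousD _ _ _ (fun=> a) (fun t : R => t * b)).
  exact: cst_continuous.
by apply: mulrr_continuous.
Qed.

(** The edge is the inverse of a chart at [x], restricted to a compact interval of chart values and
    parametrized affinely. *)
Lemma local_edge M (x : M) : exists2 h : R -> M, edge h & nbhs x (trace h).
Proof.
have [c ac dx] := atlas_cover x.
have [O /nbhs_distP[e e0 Oe] cO] := chart_map_open ac dx (@filterT _ (nbhs x) _).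
have hx := chart_half_line ac dx.
have e2 : 0 < e / 2 by rewrite divr_gt0.
have e2e : e / 2 < e by apply: half_lt.
(* The interval has radius [e / 2] around the value of [x] and is cut off at 0 on the side where the
   half-line ends, so that it lies in the image of the chart and still contains all nearby chart
   values. *)
have [a [b [ab hab1 hab2]]] : exists a b : R, [/\ a < b,
   forall r, a <= r <= b -> `|r - chart_map c x| < e /\ half_line (chart_side c) r
   & forall r, half_line (chart_side c) r -> `|r - chart_map c x| < e / 2 -> a <= r <= b].
  clear cO dx Oe; move: (chart_map c x) hx => z; case: (chart_side c) => /= hz.
    exists (Num.max 0 (z - e / 2)), (z + e / 2); split.
    - by rewrite gt_max; lra.
    - by move=> r; rewrite ge_max ltr_norml; lra.
    - by move=> r; rewrite ge_max ltr_norml; lra.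
  exists (z - e / 2), (Num.min 0 (z + e / 2)); split.
  - by rewrite lt_min; lra.
  - by move=> r; rewrite le_min ltr_norml; lra.
  - by move=> r; rewrite le_min ltr_norml; lra.
have /choice[g gP] : forall r, exists y, a <= r <= b -> chart_dom c y /\ chart_map c y = r.
  move=> r; case: (pselect (a <= r <= b)) => [rab|]; last by exists x.
  have [rz hr] := hab1 _ rab.
  by have [y [_ dy] cy] := cO r (Oe _ rz) hr; exists y.
pose f t := a + clamp t * (b - a).
have fab t : a <= f t <= b.
  have := clamp_itv t; rewrite /f; move: (clamp t) => {}t /andP[t0 t1].
  rewrite lerDl mulr_ge0 ?subr_ge0 ?(ltW ab) //=.
  by rewrite -lerBrDl ler_piMl // subr_ge0 ltW.
have fc : continuous f.
  exact (@comp_continuous R R R clamp (fun t => a + t * (b - a))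
    clamp_continuous (@affine_continuous a (b - a))).
have cgf t : chart_map c (g (f t)) = f t by case: (gP _ (fab t)).
have dgf t : chart_dom c (g (f t)) by case: (gP _ (fab t)).
(* The inverse of a chart is continuous because charts are open maps: nearby values are attained
   inside the given neighbourhood. *)
have hc : continuous (g \o f).
  move=> t W Wt.
  have [O' O'n O'P] := chart_map_open ac (dgf t) Wt.
  rewrite cgf in O'n.
  have fO : nbhs t (f @^-1` O') := fc t _ O'n.
  change (nbhs t ((g \o f) @^-1` W)); apply: filterS fO => u Ou /=.
  have [y [Wy dy] yE] := O'P _ Ou (hab1 _ (fab u)).2.
  suff <- : y = g (f u) by [].
  by apply: (chart_map_inj ac dy (dgf u)); rewrite yE cgf.
exists (g \o f).
  split=> //.
  - move=> t d t01 ad dd.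
    have [W Wn Wlt] := atlas_oriented ac ad (dgf t) dd.
    exists ((g \o f) @^-1` W); first exact: hc.
    move=> u v Wu Wv u01 v01 uv; apply: Wlt => //; rewrite !cgf /f !clamp_id //.
    by rewrite ltrD2l ltr_pM2r // subr_gt0.
  - move=> t u t01 u01 /= /(congr1 (chart_map c)); rewrite !cgf /f.
    rewrite !clamp_id //; last by rewrite !ltW //; case/andP: t01.
    by move/addrI/mulIf; apply; rewrite subr_eq0 gt_eqF.
have : nbhs x (chart_dom c `&` (chart_map c @^-1` [set r | `|r - chart_map c x| < e / 2])).
  apply: filterI; first exact: chart_dom_nbhs.
  by apply: (chart_continuous ac dx); apply/nbhs_distP; exists (e / 2).
apply: filterS => y [dy /= yx].
have := hab2 _ (chart_half_line ac dy) yx.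
set r := chart_map c y => rab.
pose t := (r - a) / (b - a).
have ba0 : 0 < b - a by rewrite subr_gt0.
have t01 : 0 <= t <= 1.
  case/andP: rab => ar rb; rewrite /t divr_ge0 ?subr_ge0 ?(ltW ab) //=.
  by rewrite ler_pdivrMr // mul1r lerD2r.
have ft : f t = r by rewrite /f clamp_id // /t divfK ?gt_eqF // addrC subrK.
by exists t => //=; apply: (chart_map_inj ac (dgf t) dy); rewrite cgf ft.
Qed.

Definition subpath (T : Type) (h : R -> T) (a b t : R) : T := h (a + t * (b - a)).

Lemma subpath_itv (a b t : R) : 0 <= a -> a < b -> b <= 1 -> 0 <= t <= 1 ->
  a <= a + t * (b - a) <= b.
Proof.
move=> a0 ab b1 t01.
have ba0 : 0 < b - a by rewrite subr_gt0.
case/andP: t01 => t0 t1; rewrite lerDl mulr_ge0 ?(ltW ba0) //=.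
by rewrite -lerBrDl ler_piMl // ltW.
Qed.

Lemma subpath_itv_lt (a b t : R) : 0 <= a -> a < b -> b <= 1 -> 0 < t < 1 ->
  a < a + t * (b - a) < b.
Proof.
move=> a0 ab b1 t01.
have ba0 : 0 < b - a by rewrite subr_gt0.
case/andP: t01 => t0 t1; rewrite ltrDl mulr_gt0 //=.
by rewrite -ltrBrDl gtr_pMl // ltW.
Qed.

Lemma subpath_continuous M (h : R -> M) a b : continuous h -> continuous (subpath h a b).
Proof.
move=> ch; exact (@comp_continuous R R M (fun t => a + t * (b - a)) h (@affine_continuous a (b - a)) ch).
Qed.

Lemma subpath_rising M (h : R -> M) a b :
  0 <= a -> a < b -> b <= 1 -> rising h -> rising (subpath h a b).
Proof.
move=> a0 ab b1 rh t c t01 ac dc.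
have I s : 0 <= s <= 1 -> 0 <= a + s * (b - a) <= 1.
  by move=> /(subpath_itv a0 ab b1)/andP[le1 le2]; rewrite (le_trans a0) // (le_trans le2).
have [W Wn WP] := rh _ _ (I _ t01) ac dc.
exists ((fun t : R => a + t * (b - a)) @^-1` W); first exact: affine_continuous.
move=> u v Wu Wv u01 v01 uv; apply: WP => //; try exact: I.
by rewrite ltrD2l ltr_pM2r // subr_gt0.
Qed.

Lemma subpath_edge M (h : R -> M) a b :
  0 <= a -> a < b -> b <= 1 -> edge h -> edge (subpath h a b).
Proof.
move=> a0 ab b1 [ch rh ih]; split.
- exact: subpath_continuous.
- exact: subpath_rising.
- move=> t u t01 u01 tu.
  have /andP[t1 t2] := subpath_itv_lt a0 ab b1 t01.
  have /andP[u1 u2] := subpath_itv a0 ab b1 u01.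
  have : a + t * (b - a) = a + u * (b - a).
    by apply: ih => //; rewrite ?(le_lt_trans a0) ?(lt_le_trans _ b1) ?(le_trans a0) ?(le_trans _ b1).
  by move/addrI/mulIf; apply; rewrite subr_eq0 gt_eqF.
Qed.

Lemma subpath0 (T : Type) (h : R -> T) a b : subpath h a b 0 = h a.
Proof. by rewrite /subpath mul0r addr0. Qed.

Lemma subpath1 (T : Type) (h : R -> T) a b : subpath h a b 1 = h b.
Proof. by rewrite /subpath mul1r addrC subrK. Qed.

Definition avoids M (h : R -> M) (x : M) : Prop := forall t, 0 < t < 1 -> h t <> x.

(** An edge passes through [x] at no more than one interior parameter, and is cut there. The last
    three properties are what an iteration needs: points avoided before stay avoided, nothing is
    lost, and no new endpoint other than [x] arises. *)
Lemma cut_edge M (h : R -> M) (x : M) : edge h ->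
  exists L : seq (R -> M), [/\ forall g, g \in L -> edge g /\ avoids g x,
    forall g y, g \in L -> avoids h y -> avoids g y,
    forall y, trace h y -> exists2 g, g \in L & trace g y
    & forall g, g \in L -> (g 0 = h 0 \/ g 0 = x) /\ (g 1 = h 1 \/ g 1 = x)].
Proof.
move=> eh; case: (pselect (avoids h x)) => [av|].
  exists [:: h]; split => //.
  - by move=> g; rewrite inE => /eqP ->.
  - by move=> g y; rewrite inE => /eqP ->.
  - by move=> y hy; exists h; rewrite ?inE.
  - by move=> g; rewrite inE => /eqP ->; split; left.
move=> /existsNP[t /not_implyP[t01 /contrapT hx]].
case/andP: (t01) => t0 t1.
have tt : 0 <= t <= 1 by rewrite !ltW.
exists [:: subpath h 0 t; subpath h t 1]; split.
- move=> g; rewrite !inE => /orP[] /eqP ->; split.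
  + by apply: subpath_edge => //; exact: ltW.
  + move=> u /(subpath_itv_lt (lexx 0) t0 (ltW t1))/andP[u0 ut].
    rewrite -hx => ut'.
    have E := edge_inj eh _ tt ut'.
    by have := ut; rewrite E ?ltxx // u0 (lt_trans ut).
  + by apply: subpath_edge => //; exact: ltW.
  + move=> u /(subpath_itv_lt (ltW t0) t1 (lexx 1))/andP[u0 ut].
    rewrite -hx => ut'.
    have E := edge_inj eh _ tt ut'.
    by have := u0; rewrite E ?ltxx // ut (lt_trans t0).
- move=> g y; rewrite !inE => /orP[] /eqP -> av u.
  + move=> /(subpath_itv_lt (lexx 0) t0 (ltW t1))/andP[u0 ut].
    by apply: av; rewrite u0 (lt_trans ut).
  + move=> /(subpath_itv_lt (ltW t0) t1 (lexx 1))/andP[u0 ut].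
    by apply: av; rewrite ut (lt_trans t0).
- move=> y [u /andP[u0 u1] <-]; case: (lerP u t) => ut.
    exists (subpath h 0 t); rewrite ?inE ?eqxx //; exists (u / t).
      by rewrite divr_ge0 ?(ltW t0) //= ler_pdivrMr // mul1r.
    by rewrite /subpath subr0 divfK ?gt_eqF // add0r.
  have t10 : 0 < 1 - t by rewrite subr_gt0.
  exists (subpath h t 1); rewrite ?inE ?eqxx ?orbT //; exists ((u - t) / (1 - t)).
    by rewrite divr_ge0 ?subr_ge0 ?(ltW t1) ?(ltW ut) //= ler_pdivrMr // mul1r lerD2r.
  by rewrite /subpath divfK ?gt_eqF // addrC subrK.
- by move=> g; rewrite !inE => /orP[] /eqP ->; rewrite subpath0 subpath1 hx; split; auto.
Qed.

(** With [P] the list of all endpoints of [L], every endpoint of [L'] lies in [P] again, so one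
    round of cutting suffices for a graph. *)
Lemma subdivide_edges M (L : seq (R -> M)) (P : seq M) :
  (forall h, h \in L -> edge h) ->
  exists L' : seq (R -> M), [/\ forall g, g \in L' -> edge g,
    forall g x, g \in L' -> x \in P -> avoids g x,
    forall h y, h \in L -> trace h y -> exists2 g, g \in L' & trace g y
    & forall g, g \in L' -> (g 0 \in P \/ exists2 h, h \in L & g 0 = h 0) /\
                            (g 1 \in P \/ exists2 h, h \in L & g 1 = h 1)].
Proof.
elim: P => [|x P IH] Le.
  exists L; split => //.
    by move=> h y hL hy; exists h.
  by move=> g gL; split; right; exists g.
have [L1 [e1 av1 c1 n1]] := IH Le.
have /choice[cut cutP] : forall h : R -> M, exists L' : seq (R -> M), edge h ->
   [/\ forall g, g \in L' -> edge g /\ avoids g x,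
    forall g y, g \in L' -> avoids h y -> avoids g y,
    forall y, trace h y -> exists2 g, g \in L' & trace g y
    & forall g, g \in L' -> (g 0 = h 0 \/ g 0 = x) /\ (g 1 = h 1 \/ g 1 = x)].
  move=> h; case: (pselect (edge h)) => [/(@cut_edge _ _ x)[L' ?]|]; first by exists L'.
  by exists [::].
exists (flatten (map cut L1)); split.
- move=> g /flattenP[_ /mapP[h hL ->] gh].
  by have [/(_ g gh)[]] := cutP h (e1 _ hL).
- move=> g y /flattenP[_ /mapP[h hL ->] gh]; have [P1 P2 _ _] := cutP h (e1 _ hL).
  rewrite inE => /orP[/eqP ->|yP]; first by case: (P1 _ gh).
  by apply: P2 => //; apply: av1.
- move=> h y hL hy; have [g gL gy] := c1 h y hL hy.
  have [_ _ P3 _] := cutP g (e1 _ gL); have [f fg fy] := P3 _ gy.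
  by exists f => //; apply/flattenP; exists (cut g) => //; apply: map_f.
- move=> g /flattenP[_ /mapP[h hL ->] gh]; have [_ _ _ /(_ g gh)[P1 P2]] := cutP h (e1 _ hL).
  have [Q1 Q2] := n1 h hL; split.
    case: P1 => ->; last by left; rewrite inE eqxx.
    by case: Q1 => [q|q]; [left; rewrite inE q orbT|right].
  case: P2 => ->; last by left; rewrite inE eqxx.
  by case: Q2 => [q|q]; [left; rewrite inE q orbT|right].
Qed.

Lemma finite_edge_cover M : exists L : seq (R -> M),
  (forall h, h \in L -> edge h) /\ forall x, exists2 h, h \in L & trace h x.
Proof.
have /compact_near_coveringP nc := @omanifold_compact R M.
have /choice[h hP] : forall x : M, exists h : R -> M, edge h /\ nbhs x (trace h).
  by move=> x; have [h ? ?] := local_edge x; exists h.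
(* A property is eventual for [F] if it holds for all lists containing some finite family of the
   chosen edges. Compactness, as near covering, turns the eventual covering of each point into one
   list covering all points. *)
pose F : set_system (seq (R -> M)) := [set P | exists s : seq M,
  forall L : seq (R -> M), {subset map h s <= L} -> P L].
have FF : Filter F.
  split.
  - by exists [::].
  - move=> P Q [s sP] [s' sQ]; exists (s ++ s') => L sL; split.
      by apply: sP => g gs; apply: sL; rewrite map_cat mem_cat gs.
    by apply: sQ => g gs; apply: sL; rewrite map_cat mem_cat gs orbT.
  - by move=> P Q PQ [s sP]; exists s => L sL; apply: PQ; apply: sP.
have [|s sP] := nc _ F (fun L x => exists2 g, g \in L & trace g x) FF.
  move=> x _; exists (trace (h x), [set L : seq (R -> M) | h x \in L]) => /=.
    split; first by case: (hP x).
    by exists [:: x] => L; apply; rewrite inE.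
  by move=> [y L] /= [hy hL]; exists (h x).
exists (map h s); split.
  by move=> _ /mapP[x _ ->]; case: (hP x).
by move=> x; apply: sP.
Qed.

End Subdivision.

(** * Decomposition into arcs and loops *)

Section EdgeDecompositions.
Variable R : realType.
Implicit Type M : omanifold R.

Lemma trace_closed M (h : R -> M) : continuous h -> closed (trace h).
Proof.
move=> ch; apply: compact_closed; first exact: omanifold_hausdorff.
have -> : trace h = h @` `[0, 1]%classic.
  by apply/seteqP; split => x [t t01 <-]; exists t.
apply: continuous_compact; last exact: segment_compact.
exact: continuous_subspaceT.
Qed.

Lemma closed_itv01 (C : set R) : closed C -> (forall t, 0 < t < 1 -> C t) ->
  forall t, 0 <= t <= 1 -> C t.
Proof.
move=> clC C01 t /andP[t0 t1]; apply: clC => B /nbhs_distP[e e0 eB].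
pose d := Num.min e 1.
have d0 : 0 < d by rewrite lt_min e0 ltr01.
have [de d1] : d <= e /\ d <= 1 by rewrite !ge_min !lexx orbT.
(* Moving from [t] towards the midpoint 1/2 enters the open interval, whichever end [t] may be. *)
clearbody d; pose s := t + d * (1 / 2 - t).
exists s; split.
  apply: C01; rewrite /s; apply/andP; split; nra.
apply: eB; rewrite /s [t + _]addrC addrK normrM gtr0_norm //.
have : `|1 / 2 - t| <= 1 / 2 by rewrite ler_norml; lra.
by move: (`|1 / 2 - t|) => z z2; nra.
Qed.

Definition concat (T : Type) (g h : R -> T) (t : R) : T :=
  if t <= 1 / 2 then g (2 * t) else h (2 * t - 1).

Lemma double_continuous : continuous (fun t : R => 2 * t).
Proof. by move=> t; apply: mulrl_continuous. Qed.

Lemma double1_continuous : continuous (fun t : R => 2 * t - 1).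
Proof.
move=> t; apply: (@continuousB _ _ _ (fun t : R => 2 * t) (fun=> 1)).
  exact: double_continuous.
exact: cst_continuous.
Qed.

Lemma concat_continuous M (g h : R -> M) :
  continuous g -> continuous h -> g 1 = h 0 -> continuous (concat g h).
Proof.
move=> cg ch gh t W.
have cg2 := @comp_continuous _ _ _ _ g (@double_continuous) cg.
have ch2 := @comp_continuous _ _ _ _ h (@double1_continuous) ch.
rewrite /concat; case: (ltgtP t (1 / 2)) => th Wt.
- have P1 : nbhs t [set s | W (g (2 * s))] := cg2 t _ Wt.
  change (nbhs t ((concat g h) @^-1` W)).
  apply: filterS (filterI P1 (lt_nbhsl th)) => s /= [].
  by rewrite /concat => + /ltW ->.
- have P1 : nbhs t [set s | W (h (2 * s - 1))] := ch2 t _ Wt.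
  change (nbhs t ((concat g h) @^-1` W)).
  apply: filterS (filterI P1 (lt_nbhsr th)) => s /= [].
  by rewrite /concat leNgt => + ->.
- have P1 : nbhs t [set s | W (g (2 * s))] := cg2 t _ Wt.
  have P2 : nbhs t [set s | W (h (2 * s - 1))].
    apply: (ch2 t); rewrite /= th (_ : 2 * (1 / 2) - 1 = 0) -?gh; last by lra.
    by move: Wt; rewrite th (_ : 2 * (1 / 2) = 1) //; lra.
  change (nbhs t ((concat g h) @^-1` W)).
  by apply: filterS (filterI P1 P2) => s /= []; rewrite /concat; case: ifP.
Qed.

(** At the joint the values on the two sides are compared through the common value at
    [g 1 = h 0]. *)
Lemma concat_rising M (g h : R -> M) :
  continuous g -> continuous h -> rising g -> rising h -> g 1 = h 0 ->
  rising (concat g h).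
Proof.
move=> cg ch rg rh gh t c /andP[t0 t1] ac.
rewrite {1}/concat; case: (ltgtP t (1 / 2)) => th dt.
- have [|W Wn WP] := rg _ _ _ ac dt; first by lra.
  exists (((fun t : R => 2 * t) @^-1` W) `&` [set s | s < 1 / 2]).
    by apply: filterI; [exact: double_continuous|exact: lt_nbhsl].
  move=> u v [/= Wu u2] [/= Wv v2] u01 v01 uv; rewrite /concat !ltW //.
  by apply: WP => //; lra.
- have [|W Wn WP] := rh _ _ _ ac dt; first by lra.
  exists (((fun t : R => 2 * t - 1) @^-1` W) `&` [set s | 1 / 2 < s]).
    by apply: filterI; [exact: double1_continuous|exact: lt_nbhsr].
  move=> u v [/= Wu u2] [/= Wv v2] u01 v01 uv; rewrite /concat !leNgt u2 v2 /=.
  by apply: WP => //; lra.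
- have dg : chart_dom c (g 1) by move: dt; rewrite th (_ : 2 * (1 / 2) = 1) //; lra.
  have dh : chart_dom c (h 0) by rewrite -gh.
  have [|W Wn WP] := rg _ _ _ ac dg; first by lra.
  have [|V Vn VP] := rh _ _ _ ac dh; first by lra.
  have W1 := nbhs_singleton Wn; have V0 := nbhs_singleton Vn.
  exists (((fun t : R => 2 * t) @^-1` W) `&` ((fun t : R => 2 * t - 1) @^-1` V)).
    apply: filterI; [apply: double_continuous|apply: double1_continuous].
      by rewrite th (_ : 2 * (1 / 2) = 1) //; lra.
    by rewrite th (_ : 2 * (1 / 2) - 1 = 0) //; lra.
  move=> u v [/= Wu Vu] [/= Wv Vv] u01 v01 uv; rewrite /concat.
  case: (lerP u (1 / 2)) => u2; case: (lerP v (1 / 2)) => v2.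
  + by apply: WP => //; lra.
  + apply: (@le_lt_trans _ _ (chart_map c (g 1))).
      have [->|un] := eqVneq (2 * u) 1; first by [].
      by apply/ltW/WP => //; [lra|lra|rewrite lt_neqAle un; lra].
    by rewrite gh; apply: VP => //; lra.
  + by lra.
  + by apply: VP => //; lra.
Qed.

(** The joint becomes an interior point and must not be met again; this is why neither path may be a
    loop. The case [g 0 = h 1] remains allowed, and then the result is a loop. *)
Lemma concat_edge M (g h : R -> M) : edge g -> edge h -> g 1 = h 0 ->
  (forall t u, 0 < t < 1 -> 0 <= u <= 1 -> g t <> h u) ->
  (forall t u, 0 < t < 1 -> 0 <= u <= 1 -> h t <> g u) ->
  g 0 <> g 1 -> h 0 <> h 1 -> edge (concat g h).
Proof.
move=> [cg rg ig] [ch rh ih] gh d1 d2 ng nh; split.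
- exact: concat_continuous.
- exact: concat_rising.
have z01 : 0 <= (0 : R) <= 1 by rewrite lexx ler01.
have o01 : 0 <= (1 : R) <= 1 by rewrite lexx ler01.
move=> t u t01 u01; rewrite /concat; case: (lerP t (1 / 2)) => t2; case: (lerP u (1 / 2)) => u2.
- have [t1|tn] := eqVneq (2 * t) 1.
    rewrite t1 => E; have [u1|un] := eqVneq (2 * u) 1; first by lra.
    have [u0|un0] := eqVneq (2 * u) 0; first by rewrite u0 in E; case: ng.
    suff : 2 * u = 1 by lra.
    apply: ig => //; rewrite lt_neqAle eq_sym un0 lt_neqAle un; lra.
  move=> E; suff : 2 * t = 2 * u by lra.
  by apply: ig => //; [rewrite [_ < 1]lt_neqAle tn; lra|lra].
- have [t1|tn] := eqVneq (2 * t) 1.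
    rewrite t1 gh => E; have [u1|un] := eqVneq (2 * u - 1) 1; first by rewrite u1 in E.
    suff : 2 * u - 1 = 0 by lra.
    by apply: ih => //; rewrite [_ < 1]lt_neqAle un; lra.
  by move=> E; case: (d1 (2 * t) (2 * u - 1)) => //; [rewrite [_ < 1]lt_neqAle tn; lra|lra].
- move=> E; case: (d2 (2 * t - 1) (2 * u)) => //; lra.
- move=> E; suff : 2 * t - 1 = 2 * u - 1 by lra.
  by apply: ih => //; lra.
Qed.

Lemma trace_concat M (g h : R -> M) (x : M) :
  g 1 = h 0 -> trace g x \/ trace h x -> trace (concat g h) x.
Proof.
move=> gh [[t t01 <-]|[t t01 <-]].
  exists (t / 2); first by lra.
  rewrite /concat ifT; last by lra.
  by congr g; lra.
have [->|tn] := eqVneq t 0.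
  exists (1 / 2); first by lra.
  by rewrite /concat lexx -gh; congr g; lra.
exists ((t + 1) / 2); first by lra.
have t0 : 0 < t by rewrite lt_neqAle eq_sym tn; lra.
rewrite /concat ifN -?ltNge; last by lra.
by congr h; lra.
Qed.

Record edge_decomposition M n (h : 'I_n -> R -> M) : Prop := {
  dec_edge : forall k, edge (h k);
  dec_cover : forall x, exists k, trace (h k) x;
  dec_disjoint : forall k l x, trace (h k) x -> trace (h l) x -> k = l }.

(** Interiors avoid all endpoints, but two edges may still overlap along their interiors or share
    endpoints. A graph with the least number of edges has neither. *)
Definition edge_graph M n (h : 'I_n -> R -> M) : Prop :=
  [/\ forall k, edge (h k), forall x, exists k, trace (h k) x
    & forall k l, avoids (h k) (h l 0) /\ avoids (h k) (h l 1)].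

Lemma edge_graph_exists M : exists n (h : 'I_n -> R -> M), edge_graph h.
Proof.
have [L [Le Lc]] := finite_edge_cover M.
pose P := [seq h 0 | h : R -> M <- L] ++ [seq h 1 | h : R -> M <- L].
have [L' [L'e L'a L'c L'n]] := subdivide_edges P Le.
exists (size L'), (tnth (in_tuple L')); split.
- by move=> k; apply: L'e; apply: mem_tnth.
- move=> x; have [h hL hx] := Lc x; have [g gL gx] := L'c h x hL hx.
  by have /tnthP[k gk] : g \in in_tuple L' by []; exists k; rewrite -gk.
- move=> k l; have /L'n[Q0 Q1] : tnth (in_tuple L') l \in L' by exact: mem_tnth.
  have kL : tnth (in_tuple L') k \in L' by exact: mem_tnth.
  split; apply: L'a => //.
    case: Q0 => // -[h hL ->]; rewrite mem_cat.
    by rewrite (map_f (fun h : R -> M => h 0) hL).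
  case: Q1 => // -[h hL ->]; rewrite mem_cat.
  by rewrite (map_f (fun h : R -> M => h 1) hL) orbT.
Qed.

Section Minimal.
Variables (M : omanifold R) (n : nat) (h : 'I_n -> R -> M).
Hypothesis gh : edge_graph h.
Hypothesis min_n : forall m (g : 'I_m -> R -> M), edge_graph g -> (n <= m)%N.

Lemma trace0 (g : R -> M) : trace g (g 0).
Proof. by exists 0; rewrite ?lexx ?ler01. Qed.

(* Otherwise [h k] would run inside [h l] and could be dropped. *)
Lemma interiors_disjoint k l t u :
  0 < t < 1 -> 0 < u < 1 -> h k t = h l u -> k = l.
Proof.
move=> t01 u01 E; apply/eqP/negPn/negP => kl.
have [he hc ha] := gh.
have ck := edge_continuous (he k); have cl := edge_continuous (he l).
have clC : closed (h k @^-1` trace (h l)).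
  by apply: closed_comp => [? _|]; [exact: ck|exact: trace_closed].
have sub : trace (h k) `<=` trace (h l).
  suff S : forall s, 0 < s < 1 -> trace (h l) (h k s).
    by move=> _ [s s01 <-]; exact: (closed_itv01 clC S).
  (* The interior parameters at which [h k] lies on [h l] form a subset of []0, 1[] that is closed,
     traces being closed, and open: by the graph property such a point is interior to [h l], where
     [rising_nbhs] gives a neighbourhood inside the trace. Connectedness makes it all of []0,
     1[]. *)
  have /connected_intervalP conn := @interval_is_interval R (Interval (BRight 0) (BLeft 1)).
  have BE : `]0, 1[ `&` (h k @^-1` trace (h l)) = `]0, 1[%classic.
    apply: conn.
    - by exists t; split; rewrite /= ?in_itv //=; exists u => //; rewrite !ltW //; case/andP: u01.
    - exists (h k @^-1` (interior (trace (h l)))).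
        apply: open_comp => [? _|]; [exact: ck|exact: open_interior].
      apply/seteqP; split => s [s01 ls]; split => //; last exact: interior_subset ls.
      rewrite /= in_itv /= in s01; case: ls => v v01 vE /=.
      have [v0|v0] := eqVneq v 0.
        by case: (ha k l) => /(_ s s01); rewrite -vE v0.
      have [v1|v1] := eqVneq v 1.
        by case: (ha k l) => _ /(_ s s01); rewrite -vE v1.
      have vv : 0 < v < 1 by rewrite !lt_neqAle eq_sym v0 v1.
      rewrite -vE /interior.
      apply: filterS (rising_nbhs cl (edge_rising (he l)) vv ltr01).
      by move=> _ [w [w01 _] <-]; exists w => //; rewrite !ltW //; case/andP: w01.
    - by exists (h k @^-1` trace (h l)).
  move=> s s01; have : (`]0, 1[%classic : set R) s by rewrite /= in_itv.
  by rewrite -BE => -[].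
case: n h gh min_n k l {t u t01 u01 E ck cl clC} kl he hc ha sub => [|m] h' gh' min' k l kl he hc ha sub.
  by have := ltn_ord k.
suff /min' : edge_graph (fun j => h' (lift k j)) by rewrite ltnn.
split => [j|x|i j]; [exact: he| |exact: ha].
have [i ix] := hc x; case: (unliftP k i) => [j ij|ik]; first by exists j; rewrite -ij.
rewrite ik in ix; have lx := sub _ ix.
by case: (unliftP k l) => [j lj|lk]; [exists j; rewrite -lj|rewrite lk eqxx in kl].
Qed.

Lemma starts_disjoint k l : h k 0 = h l 0 -> k = l.
Proof.
have [he _ _] := gh; have [ck rk _] := he k; have [cl rl _] := he l.
move=> E; have [t [u [t01 u01 tu]]] := rising_meet0 ck rk cl rl E.
exact: interiors_disjoint tu.
Qed.

Lemma stops_disjoint k l : h k 1 = h l 1 -> k = l.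
Proof.
have [he _ _] := gh; have [ck rk _] := he k; have [cl rl _] := he l.
move=> E; have [t [u [t01 u01 tu]]] := rising_meet1 ck rk cl rl E.
exact: interiors_disjoint tu.
Qed.

Lemma interior_disjoint k l t u : 0 < t < 1 -> 0 <= u <= 1 -> h k t = h l u -> k = l.
Proof.
move=> t01 u01 E; have [_ _ ha] := gh.
have [v0|v0] := eqVneq u 0; first by case: (ha k l) => /(_ t t01); rewrite E v0.
have [v1|v1] := eqVneq u 1; first by case: (ha k l) => _ /(_ t t01); rewrite E v1.
by apply: interiors_disjoint E; rewrite // !lt_neqAle eq_sym v0 v1.
Qed.

(* Otherwise the two edges could be replaced by their concatenation. *)
Lemma stop_start_disjoint k l : h k 1 = h l 0 -> k = l.
Proof.
move=> E; apply/eqP/negPn/negP => kl.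
have [he hc ha] := gh.
have nk : h k 0 <> h k 1 by rewrite E => /starts_disjoint/eqP; rewrite (negbTE kl).
have nl : h l 0 <> h l 1 by rewrite -E => /stops_disjoint/eqP; rewrite (negbTE kl).
have ed : edge (concat (h k) (h l)).
  apply: concat_edge => // t u t01 u01 tu; move/eqP: kl; apply.
    exact: interior_disjoint tu.
  exact/esym/(interior_disjoint t01 u01).
have int t : 0 < t < 1 -> (exists2 s, 0 < s < 1 & concat (h k) (h l) t = h k s) \/
    (exists2 s, 0 < s < 1 & concat (h k) (h l) t = h l s) \/ concat (h k) (h l) t = h k 1.
  move=> t01; rewrite /concat; case: (ltgtP t (1 / 2)) => t2.
  - by left; exists (2 * t) => //; lra.
  - by right; left; exists (2 * t - 1) => //; lra.
  - by right; right; congr (h k _); lra.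
have av j : (j != l -> avoids (concat (h k) (h l)) (h j 0)) /\
            (j != k -> avoids (concat (h k) (h l)) (h j 1)).
  split => jn t /int[[s s01 ->]|[[s s01 ->]|->]].
  - by case: (ha k j) => + _; apply.
  - by case: (ha l j) => + _; apply.
  - by rewrite E => /starts_disjoint/eqP; rewrite eq_sym (negbTE jn).
  - by case: (ha k j) => _; apply.
  - by case: (ha l j) => _; apply.
  - by move/stops_disjoint/eqP; rewrite eq_sym (negbTE jn).
case: n h gh min_n k l kl E he hc ha nk nl ed av {int} => [|m] h' gh' min' k l kl E he hc ha nk nl ed av.
  by have := ltn_ord k.
(* The index [l] is skipped and the slot of [k] takes the concatenation. The joint stops being an
   endpoint, which is why [av] excludes just [h l 0] and [h k 1]. *)
pose g j := if lift l j == k then concat (h' k) (h' l) else h' (lift l j).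
have c0 : concat (h' k) (h' l) 0 = h' k 0.
  by rewrite /concat ifT ?mulr0 //; lra.
have c1 : concat (h' k) (h' l) 1 = h' l 1.
  rewrite /concat ifN -?ltNge; last by lra.
  by congr h'; lra.
suff /min' : edge_graph g by rewrite ltnn.
split => [j|x|i j].
- by rewrite /g; case: ifP.
- have [i ix] := hc x.
  have [j jk|lk] := unliftP l k; last by rewrite lk eqxx in kl.
  have [ii|ii] := boolP ((i == l) || (i == k)).
    exists j; rewrite /g -jk eqxx; apply: trace_concat => //.
    by case/orP: ii ix => /eqP -> ?; [right|left].
  case/norP: ii => il ik; have [i' iE|iE] := unliftP l i; last by rewrite iE eqxx in il.
  by exists i'; rewrite /g -iE (negbTE ik).
- have nl' : lift l j != l by rewrite eq_sym neq_lift.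
  have g0 : g j 0 = h' (lift l j) 0.
    by rewrite /g; case: ifP => // /eqP ->.
  have g1 : exists2 j', j' != k & g j 1 = h' j' 1.
    rewrite /g; case: ifP => [_|/negbT jk]; last by exists (lift l j).
    by exists l; rewrite // eq_sym.
  rewrite g0; case: g1 => j' j'k ->; rewrite /g; case: ifP => _.
    by split; case: (av (lift l j)) (av j') => [a0 _] [_ a1]; [exact: a0|exact: a1].
  by split; [case: (ha (lift l i) (lift l j))|case: (ha (lift l i) j')].
Qed.

Lemma minimal_decomposition : edge_decomposition h.
Proof.
have [he hc _] := gh; split => // k l x [t t01 <-] [u u01] E.
case: (itv01P t01) => tE; last by apply: (interior_disjoint tE u01); rewrite E.
  case: (itv01P u01) => uE; last by apply/esym/(interior_disjoint uE t01).
    by rewrite tE uE in E; apply: starts_disjoint.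
  by rewrite tE uE in E; apply/esym/stop_start_disjoint.
case: (itv01P u01) => uE; last by apply/esym/(interior_disjoint uE t01).
  by rewrite tE uE in E; apply: stop_start_disjoint.
by rewrite tE uE in E; apply: stops_disjoint.
Qed.

End Minimal.

Theorem edge_decomposition_exists M :
  exists n (h : 'I_n -> R -> M), edge_decomposition h.
Proof.
pose P n := `[< exists h : 'I_n -> R -> M, edge_graph h >].
have exP : exists n, P n.
  by have [n [h gh]] := edge_graph_exists M; exists n; apply/asboolP; exists h.
case: (ex_minnP exP) => n /asboolP[h gh] min_n; exists n, h.
apply: minimal_decomposition => // m g gg; apply: min_n.
by apply/asboolP; exists g.
Qed.

End EdgeDecompositions.

(** * Maps out of a decomposed manifold, and its boundary *)

Section DecompositionMaps.
Variable R : realType.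
Implicit Type M : omanifold R.

(** [true] is the sign of initial points, whence the parameter 0. *)
Definition endpoint (s : bool) : R := if s then 0 else 1.

Lemma endpoint_itv s : 0 <= endpoint s <= 1.
Proof. by case: s; rewrite /= ?lexx ler01. Qed.

Lemma arc_inj M (h : R -> M) : edge h -> h 0 <> h 1 ->
  forall t u, 0 <= t <= 1 -> 0 <= u <= 1 -> h t = h u -> t = u.
Proof.
move=> eh h01.
move=> t u t01 u01 E.
case: (itv01P t01) => tE; last exact: (edge_inj eh) E.
  case: (itv01P u01) => uE; last by apply/esym/(edge_inj eh).
    by rewrite tE uE.
  by rewrite tE uE in E; case: h01.
case: (itv01P u01) => uE; last by apply/esym/(edge_inj eh).
  by rewrite tE uE in E; case: h01.
by rewrite tE uE.
Qed.

Lemma image_itv_closed M (h : R -> M) (C : set R) :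
  continuous h -> closed C -> closed (h @` [set t | 0 <= t <= 1 /\ C t]).
Proof.
move=> ch clC; apply: compact_closed; first exact: omanifold_hausdorff.
apply: continuous_compact; first exact: continuous_subspaceT.
have -> : [set t | 0 <= t <= 1 /\ C t] = `[0, 1]%classic `&` C.
  by apply/seteqP; split => t /=; rewrite in_itv.
by apply: compact_closedI; [exact: segment_compact|].
Qed.

Lemma half_lineP s (r : R) : half_line s r <-> (if s then 0 <= r else r <= 0).
Proof. by case: s. Qed.

Section Decomposition.
Variables (M : omanifold R) (n : nat) (h : 'I_n -> R -> M).
Hypothesis dh : edge_decomposition h.

Lemma dec_param x : exists k t, 0 <= t <= 1 /\ h k t = x.
Proof. by have [k [t t01 tx]] := dec_cover dh x; exists k, t. Qed.

Lemma dec_same k l t u : 0 <= t <= 1 -> 0 <= u <= 1 -> h k t = h l u -> k = l.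
Proof.
by move=> t01 u01 E; apply: (dec_disjoint dh (x := h k t)); [exists t|exists u].
Qed.

(** Distinct edges are disjoint, so a map defined edge by edge has to be consistent only within each
    edge, that is, where a loop closes. *)
Lemma dec_factor (X : Type) (f : 'I_n -> R -> X) :
  (forall k t u, 0 <= t <= 1 -> 0 <= u <= 1 -> h k t = h k u -> f k t = f k u) ->
  exists F : M -> X, forall k t, 0 <= t <= 1 -> F (h k t) = f k t.
Proof.
move=> fP.
have /choice[F FP] : forall x, exists y, forall k t, 0 <= t <= 1 -> h k t = x -> y = f k t.
  move=> x; have [k [t [t01 tx]]] := dec_param x; exists (f k t) => l u u01 ux.
  rewrite -ux in tx; have kl := dec_same t01 u01 tx.
  by rewrite -kl in tx *; apply: fP.
by exists F => k t t01; apply: FP.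
Qed.

(** The preimage of a closed set is a finite union of continuous images of compact sets of
    parameters. *)
Lemma dec_continuous (X : topologicalType) (F : M -> X) (f : 'I_n -> R -> X) :
  (forall k t, 0 <= t <= 1 -> F (h k t) = f k t) -> (forall k, continuous (f k)) ->
  continuous F.
Proof.
move=> Ff cf; apply/continuous_closedP => A clA.
have -> : F @^-1` A = \bigcup_(k in [set: 'I_n]) (h k @` [set t | 0 <= t <= 1 /\ (f k @^-1` A) t]).
  apply/seteqP; split => [x Ax|x [k _ [t [t01 At] <-]]]; last by rewrite /= Ff.
  have [k [t [t01 tx]]] := dec_param x; exists k => //; exists t => //; split => //=.
  by rewrite -Ff // tx.
apply: closed_bigcup => [|k _]; first exact: finite_finset.
apply: image_itv_closed; first exact: edge_continuous (dec_edge dh k).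
by apply: (iffLR (continuous_closedP (f k))).
Qed.

(** A union of traces is closed, and its complement is the union of the remaining traces. *)
Lemma trace_clopen (D : set 'I_n) :
  closed (\bigcup_(k in D) trace (h k)) /\ open (\bigcup_(k in D) trace (h k)).
Proof.
have cl (E : set 'I_n) : closed (\bigcup_(k in E) trace (h k)).
  apply: closed_bigcup => [|k _]; first exact: finite_finset.
  exact/trace_closed/(edge_continuous (dec_edge dh k)).
split => //; rewrite -closedC (_ : ~` _ = \bigcup_(k in ~` D) trace (h k)) //.
apply/seteqP; split => [x nx|x [k nk kx] [l Dl lx]].
  have [k kx] := dec_cover dh x; exists k => // Dk; apply: nx; by exists k.
by apply: nk; rewrite /= (dec_disjoint dh kx lx).
Qed.

(** From the clopen trace one removes the compact image of the parameters at distance at least [e]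
    from [t]; injectivity keeps [h k t]. In contrast to [rising_nbhs], this covers the ends of the
    arc. *)
Lemma arc_nbhs k t e : h k 0 <> h k 1 -> 0 <= t <= 1 -> 0 < e ->
  nbhs (h k t) (h k @` [set u | 0 <= u <= 1 /\ `|u - t| < e]).
Proof.
move=> hk t01 e0.
pose C := h k @` [set u | 0 <= u <= 1 /\ [set v : R | e <= `|v - t|] u].
have clC : closed C.
  apply: image_itv_closed; first exact: edge_continuous (dec_edge dh k).
  rewrite -openC (_ : ~` _ = ball t e); first exact: ball_open.
  by apply/seteqP; split => v; rewrite /ball /= distrC ltNge => /negP.
have [_ oT] := trace_clopen [set k].
have : nbhs (h k t) ((\bigcup_(j in [set k]) trace (h j)) `&` ~` C).
  apply: open_nbhs_nbhs; split; first by apply: openI => //; apply: closed_openC.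
  split; first by exists k => //; exists t.
  move=> [u [u01 /= eu] /(arc_inj (dec_edge dh k) hk u01 t01) ut].
  by rewrite ut subrr normr0 leNgt e0 in eu.
apply: filterS => x [[_ -> [u u01 ux]] nC]; exists u => //; split => //.
by rewrite ltNge; apply/negP => eu; apply: nC; exists u.
Qed.

(** At a parameter of [x] other than [endpoint s], a small move towards [endpoint s] would push the
    chart value beyond the origin of the half-line. So every parameter of [x] is [endpoint s]. *)
Lemma boundary_signP x s : boundary_sign x s ->
  exists2 k, h k 0 <> h k 1 & x = h k (endpoint s).
Proof.
move=> [c [ac dc cs cx]].
have key k t : 0 <= t <= 1 -> h k t = x -> t = endpoint s.
  move=> t01 tx; rewrite -tx in dc cx.
  have [ch rh _] := dec_edge dh k.
  have [e e0 [eD eI]] := rising_box ch rh t01 ac dc.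
  apply/eqP/negPn/negP => ts.
  pose d := Num.min e 1; have d0 : 0 < d by rewrite lt_min e0 ltr01.
  have [de d1] : d <= e /\ d <= 1 by rewrite !ge_min !lexx orbT.
  (* The factor [d / 2], with [d] at most [e] and 1, keeps [u] both in [0,1] and in the range where
     [h k] is known to be increasing. *)
  pose u := t + d / 2 * (endpoint s - t).
  have [u01 ut] : 0 <= u <= 1 /\ `|u - t| < e.
    have nt : `|endpoint s - t| <= 1.
      by rewrite ler_norml; have := endpoint_itv s; lra.
    have := endpoint_itv s; move: (endpoint s) nt (d) d0 de d1 @u => p nt d' d0 de d1 /= p01.
    split; first by nra.
    rewrite [t + _]addrC addrK normrM gtr0_norm ?divr_gt0 //.
    by move: (`|p - t|) nt => z z1; nra.
  have /half_lineP := chart_half_line ac (eD _ ut); rewrite cs.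
  have tt : `|t - t| < e by rewrite subrr normr0.
  case: (s) ts @u u01 ut => /= ts u01 ut hl.
    have lt_ut : t + d / 2 * (0 - t) < t.
      have t0 : 0 < t by rewrite lt_neqAle eq_sym ts; case/andP: t01.
      by have := mulr_gt0 d0 t0; lra.
    by have := eI _ _ ut tt u01 t01 lt_ut; rewrite cx; move: hl; lra.
  have lt_tu : t < t + d / 2 * (1 - t).
    have t1 : 0 < 1 - t by rewrite subr_gt0 lt_neqAle ts; case/andP: t01.
    by have := mulr_gt0 d0 t1; lra.
  by have := eI _ _ tt ut t01 u01 lt_tu; rewrite cx; move: hl; lra.
have [k [t [t01 tx]]] := dec_param x.
exists k; last by rewrite -tx; congr h; exact: key tx.
(* On a loop both 0 and 1 would be parameters of [x], and [key] would make them equal. *)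
move=> E.
have k0 : 0 <= (0 : R) <= 1 by rewrite lexx ler01.
have k1 : 0 <= (1 : R) <= 1 by rewrite lexx ler01.
have xs := key _ _ t01 tx.
have : (0 : R) = 1.
  have e0 : h k 0 = x by case: (s) xs => /= ts; rewrite -tx ts.
  by rewrite (key _ _ k0 e0) -(key k 1) // -E.
by move/eqP; rewrite eq_sym oner_eq0.
Qed.

(** Near an end of an arc all points come from parameters on one side, so the chart value of that
    end is extremal among the nearby ones. In a half-line only the origin, on the matching side, is
    extremal in this way. *)
Lemma boundary_sign_arc k s : h k 0 <> h k 1 -> boundary_sign (h k (endpoint s)) s.
Proof.
move=> hk; set x := h k _; have [c ac dx] := atlas_cover x.
have [ch rh _] := dec_edge dh k.
have s01 := endpoint_itv s.
have [e e0 [eD eI]] := rising_box ch rh s01 ac dx.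
have [O /nbhs_distP[d d0 Od] OP] := chart_map_open ac dx (arc_nbhs hk s01 e0).
have hx := chart_half_line ac dx.
have ss : `|endpoint s - endpoint s| < e by rewrite subrr normr0.
(* No value of the chart lies on the outer side of its value at [x]. *)
have out r : `|r - chart_map c x| < d -> half_line (chart_side c) r ->
    if s then chart_map c x <= r else r <= chart_map c x.
  move=> rd hr; have [y [[u [u01 ue] uy] dy] <-] := OP r (Od _ rd) hr; rewrite -uy /x.
  have [->|us] := eqVneq u (endpoint s); first by case: (s).
  case/andP: (u01) => u0 u1; case: ifP => sE; apply/ltW/eI => //.
    by rewrite lt_neqAle eq_sym us sE.
  by rewrite lt_neqAle us sE.
have d2 : 0 < d / 2 by rewrite divr_gt0.
have d2d : d / 2 < d by exact: half_lt.
move cz : (chart_map c x) hx out => z hz out.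
suff [sE z0] : chart_side c = s /\ z = 0.
  by exists c; split => //; rewrite cz.
case: (chart_side c) hz out => /= hz out; case: (s) out => out.
- split => //; apply/eqP/negPn/negP => z0.
  have zz : 0 < z by rewrite lt_neqAle eq_sym z0.
  have := out (z - Num.min (d / 2) z); set m := Num.min _ _.
  have m0 : 0 < m by rewrite lt_min d2 zz.
  have [m1 m2] : m <= d / 2 /\ m <= z by rewrite !ge_min !lexx orbT.
  rewrite ltr_norml; clearbody m => F.
  have : z <= z - m by apply: F; lra.
  by lra.
- have : z + d / 2 <= z by apply: out; [rewrite ltr_norml; lra|lra].
  by lra.
- have : z <= z - d / 2 by apply: out; [rewrite ltr_norml; lra|lra].
  by lra.
- split => //; apply/eqP/negPn/negP => z0.
  have zz : z < 0 by rewrite lt_neqAle z0.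
  have := out (z + Num.min (d / 2) (- z)); set m := Num.min _ _.
  have m0 : 0 < m by rewrite lt_min d2 oppr_gt0 zz.
  have [m1 m2] : m <= d / 2 /\ m <= - z by rewrite !ge_min !lexx orbT.
  rewrite ltr_norml; clearbody m => F.
  have : z + m <= z by apply: F; lra.
  by lra.
Qed.

Hypothesis arcs : forall k, h k 0 <> h k 1.

Lemma arcs_inj k l t u : 0 <= t <= 1 -> 0 <= u <= 1 -> h k t = h l u -> k = l /\ t = u.
Proof.
move=> t01 u01 E; have kl := dec_same t01 u01 E; split => //; subst l.
exact: (arc_inj (dec_edge dh k)) E.
Qed.

(** Near a point of an arc the order of chart values is the order of parameters, and [f k] respects
    the latter. The neighbourhoods come from [arc_nbhs], which is where [arcs] enters. *)
Lemma dec_orientation (N : omanifold R) (F : M -> N) (f : 'I_n -> R -> N) :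
  (forall k t, 0 <= t <= 1 -> F (h k t) = f k t) -> (forall k, rising (f k)) ->
  orientation_preserving F.
Proof.
move=> Ff rf c d ac ad x dx dFx; have [k [t [t01 tx]]] := dec_param x.
subst x; have [ch rh _] := dec_edge dh k.
have [e e0 [eD eI]] := rising_box ch rh t01 ac dx.
rewrite Ff // in dFx; have [W /nbhs_distP[e' e'0 e'W] WP] := rf k t d t01 ad dFx.
have e20 : 0 < Num.min e e' by rewrite lt_min e0 e'0.
exists (h k @` [set u | 0 <= u <= 1 /\ `|u - t| < Num.min e e']); first exact: arc_nbhs.
move=> _ _ [u [u01 ut] <-] [v [v01 vt] <-]; move: ut vt; rewrite !lt_min.
move=> /andP[ue ue'] /andP[ve ve'] cuv; rewrite !Ff //; apply: WP => //; try exact: e'W.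
rewrite ltNge le_eqVlt; apply/negP => /orP[/eqP vu|vu].
  by rewrite vu ltxx in cuv.
by have := lt_trans cuv (eI _ _ ve ue v01 u01 vu); rewrite ltxx.
Qed.

End Decomposition.

End DecompositionMaps.

(** * Splitting cobordisms along clopen subsets *)

Section Submanifolds.
Variable R : realType.
Implicit Type M : omanifold R.

Lemma set_type_continuous (T : topologicalType) (A : set T) : continuous (set_val : A -> T).
Proof. exact: initial_continuous. Qed.

Lemma set_type_nbhs (T : topologicalType) (A : set T) (x : A) (W : set A) :
  nbhs x W -> exists2 O, nbhs (set_val x) O & set_val @^-1` O `<=` W.
Proof.
rewrite nbhsE => -[U [[O oO OU] Ux] UW]; exists O; last by rewrite OU.
by exists O => //; split => //; rewrite -OU in Ux.
Qed.

Lemma set_type_compact (T : topologicalType) (A : set T) :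
  compact A -> compact [set: A].
Proof.
move=> cA F PF _.
have [|x [Ax clx]] := cA (set_val @ F) _.
  by change (F (set_val @^-1` A)); apply: filterE => x; exact: set_valP.
exists (SigSub (mem_set Ax)); split => // B W FB /set_type_nbhs[O Ox OW].
have [|y [[b Bb <-] Ob]] := clx (set_val @` B) O _ Ox.
  by change (F (set_val @^-1` (set_val @` B))); apply: filterS FB => b Bb; exists b.
by exists b; split => //; apply: OW.
Qed.

Lemma set_type_hausdorff (T : topologicalType) (A : set T) :
  hausdorff_space T -> hausdorff_space A.
Proof.
move=> hT p q cl; apply: val_inj; apply: hT => B C Bp Cq.
have [|| x [? ?]] := cl (set_val @^-1` B) (set_val @^-1` C).
- exact: set_type_continuous.
- exact: set_type_continuous.
by exists (set_val x).
Qed.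

Section Submanifold.
Variables (M : omanifold R) (A : set M).
Hypotheses (oA : open A) (cA : closed A).

Definition subchart (c : chart R M) : chart R A :=
  Chart (set_val @^-1` chart_dom c) (chart_map c \o set_val) (chart_side c).

Lemma subchart_is_chart c : is_chart c -> is_chart (subchart c).
Proof.
move=> [od cc ci op].
have osub : open (set_val @^-1` chart_dom c : set A).
  by apply: open_comp => // ? _; exact: set_type_continuous.
split => //=.
- rewrite continuous_open_subspace // => x /set_mem dx.
  rewrite continuous_open_subspace // in cc.
  apply: continuous_comp; first exact: set_type_continuous.
  exact/cc/mem_set.
- move=> x y /set_mem dx /set_mem dy /= E; apply: val_inj.
  by apply: ci => //; apply: mem_set.
- move=> W oW Wd; have [||O oO OE] := op (set_val @` W).
  + case: oW => U oU <-; rewrite (_ : _ @` _ = A `&` U); first exact: openI.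
    apply/seteqP; split => [_ [x Ux <-]|x [Ax Ux]]; first by split => //; exact: set_valP.
    by exists (SigSub (mem_set Ax)).
  + by move=> _ [x Wx <-]; apply: Wd.
  by exists O => //; rewrite -OE image_comp.
Qed.

Lemma submanifold_cover (x : A) :
  exists2 c, (subchart @` @atlas R M) c & chart_dom c x.
Proof.
have [c ac dx] := atlas_cover (set_val x).
by exists (subchart c) => //; exists c.
Qed.

Lemma submanifold_oriented c d : (subchart @` @atlas R M) c ->
  (subchart @` @atlas R M) d -> locally_increasing id c d.
Proof.
move=> [{}c ac <-] [{}d ad <-] x dx dy; have [W Wn WP] := atlas_oriented ac ad dx dy.
exists (set_val @^-1` W); first exact: set_type_continuous.
by move=> y z Wy Wz; apply: WP.
Qed.

Lemma submanifold_chart c : (subchart @` @atlas R M) c -> is_chart c.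
Proof. by move=> [d ad <-]; apply/subchart_is_chart/atlas_chart. Qed.

Lemma submanifold_compact : compact [set: A].
Proof.
by apply: set_type_compact; apply: subclosed_compact cA (@omanifold_compact R M) _.
Qed.

Definition submanifold : omanifold R :=
  @OManifold R (set_type A) (subchart @` @atlas R M) submanifold_compact
    (set_type_hausdorff (@omanifold_hausdorff R M)) submanifold_chart
    submanifold_cover submanifold_oriented.

Definition subval (x : submanifold) : M := set_val (x : A).

Lemma subval_orientation : orientation_preserving subval.
Proof.
move=> _ d [c ac <-] ad x dx dy; have [W Wn WP] := atlas_oriented ac ad dx dy.
exists (set_val @^-1` W); first exact: set_type_continuous.
by move=> y z Wy Wz; apply: WP.
Qed.

Lemma subval_continuous : continuous subval.
Proof. exact: set_type_continuous. Qed.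

Lemma subval_inj : injective subval.
Proof. exact: val_inj. Qed.

Lemma subvalP (x : submanifold) : A (subval x).
Proof. exact: set_valP. Qed.

Lemma subval_surj x : A x -> exists y : submanifold, subval y = x.
Proof. by move=> Ax; exists (SigSub (mem_set Ax)). Qed.

Lemma boundary_sign_sub (x : submanifold) s :
  boundary_sign x s <-> boundary_sign (subval x) s.
Proof.
split => [[_ [[c ac <-] dx cs cx]]|[c [ac dx cs cx]]]; first by exists c.
by exists (subchart c); split => //; exists c.
Qed.

Lemma sub_edge (h : R -> M) : edge h -> trace h `<=` A ->
  exists g : R -> submanifold, edge g /\ forall t, 0 <= t <= 1 -> subval (g t) = h t.
Proof.
move=> [ch rh ih] hA.
(* Outside [0,1] the path may leave [A], hence the clamp. *)
have Ah t : A (h (clamp t)) by apply: hA; exists (clamp t) => //; exact: clamp_itv.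
pose g t : submanifold := SigSub (mem_set (Ah t)).
have gE t : subval (g t) = h (clamp t) by [].
have gE' t : 0 <= t <= 1 -> subval (g t) = h t by move=> t01; rewrite gE clamp_id.
exists g; split => //; split.
- move=> t W /set_type_nbhs[O Ot OW].
  have cc := @comp_continuous _ _ _ _ h (@clamp_continuous R) ch.
  have cO : nbhs t ((h \o @clamp R) @^-1` O) := cc t O Ot.
  by apply: filterS cO => u Ou; apply: OW.
- move=> t _ t01 [c ac <-] /= dt; change (chart_dom c (subval (g t))) in dt.
  rewrite gE' // in dt.
  have [W Wn WP] := rh t c t01 ac dt.
  exists W => // u v Wu Wv u01 v01 uv /=.
  change (chart_map c (subval (g u)) < chart_map c (subval (g v))).
  by rewrite !gE' //; apply: WP.
- move=> t u t01 u01 /(congr1 subval); rewrite !gE' //; first exact: ih.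
  by case/andP: t01 => *; rewrite !ltW.
Qed.

Lemma sub_decomposition n m (h : 'I_n -> R -> M) (f : 'I_m -> 'I_n) :
  edge_decomposition h -> injective f ->
  (forall x, A x -> exists k, trace (h (f k)) x) -> (forall k, trace (h (f k)) `<=` A) ->
  exists g : 'I_m -> R -> submanifold, edge_decomposition g /\
    forall k t, 0 <= t <= 1 -> subval (g k t) = h (f k) t.
Proof.
move=> [he hc hd] fi Af fA.
have /choice[g gP] : forall k, exists g : R -> submanifold,
    edge g /\ forall t, 0 <= t <= 1 -> subval (g t) = h (f k) t.
  by move=> k; apply: sub_edge.
exists g; split; last by move=> k; case: (gP k).
have tr k x : trace (g k) x -> trace (h (f k)) (subval x).
  by move=> [t t01 <-]; exists t => //; case: (gP k) => _ ->.
split.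
- by move=> k; case: (gP k).
- move=> x; have [k [t t01 tx]] := Af _ (subvalP x); exists k; exists t => //.
  by apply: subval_inj; rewrite -tx; case: (gP k) => _ ->.
- by move=> k l x /tr kx /tr lx; apply/fi/(hd _ _ _ kx lx).
Qed.

End Submanifold.

(** The final topology comes for free: the complement of [O] is the union of the images of two
    closed subsets of compact spaces, hence compact, hence closed in the Hausdorff space [N]. *)
Lemma glued_intro (M1 M2 N : omanifold R) (i1 : M1 -> N) (i2 : M2 -> N) :
  continuous i1 -> continuous i2 -> injective i1 -> injective i2 ->
  (forall x, (exists y, i1 y = x) \/ (exists y, i2 y = x)) ->
  orientation_preserving i1 -> orientation_preserving i2 -> is_glued_from i1 i2.
Proof.
move=> c1 c2 j1 j2 cov o1 o2; split => //.
  apply/seteqP; split => // x _.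
  by case: (cov x) => -[y yx]; [left|right]; exists y.
move=> O; split => [oO|[oO1 oO2]].
  split; first by apply: open_comp => // ? _; apply: c1.
  by apply: open_comp => // ? _; apply: c2.
have cl (M' : omanifold R) (i : M' -> N) : continuous i -> open (i @^-1` O) ->
    closed (i @` (~` (i @^-1` O))).
  move=> ci oi; apply: compact_closed; first exact: omanifold_hausdorff.
  apply: continuous_compact; first exact: continuous_subspaceT.
  by apply: (subclosed_compact _ (@omanifold_compact R M')) => //; apply: open_closedC.
rewrite -[O]setCK openC (_ : ~` O = (i1 @` (~` (i1 @^-1` O))) `|` (i2 @` (~` (i2 @^-1` O)))).
  by apply: closedU; apply: cl.
apply/seteqP; split => [x Ox|x [[y Oy <-]|[y Oy <-]]] //.
by case: (cov x) => -[y yx]; [left|right]; exists y; rewrite /= ?yx.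
Qed.

Section SubCobordism.
Variables (a b a' b' : word) (K : cob R a b) (A : set K).
Hypotheses (oA : open A) (cA : closed A).
Variables (f : 'I_(size a') -> 'I_(size a)) (g : 'I_(size b') -> 'I_(size b)).
Hypotheses (fi : injective f) (gi : injective g).
Hypotheses (fl : forall i, letter (f i) = letter i) (gl : forall j, letter (g j) = letter j).
Hypotheses (fA : forall i, A (ingoing K (f i))) (gA : forall j, A (outgoing K (g j))).
Hypotheses (Af : forall i, A (ingoing K i) -> exists i', f i' = i)
  (Ag : forall j, A (outgoing K j) -> exists j', g j' = j).

Let N := submanifold oA cA.
Definition sub_in i : N := SigSub (mem_set (fA i)).
Definition sub_out j : N := SigSub (mem_set (gA j)).

Lemma sub_ends_inj : injective (ends sub_in sub_out).
Proof.
have E x : subval (ends sub_in sub_out x) = ends (ingoing K) (outgoing K)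
    (match x with inl i => inl (f i) | inr j => inr (g j) end) by case: x.
move=> x y /(congr1 (@subval K A oA cA)); rewrite !E => /ends_inj.
by case: x y {E} => [i|j] [i'|j'] // []; [move/fi ->|move/gi ->].
Qed.

Lemma sub_in_sign i : boundary_sign (sub_in i) (letter i).
Proof. by apply/boundary_sign_sub; rewrite -fl; apply: ingoing_sign. Qed.

Lemma sub_out_sign j : boundary_sign (sub_out j) (~~ letter j).
Proof. by apply/boundary_sign_sub; rewrite -gl; apply: outgoing_sign. Qed.

Lemma sub_ends_boundary : range (ends sub_in sub_out) = @boundary R N.
Proof.
apply/seteqP; split => [_ [[i|j] _ <-]|x [s /boundary_sign_sub xs]].
- by exists (letter i); apply: sub_in_sign.
- by exists (~~ letter j); apply: sub_out_sign.
have : @boundary R K (subval x) by exists s.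
have Ax := subvalP x.
rewrite -ends_boundary => -[[i|j] _ /= E]; rewrite -E in Ax.
  have [i' i'E] := Af Ax; exists (inl i') => //; apply: subval_inj.
  by rewrite -E -i'E.
have [i' i'E] := Ag Ax; exists (inr i') => //; apply: subval_inj.
by rewrite -E -i'E.
Qed.

Definition sub_cob : cob R a' b' :=
  Cob sub_ends_inj sub_ends_boundary sub_in_sign sub_out_sign.

End SubCobordism.

Lemma lcat_inj (u v : word) : injective (@lcat u v).
Proof. by move=> i j /(congr1 val)/= /val_inj. Qed.

Lemma rcat_inj (u v : word) : injective (@rcat u v).
Proof. by move=> i j /(congr1 val)/= /addnI/val_inj. Qed.

Lemma cat_ordP (u v : word) (k : 'I_(size (u ++ v))) :
  (exists i, lcat v i = k) \/ (exists j, rcat u j = k).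
Proof.
have [ku|ku] := ltnP k (size u).
  by left; exists (Ordinal ku); apply: val_inj.
have kv : (k - size u < size v)%N by rewrite ltn_subLR // -size_cat.
by right; exists (Ordinal kv); apply: val_inj; rewrite /= subnKC.
Qed.

Lemma letter_lcat (u v : word) (i : 'I_(size u)) : letter (lcat v i) = letter i.
Proof. by rewrite /letter !(tnth_nth false) /= nth_cat ltn_ord. Qed.

Lemma letter_rcat (u v : word) (i : 'I_(size v)) : letter (rcat u i) = letter i.
Proof. by rewrite /letter !(tnth_nth false) /= nth_cat ltnNge leq_addr addKn. Qed.

Section SplitCobordism.
Variables (a b c d : word) (K : cob R (a ++ c) (b ++ d)) (A : set K).
Hypotheses (oA : open A) (cA : closed A).
Hypotheses (inl_A : forall i, A (ingoing K (lcat c i))) (inr_A : forall i, (~` A) (ingoing K (rcat a i))).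
Hypotheses (outl_A : forall j, A (outgoing K (lcat d j))) (outr_A : forall j, (~` A) (outgoing K (rcat b j))).

Lemma in_A i : A (ingoing K i) -> exists i', lcat c i' = i.
Proof. by case: (cat_ordP i) => // -[j <-] /(inr_A (i := j)). Qed.

Lemma out_A i : A (outgoing K i) -> exists i', lcat d i' = i.
Proof. by case: (cat_ordP i) => // -[j <-] /(outr_A (j := j)). Qed.

Lemma in_nA i : (~` A) (ingoing K i) -> exists i', rcat a i' = i.
Proof. by case: (cat_ordP i) => // -[j <-]; case. Qed.

Lemma out_nA i : (~` A) (outgoing K i) -> exists i', rcat b i' = i.
Proof. by case: (cat_ordP i) => // -[j <-]; case. Qed.

Definition left_part : cob R a b :=
  sub_cob oA cA (@lcat_inj _ _) (@lcat_inj _ _) (@letter_lcat _ _) (@letter_lcat _ _)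
    inl_A outl_A in_A out_A.

Definition right_part : cob R c d :=
  sub_cob (closed_openC cA) (open_closedC oA) (@rcat_inj _ _) (@rcat_inj _ _)
    (@letter_rcat _ _) (@letter_rcat _ _) inr_A outr_A in_nA out_nA.

(** The inclusions of the clopen parts are the required embeddings, so [K] itself, and not merely an
    equivalent cobordism, is the tensor product. *)
Lemma split_tensor : is_tensor left_part right_part K.
Proof.
exists (@subval _ _ oA cA), (@subval _ _ (closed_openC cA) (open_closedC oA)).
split => //.
  apply: glued_intro; try exact: subval_continuous; try exact: subval_inj;
    try exact: subval_orientation.
  move=> x; case: (pselect (A x)) => Ax; [left|right]; exact: subval_surj.
by move=> x y xy; apply: (subvalP y); rewrite -xy; apply: subvalP.
Qed.

End SplitCobordism.

(** * Compact subsets of the line as oriented manifolds; the standard intervals *)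

Section LineManifold.
Variable S : set R.
Hypothesis cS : compact S.

(** Within distance 1 of [a] the set is a half-line with origin [a], so translation by [a] is a
    chart there. All transition maps are then translations. *)
Definition line_end (a : R) (s : bool) : Prop :=
  forall y, `|y - a| < 1 -> (S y <-> half_line s (y - a)).

Hypothesis S_ends : forall x, S x -> exists a s, `|x - a| < 1 /\ line_end a s.

Definition line_chart (a : R) (s : bool) : chart R S :=
  Chart (set_val @^-1` [set x | `|x - a| < 1]) (fun x : S => set_val x - a) s.

Definition line_atlas : set (chart R S) :=
  [set c | exists a s, line_end a s /\ c = line_chart a s].

Lemma ball_dist (a e : R) : open [set x : R | `|x - a| < e].
Proof.
rewrite (_ : [set x | _] = ball a e); first exact: ball_open.
by apply/seteqP; split => v; rewrite /ball /= distrC.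
Qed.

Lemma line_hausdorff : hausdorff_space S.
Proof. exact/set_type_hausdorff/Rhausdorff. Qed.

Lemma line_atlas_chart c : line_atlas c -> is_chart c.
Proof.
move=> [a [s [as_ ->]]]; split => /=.
- by apply: open_comp => [? _|]; [exact: set_type_continuous|exact: ball_dist].
- apply: continuous_subspaceT => x.
  apply: (@continuousB _ _ _ (fun x : S => set_val x) (fun=> a)).
    exact: set_type_continuous.
  exact: cst_continuous.
- by move=> x y _ _ /addIr/val_inj.
- move=> _ [O oO <-] Od; exists [set r | O (r + a) /\ `|r| < 1].
    apply: openI; last first.
      by have := @ball_dist 0 1; congr open; apply/seteqP; split => r /=; rewrite subr0.
    apply: open_comp => // r _.
    by apply: (@continuousD _ _ _ id (fun=> a)); [exact: cvg_id|exact: cst_continuous].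
  apply/seteqP; split => [_ [x Ox <-]|r [[Or r1] hr]].
    have xa := Od _ Ox; split; first by rewrite /= subrK.
    by apply/as_ => //; exact: set_valP.
  have Sr : S (r + a) by apply/as_; rewrite addrK.
  by exists (SigSub (mem_set Sr)); rewrite /= ?addrK.
Qed.

Lemma line_atlas_cover (x : S) : exists2 c, line_atlas c & chart_dom c x.
Proof.
have [a [s [xa as_]]] := S_ends (set_valP x).
by exists (line_chart a s) => //; exists a, s.
Qed.

Lemma line_atlas_oriented c d : line_atlas c -> line_atlas d -> locally_increasing id c d.
Proof.
move=> [a [s [_ ->]]] [a' [s' [_ ->]]] x _ _; exists setT; first exact: filterT.
by move=> y z _ _ /=; rewrite !ltrD2r.
Qed.

Definition line_manifold : omanifold R :=
  @OManifold R (set_type S) line_atlas (set_type_compact cS) line_hausdorff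
    line_atlas_chart line_atlas_cover line_atlas_oriented.

End LineManifold.

Section IntervalsManifold.
Variable n : nat.

(** Unit intervals separated by gaps of length 1. The open ball of radius 1 around an end of an
    interval meets no other interval and misses the opposite end, so it looks like a half-line. *)
Definition intervals : set R :=
  [set x | exists k : 'I_n, 2 * k%:R <= x <= 2 * k%:R + 1].

Lemma intervals_compact : compact intervals.
Proof.
have sub : intervals `<=` `[0, 2 * n%:R]%classic.
  move=> x [k /andP[kx xk]]; rewrite /= in_itv /=.
  have kn : k%:R + 1 <= n%:R :> R by rewrite natr1 ler_nat.
  have k0 : 0 <= k%:R :> R by [].
  by lra.
apply: subclosed_compact (@segment_compact _ _ _) sub.
rewrite (_ : intervals = \bigcup_(k in [set: 'I_n]) `[2 * k%:R, 2 * k%:R + 1]%classic).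
  by apply: closed_bigcup => [|k _]; [exact: finite_finset|exact: itv_closed].
apply/seteqP; split => [x [k kx]|x [k _ /=]]; first by exists k; rewrite //= in_itv.
by rewrite in_itv; exists k.
Qed.

Lemma intervals_ends x : intervals x ->
  exists a s, `|x - a| < 1 /\ line_end intervals a s.
Proof.
have near (k j : 'I_n) (y : R) : 2 * k%:R - 1 < y < 2 * k%:R + 2 ->
    2 * j%:R <= y <= 2 * j%:R + 1 -> j = k.
  move=> y1 y2; apply: val_inj; apply/eqP; rewrite eqn_leq.
  have jk : j%:R < k%:R + 1 :> R by lra.
  have kj : k%:R < j%:R + 1 :> R by lra.
  by rewrite natr1 ltr_nat ltnS in jk; rewrite natr1 ltr_nat ltnS in kj; rewrite jk kj.
move=> [k kx]; case: (ltrP x (2 * k%:R + 1)) => xk.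
  exists (2 * k%:R), true; split; first by rewrite ltr_norml; lra.
  move=> y; rewrite ltr_norml => yk; split.
    move=> [j jy]; have jk : j = k by apply: near jy; lra.
    by subst j; rewrite /=; lra.
  by move=> /= y0; exists k; lra.
exists (2 * k%:R + 1), false; split; first by rewrite ltr_norml; lra.
move=> y; rewrite ltr_norml => yk; split.
  move=> [j jy]; have jk : j = k by apply: near jy; lra.
  by subst j; rewrite /=; lra.
by move=> /= y0; exists k; lra.
Qed.

Definition intervals_manifold : omanifold R :=
  line_manifold intervals_compact intervals_ends.

Lemma interval_pathP (k : 'I_n) t : intervals (2 * k%:R + clamp t).
Proof. by exists k; have := clamp_itv t; lra. Qed.

Definition interval_path (k : 'I_n) (t : R) : intervals_manifold :=
  SigSub (mem_set (interval_pathP k t)).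

Lemma interval_path_edge k : edge (interval_path k).
Proof.
split.
- move=> t W /set_type_nbhs[O Ot OW].
  have cc := @comp_continuous R R R (@clamp R) (fun t => 2 * k%:R + t * 1)
    (@clamp_continuous R) (@affine_continuous R _ _).
  have cO : nbhs t ((fun t => 2 * k%:R + clamp t * 1) @^-1` O).
    by apply: (cc t O); rewrite /= mulr1.
  by apply: filterS cO => u; rewrite /= mulr1 => Ou; apply: OW.
- move=> t _ t01 [a [s [_ ->]]] _; exists setT; first exact: filterT.
  by move=> u v _ _ u01 v01 uv /=; rewrite set_valE /= !clamp_id // ltrD2r ltrD2l.
- move=> t u t01 u01 /(congr1 val) /= /addrI; rewrite !clamp_id //.
  by case/andP: t01 => *; rewrite !ltW.
Qed.

Lemma interval_path_arc k : interval_path k 0 <> interval_path k 1.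
Proof.
move=> /(congr1 val) /= /addrI; rewrite !clamp_id ?lexx ?ler01 //.
by move/eqP; rewrite eq_sym oner_eq0.
Qed.

Lemma interval_path_decomposition : edge_decomposition interval_path.
Proof.
split; first exact: interval_path_edge.
- move=> x; have [k kx] : intervals (val x) by exact: set_valP.
  have x01 : 0 <= (val x : R) - 2 * k%:R <= 1 by rewrite subr_ge0 lerBlDl.
  exists k; exists (val x - 2 * k%:R) => //; apply: val_inj; rewrite /= clamp_id //.
  by rewrite addrC subrK.
- move=> k l x [t t01 <-] [u u01 /(congr1 val) /=]; rewrite !clamp_id // => E.
  apply: val_inj; apply/eqP; rewrite eqn_leq.
  have lk : l%:R < k%:R + 1 :> R by lra.
  have kl : k%:R < l%:R + 1 :> R by lra.
  by rewrite natr1 ltr_nat ltnS in lk; rewrite natr1 ltr_nat ltnS in kl; rewrite lk kl.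
Qed.

End IntervalsManifold.

End Submanifolds.

(** * Cobordisms made of arcs: standard models, relabelling, permutations *)

Section ArcCobordisms.
Variable R : realType.
Implicit Type M : omanifold R.

Lemma reverse_continuous : continuous (fun t : R => 1 - t).
Proof.
rewrite (_ : (fun t => _) = (fun t : R => 1 + t * -1)); first exact: affine_continuous.
by apply/funext => t; rewrite mulrN1.
Qed.

(** In [consists_of_intervals] a path starts at the ingoing point; over a negative letter this is
    the terminal point, so the edge has to be run backwards. *)
Definition direct (s : bool) (t : R) : R := if s then t else 1 - t.

Lemma direct_itv s t : 0 <= t <= 1 -> 0 <= direct s t <= 1.
Proof. by rewrite /direct; case: s => //; lra. Qed.

Lemma direct_continuous s : continuous (direct s).
Proof. by case: s => [t|]; [exact: cvg_id|exact: reverse_continuous]. Qed.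

Lemma reversed_continuous M (h : R -> M) s :
  continuous h -> continuous (fun t => h (direct s t)).
Proof. by move=> ch; apply: (@comp_continuous R R M (direct s) h) => //; apply: direct_continuous. Qed.

Lemma directK s t : direct s (direct s t) = t.
Proof. by rewrite /direct; case: s; lra. Qed.

Lemma direct0 s : direct s 0 = endpoint R s.
Proof. by rewrite /direct; case: s; rewrite ?subr0. Qed.

Lemma direct1 s : direct s 1 = endpoint R (~~ s).
Proof. by rewrite /direct; case: s; rewrite ?subrr. Qed.

Definition point_sign (a b : word) (x : 'I_(size a) + 'I_(size b)) : bool :=
  match x with inl i => letter i | inr j => ~~ letter j end.

Definition cob_end a b (K : cob R a b) := ends (ingoing K) (outgoing K).

Lemma cob_end_sign a b (K : cob R a b) x :
  boundary_sign (cob_end K x) (point_sign x).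
Proof. by case: x => [i|j]; [apply: ingoing_sign|apply: outgoing_sign]. Qed.

Lemma endpoint_inj : injective (@endpoint R).
Proof.
by case=> [] [] //= /eqP; rewrite ?oner_eq0 // eq_sym oner_eq0.
Qed.

Section CobordismEnds.
Variables (a b : word) (K : cob R a b) (n : nat) (h : 'I_n -> R -> K).
Hypothesis dh : edge_decomposition h.

Lemma cob_end_edge x :
  exists2 k, h k 0 <> h k 1 & cob_end K x = h k (endpoint R (point_sign x)).
Proof. exact (boundary_signP dh (cob_end_sign K x)). Qed.

(** The end of an arc is a boundary point, hence labelled; injectivity on the arc excludes the wrong
    sign. *)
Lemma edge_cob_end k s : h k 0 <> h k 1 ->
  exists2 x, point_sign x = s & cob_end K x = h k (endpoint R s).
Proof.
move=> hk; have := boundary_sign_arc dh s hk => bs.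
have : @boundary R K (h k (endpoint R s)) by exists s.
rewrite -ends_boundary => -[x _ xE]; exists x => //.
have [l hl lE] := cob_end_edge x.
have E : h l (endpoint R (point_sign x)) = h k (endpoint R s) by rewrite -xE -lE.
have lk := dec_same dh (endpoint_itv R _) (endpoint_itv R _) E; subst l.
by apply/endpoint_inj/(arc_inj (dec_edge dh k) hk) => //; exact: endpoint_itv.
Qed.

End CobordismEnds.

Lemma cob_end_inj a b (K : cob R a b) : injective (cob_end K).
Proof. exact: ends_inj. Qed.

Section ArcCobordism.
Variables (n : nat) (a b : word) (iota : 'I_(size a) + 'I_(size b) -> 'I_n * bool).
Hypotheses (iota_inj : injective iota) (iota_surj : forall ks, exists x, iota x = ks)
  (iota_sign : forall x, (iota x).2 = point_sign x).

Definition arc_end (ks : 'I_n * bool) : intervals_manifold R n :=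
  interval_path ks.1 (endpoint R ks.2).

Lemma arc_end_inj : injective arc_end.
Proof.
move=> [k s] [l r]; rewrite /arc_end /= => E.
have [-> /endpoint_inj -> //] := arcs_inj (interval_path_decomposition R n)
  (@interval_path_arc R n) (endpoint_itv R _) (endpoint_itv R _) E.
Qed.

Lemma arc_ends x : ends (arc_end \o iota \o inl) (arc_end \o iota \o inr) x = arc_end (iota x).
Proof. by case: x. Qed.

Lemma arc_ends_sign x :
  boundary_sign (arc_end (iota x)) (point_sign x).
Proof.
rewrite -iota_sign; apply: (boundary_sign_arc (interval_path_decomposition R n)).
exact: interval_path_arc.
Qed.

Lemma arc_ends_inj : injective (ends (arc_end \o iota \o inl) (arc_end \o iota \o inr)).
Proof. by move=> x y; rewrite !arc_ends => /arc_end_inj/iota_inj. Qed.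

Lemma arc_ends_boundary :
  range (ends (arc_end \o iota \o inl) (arc_end \o iota \o inr)) =
  @boundary R (intervals_manifold R n).
Proof.
apply/seteqP; split => [_ [x _ <-]|x [s xs]].
  by rewrite arc_ends; exists (point_sign x); apply: arc_ends_sign.
have [k _ ->] := boundary_signP (interval_path_decomposition R n) xs.
by have [y yE] := iota_surj (k, s); exists y => //; rewrite arc_ends yE.
Qed.

(** [iota] tells for each boundary position on which standard interval and at which end it sits,
    [true] meaning the initial end. Any sign-respecting bijection of this kind gives a cobordism. *)
Definition arc_cob : cob R a b :=
  Cob arc_ends_inj arc_ends_boundary
    (fun i => arc_ends_sign (inl i)) (fun j => arc_ends_sign (inr j)).

Lemma cob_end_arc x : cob_end arc_cob x = arc_end (iota x).
Proof. exact: arc_ends. Qed.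

End ArcCobordism.

Section Relabel.
Variables (a b a' b' : word) (K : cob R a b).
Variables (f : 'I_(size a') -> 'I_(size a)) (g : 'I_(size b') -> 'I_(size b)).
Variables (f' : 'I_(size a) -> 'I_(size a')) (g' : 'I_(size b) -> 'I_(size b')).
Hypotheses (fK : cancel f f') (f'K : cancel f' f) (gK : cancel g g') (g'K : cancel g' g).
Hypotheses (fl : forall i, letter (f i) = letter i) (gl : forall j, letter (g j) = letter j).

Definition relabel_map (x : 'I_(size a') + 'I_(size b')) : 'I_(size a) + 'I_(size b) :=
  match x with inl i => inl (f i) | inr j => inr (g j) end.

Lemma relabel_endsE x :
  ends (ingoing K \o f) (outgoing K \o g) x = cob_end K (relabel_map x).
Proof. by case: x. Qed.

Lemma relabel_inj : injective (ends (ingoing K \o f) (outgoing K \o g)).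
Proof.
move=> x y; rewrite !relabel_endsE => /cob_end_inj.
by case: x y => [i|j] [i'|j'] // []; [move/(can_inj fK) ->|move/(can_inj gK) ->].
Qed.

Lemma relabel_boundary : range (ends (ingoing K \o f) (outgoing K \o g)) = @boundary R K.
Proof.
rewrite -ends_boundary; apply/seteqP; split => [_ [x _ <-]|_ [x _ <-]].
  by rewrite relabel_endsE; exists (relabel_map x).
by case: x => [i|j]; [exists (inl (f' i))|exists (inr (g' j))]; rewrite //= ?f'K ?g'K.
Qed.

Lemma relabel_in_sign i : boundary_sign ((ingoing K \o f) i) (letter i).
Proof. by rewrite -fl; apply: ingoing_sign. Qed.

Lemma relabel_out_sign j : boundary_sign ((outgoing K \o g) j) (~~ letter j).
Proof. by rewrite -gl; apply: outgoing_sign. Qed.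

Definition relabel : cob R a' b' :=
  @Cob R a' b' K _ _ relabel_inj relabel_boundary relabel_in_sign relabel_out_sign.

End Relabel.

Section PermCobordism.
Variables (a b : word) (s : 'I_(size a) -> 'I_(size b)) (s' : 'I_(size b) -> 'I_(size a)).
Hypotheses (sK : cancel s s') (s'K : cancel s' s) (sl : forall i, letter (s i) = letter i).

(** Intervals are numbered by their ingoing points. A positive letter enters at the initial end and
    leaves at the terminal one; for a negative letter it is the reverse. *)
Definition perm_iota (x : 'I_(size a) + 'I_(size b)) : 'I_(size a) * bool :=
  match x with inl i => (i, letter i) | inr j => (s' j, ~~ letter j) end.

Lemma perm_iota_inj : injective perm_iota.
Proof.
case=> [i|j] [i'|j'] //=; first by case=> ->.
- by case=> ->; rewrite -sl s'K; case: letter.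
- by case=> <-; rewrite -sl s'K; case: letter.
- by case=> /(can_inj s'K) ->.
Qed.

Lemma perm_iota_surj ks : exists x, perm_iota x = ks.
Proof.
case: ks => k r; have [<-|kr] := eqVneq (letter k) r; first by exists (inl k).
by exists (inr (s k)); rewrite /= sK sl; case: letter r kr => [] [].
Qed.

Lemma perm_iota_sign x : (perm_iota x).2 = point_sign x.
Proof. by case: x. Qed.

Definition perm_cob : cob R a b := arc_cob perm_iota_inj perm_iota_surj perm_iota_sign.

Lemma perm_cob_intervals : consists_of_intervals perm_cob s.
Proof.
exists (fun k t => @interval_path R (size a) k (direct (letter k) t)); split.
- move=> k; apply: continuous_subspaceT.
  exact/reversed_continuous/edge_continuous/interval_path_edge.
- move=> k l t u t01 u01 E.
  have [kl tu] := arcs_inj (interval_path_decomposition R (size a))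
    (@interval_path_arc R _) (direct_itv _ t01) (direct_itv _ u01) E; subst l; split => //.
  by rewrite -[t](directK (letter k)) tu directK.
- move=> x; have [k [t [t01 tx]]] := dec_param (interval_path_decomposition R (size a)) x.
  by exists k, (direct (letter k) t); split; [exact: direct_itv|rewrite directK].
- by move=> k; rewrite direct0.
- move=> k; rewrite direct1.
  change (interval_path k (endpoint R (~~ letter k)) =
    interval_path (s' (s k)) (endpoint R (~~ letter (s k)))).
  by rewrite sK sl.
Qed.

End PermCobordism.

(** The sign of a boundary point decides at which end of the only arc it lies. Hence the map
    matching parameters also matches all labels. *)
Lemma arcs1_equiv a b (K L : cob R a b) (h : 'I_1 -> R -> K) (g : 'I_1 -> R -> L) :
  edge_decomposition h -> edge_decomposition g -> h ord0 0 <> h ord0 1 ->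
  g ord0 0 <> g ord0 1 -> cob_equiv K L.
Proof.
move=> dh dg hn gn.
have ha k : h k 0 <> h k 1 by rewrite ord1.
have ga k : g k 0 <> g k 1 by rewrite ord1.
have [|f fP] := dec_factor dh (f := g).
  by move=> k t u t01 u01 /(arcs_inj dh ha t01 u01)[_ ->].
have [|e eP] := dec_factor dg (f := h).
  by move=> k t u t01 u01 /(arcs_inj dg ga t01 u01)[_ ->].
have fends x : f (cob_end K x) = cob_end L x.
  have [k _ ->] := cob_end_edge dh x; have [l _ ->] := cob_end_edge dg x.
  by rewrite fP ?endpoint_itv // !ord1.
exists f, e; split; last 2 first.
- by move=> i; apply: (fends (inl i)).
- by move=> i; apply: (fends (inr i)).
- split => x.
    by have [k [t [t01 <-]]] := dec_param dh x; rewrite fP // eP.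
  by have [k [t [t01 <-]]] := dec_param dg x; rewrite eP // fP.
- split.
    by apply: (dec_continuous dh fP) => k; exact: edge_continuous (dec_edge dg k).
  by apply: (dec_continuous dg eP) => k; exact: edge_continuous (dec_edge dh k).
- apply: (dec_orientation dh ha fP) => k; exact: edge_rising (dec_edge dg k).
Qed.

Lemma arcs1_identity (x : bool) (K : cob R [:: x] [:: x]) (h : 'I_1 -> R -> K) :
  edge_decomposition h -> h ord0 0 <> h ord0 1 -> is_identity K.
Proof.
move=> dh hn; have ha k : h k 0 <> h k 1 by rewrite ord1.
have E y : cob_end K y = h ord0 (endpoint R (point_sign y)).
  by have [k _ ->] := cob_end_edge dh y; rewrite ord1.
have lx (k : 'I_(size [:: x])) : letter k = x.
  by rewrite [k]ord1 /letter (tnth_nth false).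
exists (fun k t => h ord0 (direct x t)); split.
- move=> k; apply: continuous_subspaceT.
  exact/reversed_continuous/edge_continuous/(dec_edge dh ord0).
- move=> k l t u t01 u01 tu; split; first by rewrite [k]ord1 [l]ord1.
  have [_ {}tu] := arcs_inj dh ha (direct_itv _ t01) (direct_itv _ u01) tu.
  by rewrite -[t](directK x) tu directK.
- move=> y; have [k [t [t01 tx]]] := dec_param dh y.
  exists ord0, (direct x t); split; first exact: direct_itv.
  by rewrite directK -tx [k]ord1.
- by move=> k; rewrite direct0 -[RHS]/(cob_end K (inl k)) E /= lx.
- by move=> k; rewrite direct1 -[RHS]/(cob_end K (inr k)) E /= lx.
Qed.

Definition cat_end_left (a b c d : word) (x : 'I_(size a) + 'I_(size b)) :
    'I_(size (a ++ c)) + 'I_(size (b ++ d)) :=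
  match x with inl i => inl (lcat c i) | inr j => inr (lcat d j) end.

Definition cat_end_right (a b c d : word) (x : 'I_(size c) + 'I_(size d)) :
    'I_(size (a ++ c)) + 'I_(size (b ++ d)) :=
  match x with inl i => inl (rcat a i) | inr j => inr (rcat b j) end.

(** The trace of [h k] is clopen and contains exactly the boundary points of the left block. The
    last clauses record what an induction needs on the rest: which edges are loops and which edge
    carries which end. *)
Lemma split_edge (a b c d : word) (K : cob R (a ++ c) (b ++ d)) (n : nat)
    (h : 'I_n.+1 -> R -> K) (k : 'I_n.+1) :
  edge_decomposition h ->
  (forall x, trace (h k) (cob_end K (cat_end_left c d x))) ->
  (forall x, ~ trace (h k) (cob_end K (cat_end_right a b x))) ->
  exists (K1 : cob R a b) (K2 : cob R c d) (h1 : 'I_1 -> R -> K1) (h2 : 'I_n -> R -> K2),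
  [/\ is_tensor K1 K2 K, edge_decomposition h1, edge_decomposition h2,
    (h1 ord0 0 = h1 ord0 1 <-> h k 0 = h k 1)
  & (forall j, h2 j 0 = h2 j 1 <-> h (lift k j) 0 = h (lift k j) 1) /\
    (forall x j, trace (h2 j) (cob_end K2 x) <->
       trace (h (lift k j)) (cob_end K (cat_end_right a b x)))].
Proof.
move=> dh hl hr; pose A := \bigcup_(j in [set k]) trace (h j).
have AE : A = trace (h k) by rewrite /A bigcup_set1.
have [cA oA] : closed A /\ open A := trace_clopen dh [set k].
have il i : A (ingoing K (lcat c i)) by rewrite AE; apply: (hl (inl i)).
have ir i : (~` A) (ingoing K (rcat a i)) by rewrite AE; apply: (hr (inl i)).
have ol i : A (outgoing K (lcat d i)) by rewrite AE; apply: (hl (inr i)).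
have or i : (~` A) (outgoing K (rcat b i)) by rewrite AE; apply: (hr (inr i)).
have T := split_tensor oA cA il ir ol or.
have [||| h1 [dh1 h1E]] := @sub_decomposition R K A oA cA _ 1 h (fun=> k) dh.
- by move=> i j _; rewrite !ord1.
- by move=> x; rewrite AE => kx; exists ord0.
- by move=> _; rewrite AE.
have tn j : trace (h (lift k j)) `<=` ~` A.
  move=> x jx; rewrite AE => kx; have /eqP := dec_disjoint dh kx jx.
  by rewrite (negbTE (neq_lift _ _)).
have [||| h2 [dh2 h2E]] := @sub_decomposition R K (~` A) (closed_openC cA) (open_closedC oA) _ n h (lift k) dh.
- exact: lift_inj.
- move=> x; rewrite AE => nkx; have [j jx] := dec_cover dh x.
  by case: (unliftP k j) jx => [j' ->|->] // jx; exists j'.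
- exact: tn.
have z01 : 0 <= (0 : R) <= 1 by rewrite lexx ler01.
have o01 : 0 <= (1 : R) <= 1 by rewrite lexx ler01.
exists (left_part oA cA il ir ol or), (right_part oA cA il ir ol or), h1, h2; split;
  [exact: T|exact: dh1|exact: dh2| |split].
- rewrite -(h1E ord0) // -(h1E ord0 1) //; split => [-> //|]; exact: subval_inj.
- move=> j; rewrite -(h2E j) // -(h2E j 1) //; split => [-> //|]; exact: subval_inj.
move=> x j.
have E : subval (cob_end (right_part oA cA il ir ol or) x) = cob_end K (cat_end_right a b x).
  by case: x.
rewrite -E; split => -[t t01 tx]; exists t => //.
  by rewrite -h2E // tx.
by apply: subval_inj; rewrite h2E.
Qed.

End ArcCobordisms.

(** * Collars *)

Section Collars.
Variable R : realType.
Implicit Type M : omanifold R.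

Lemma glued_sym (M1 M2 N : omanifold R) (i1 : M1 -> N) (i2 : M2 -> N) :
  is_glued_from i1 i2 -> is_glued_from i2 i1.
Proof.
move=> [[j1 j2] cov opn [o1 o2]]; split => //; first by rewrite setUC.
by move=> O; rewrite opn; split => -[].
Qed.

Section Collar.
Variables (M : omanifold R) (n : nat) (h : 'I_n -> R -> M).
Hypotheses (dh : edge_decomposition h) (ha : forall k, h k 0 <> h k 1).
Variables (m : nat) (nu : 'I_m -> 'I_n * bool).
Hypothesis nu_inj : injective nu.

(** An arc may be cut at both of its ends, so each collar takes an outer third and the core keeps at
    least the middle one. *)
Let lo (s : bool) : R := if s then 0 else 2 / 3.
Let hi (s : bool) : R := if s then 1 / 3 else 1.
Let clo e : R := if [exists k, nu k == (e, true)] then 1 / 3 else 0.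
Let chi e : R := if [exists k, nu k == (e, false)] then 2 / 3 else 1.

Lemma collar_lohi s : [/\ 0 <= lo s, lo s < hi s & hi s <= 1].
Proof. by rewrite /lo /hi; case: s; split; lra. Qed.

Lemma core_lohi e : [/\ 0 <= clo e, clo e < chi e & chi e <= 1].
Proof. by rewrite /clo /chi; do 2 case: ifP => _; split; lra. Qed.

(* [m] collars are cut off at the ends listed by [nu]; [i1] maps the standard intervals
   onto them and [i2] shrinks [M] onto the rest. *)
Lemma collar : exists (i1 : intervals_manifold R m -> M) (i2 : M -> M),
  [/\ is_glued_from i1 i2,
    forall k, i1 (arc_end R (k, (nu k).2)) = h (nu k).1 (endpoint R (nu k).2),
    forall x y, i1 x = i2 y <-> exists k,
      x = arc_end R (k, ~~ (nu k).2) /\ y = h (nu k).1 (endpoint R (nu k).2)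
  & forall e s, (forall k, nu k <> (e, s)) -> i2 (h e (endpoint R s)) = h e (endpoint R s)].
Proof.
have dI := interval_path_decomposition R m.
have aI := @interval_path_arc R m.
pose f1 k := subpath (h (nu k).1) (lo (nu k).2) (hi (nu k).2).
pose f2 e := subpath (h e) (clo e) (chi e).
have [|i1 i1E] := dec_factor dI (f := f1).
  by move=> k t u t01 u01 /(arcs_inj dI aI t01 u01)[_ ->].
have [|i2 i2E] := dec_factor dh (f := f2).
  by move=> k t u t01 u01 /(arcs_inj dh ha t01 u01)[_ ->].
have sI (a b t : R) : 0 <= a -> a < b -> b <= 1 -> 0 <= t <= 1 -> 0 <= a + t * (b - a) <= 1.
  move=> a0 ab b1 t01; have /andP[l1 l2] := @subpath_itv R a b t a0 ab b1 t01.
  by rewrite (le_trans a0 l1) (le_trans l2 b1).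
have key (e e' : 'I_n) (a b a' b' t u : R) : 0 <= a -> a < b -> b <= 1 -> 0 <= a' -> a' < b' -> b' <= 1 ->
    0 <= t <= 1 -> 0 <= u <= 1 -> subpath (h e) a b t = subpath (h e') a' b' u ->
    e = e' /\ a + t * (b - a) = a' + u * (b' - a').
  by move=> a0 ab b1 a'0 ab' b'1 t01 u01; apply: (arcs_inj dh ha); apply: sI.
exists i1, i2; split.
- apply: glued_intro.
  + apply: (dec_continuous dI i1E) => k; apply: subpath_continuous.
    exact: edge_continuous (dec_edge dh _).
  + apply: (dec_continuous dh i2E) => k; apply: subpath_continuous.
    exact: edge_continuous (dec_edge dh _).
  + move=> x y; have [k [t [t01 <-]]] := dec_param dI x; have [l [u [u01 <-]]] := dec_param dI y.
    rewrite !i1E // /f1.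
    have [k0 k1 k2] := collar_lohi (nu k).2; have [l0 l1 l2] := collar_lohi (nu l).2.
    move=> /(key _ _ _ _ _ _ _ _ k0 k1 k2 l0 l1 l2 t01 u01)[e E].
    have [s|s] := eqVneq (nu k).2 (nu l).2.
      have kl : k = l by apply: nu_inj; case: (nu k) (nu l) e s => [? ?] [? ?] /= -> ->.
      by subst l; move/addrI/mulIf: E => -> //; rewrite subr_eq0 gt_eqF.
    by exfalso; move: s E; rewrite /lo /hi; case: (nu k).2; case: (nu l).2 => //= _; lra.
  + move=> x y; have [k [t [t01 <-]]] := dec_param dh x; have [l [u [u01 <-]]] := dec_param dh y.
    rewrite !i2E // /f2.
    have [k0 k1 k2] := core_lohi k; have [l0 l1 l2] := core_lohi l.
    move=> /(key _ _ _ _ _ _ _ _ k0 k1 k2 l0 l1 l2 t01 u01)[e]; subst l.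
    by move/addrI/mulIf => -> //; rewrite subr_eq0 gt_eqF.
  + move=> x; have [e [t [t01 <-]]] := dec_param dh x.
    have [tl|tl] := ltrP t (clo e).
      left; move: tl; rewrite /clo; case: ifP => [/existsP[k /eqP kE] tl|_]; last by lra.
      have tt : 0 <= 3 * t <= 1 by lra.
      exists (interval_path k (3 * t)); rewrite i1E // /f1 kE /subpath /lo /hi /=.
      by congr (h e _); lra.
    have [th|th] := ltrP (chi e) t.
      left; move: th; rewrite /chi; case: ifP => [/existsP[k /eqP kE] th|_]; last by lra.
      have tt : 0 <= 3 * t - 2 <= 1 by lra.
      exists (interval_path k (3 * t - 2)); rewrite i1E // /f1 kE /subpath /lo /hi /=.
      by congr (h e _); lra.
    right; have [k0 k1 k2] := core_lohi e.
    have c0 : 0 < chi e - clo e by rewrite subr_gt0.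
    have tt : 0 <= (t - clo e) / (chi e - clo e) <= 1.
      by rewrite divr_ge0 ?subr_ge0 // ?(ltW k1) //= ler_pdivrMr // mul1r lerD2r.
    exists (h e ((t - clo e) / (chi e - clo e))); rewrite i2E // /f2 /subpath.
    by rewrite divfK ?gt_eqF // addrC subrK.
  + apply: (dec_orientation dI aI i1E) => k; have [? ? ?] := collar_lohi (nu k).2.
    by apply: subpath_rising => //; exact: edge_rising (dec_edge dh _).
  + apply: (dec_orientation dh ha i2E) => e; have [? ? ?] := core_lohi e.
    by apply: subpath_rising => //; exact: edge_rising (dec_edge dh _).
- move=> k; rewrite /arc_end /= i1E ?endpoint_itv // /f1 /lo /hi.
  by case: (nu k).2; rewrite /= ?subpath0 ?subpath1.
- move=> x y; split.
  + have [k [t [t01 <-]]] := dec_param dI x; have [l [u [u01 <-]]] := dec_param dh y.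
    rewrite i1E // i2E // /f1 /f2.
    have [k0 k1 k2] := collar_lohi (nu k).2; have [l0 l1 l2] := core_lohi l.
    move=> /(key _ _ _ _ _ _ _ _ k0 k1 k2 l0 l1 l2 t01 u01)[e].
    move=> E; exists k; rewrite /arc_end /=.
    have kE : nu k = (l, (nu k).2) by rewrite -e; case: (nu k).
    (* A collar and the core of the same arc are adjacent intervals of parameters and share only the
       cut point. *)
    move: E; rewrite {k0 k1 k2 l0 l1 l2} /lo /hi /clo /chi e.
    case: (nu k).2 kE => /= kE.
      rewrite ifT; last by apply/existsP; exists k; rewrite kE.
      move=> E; have [-> ->] : t = 1 /\ u = 0 by move: E; case: ifP => _; split; lra.
      by [].
    have -> : [exists j, nu j == (l, false)] by apply/existsP; exists k; rewrite kE.
    move=> E; have [-> ->] : t = 0 /\ u = 1 by move: E; case: ifP => _; split; lra.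
    by [].
  + move=> [k [-> ->]]; rewrite /arc_end /= i1E ?endpoint_itv // i2E ?endpoint_itv // /f1 /f2.
    have kE : nu k = ((nu k).1, (nu k).2) by case: (nu k).
    rewrite /lo /hi /clo /chi; case: (nu k).2 kE => /= kE.
      by rewrite subpath1 subpath0 ifT //; apply/existsP; exists k; rewrite kE.
    by rewrite subpath1 subpath0 ifT //; apply/existsP; exists k; rewrite kE.
- move=> e s ns; rewrite i2E ?endpoint_itv // /f2 /clo /chi.
  case: s ns => ns; rewrite ?subpath0 ?subpath1 ifF //; apply/negbTE/existsP => -[k /eqP];
  exact: ns.
Qed.

End Collar.

Lemma id_letter (u : word) (i : 'I_(size u)) : letter (id i) = letter i.
Proof. by []. Qed.

Lemma id_cancel (T : Type) : cancel (@id T) id.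
Proof. by []. Qed.

Section Moves.
Variables (a b : word) (K : cob R a b) (n : nat) (h : 'I_n -> R -> K).
Hypotheses (dh : edge_decomposition h) (ha : forall k, h k 0 <> h k 1).

(** Collars at all ingoing ends are taken as the strands of the permutation, and [K], shrunk away
    from them, as the relabelled factor. The permutation [s] affects only the labels at the cut.
    Outgoing ends are not listed in [nu] and stay fixed. *)
Lemma in_move (a' : word) (s : 'I_(size a) -> 'I_(size a')) (s' : 'I_(size a') -> 'I_(size a))
    (sK : cancel s s') (s'K : cancel s' s) (sl : forall i, letter (s i) = letter i)
    (s'l : forall i, letter (s' i) = letter i) :
  is_composite (perm_cob R sK s'K sl)
    (relabel K s'K sK (@id_cancel _) (@id_cancel _) s'l (@id_letter b)) K.
Proof.
have /choice[e eE] : forall i, exists e, ingoing K i = h e (endpoint R (letter i)).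
  by move=> i; have [e _ eE] := cob_end_edge dh (inl i); exists e.
pose nu i := (e i, letter i).
have [|i1 [i2 [gl i1E i12 i2E]]] := collar dh ha (nu := nu).
  move=> i j [eij lij]; have := eE j; rewrite -eij -lij -eE => E.
  by have [] : inl i = inl j :> 'I_(size a) + 'I_(size b) by apply: (@cob_end_inj _ _ _ K).
exists i1, i2; split => //.
- move=> x y; rewrite i12; split => -[k [-> ->]].
    exists (s k); split; last by rewrite /= sK eE.
    change (arc_end R (k, ~~ letter k) = arc_end R (s' (s k), ~~ letter (s k))).
    by rewrite sK sl.
  exists (s' k); split; last by rewrite /= -eE.
  change (arc_end R (s' k, ~~ letter k) = arc_end R (s' k, ~~ letter (s' k))).
  by rewrite s'l.
- by move=> i; rewrite eE -(i1E i).
- move=> j /=; have [l _ lE] := cob_end_edge dh (inr j).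
  change (outgoing K j) with (cob_end K (inr j)).
  rewrite lE i2E // => k [kl ks].
  suff : inl k = inr j :> 'I_(size a) + 'I_(size b) by [].
  by apply: (@cob_end_inj _ _ _ K); rewrite lE -kl /= -ks; exact: eE.
Qed.

(** Mirror image of [in_move]. Collars are indexed by the new outgoing word [b'], the source of the
    permutation, and signs are negated because the points are outgoing. *)
Lemma out_move (b' : word) (s : 'I_(size b) -> 'I_(size b')) (s' : 'I_(size b') -> 'I_(size b))
    (sK : cancel s s') (s'K : cancel s' s) (sl : forall i, letter (s i) = letter i)
    (s'l : forall i, letter (s' i) = letter i) :
  is_composite (relabel K (@id_cancel _) (@id_cancel _) s'K sK (@id_letter a) s'l)
    (perm_cob R s'K sK s'l) K.
Proof.
have /choice[e eE] : forall j, exists e, outgoing K (s' j) = h e (endpoint R (~~ letter j)).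
  by move=> i; have [e _ eE] := cob_end_edge dh (inr (s' i)); exists e; rewrite -s'l.
pose nu j := (e j, ~~ letter j).
have [|i1 [i2 [gl i1E i12 i2E]]] := collar dh ha (nu := nu).
  move=> i j [eij lij]; have := eE j; rewrite -eij -lij -eE => E.
  have [] : inr (s' i) = inr (s' j) :> 'I_(size a) + 'I_(size b) by apply: (@cob_end_inj _ _ _ K).
  by move/(can_inj s'K).
exists i2, i1; split.
- exact: glued_sym.
- move=> x y; split.
    move/esym/i12 => [k [-> ->]]; exists k; split; first by rewrite /= eE.
    by rewrite /nu /= negbK.
  move=> [k [-> ->]]; apply/esym/i12; exists k; split; last by rewrite /= eE.
  by rewrite /nu /= negbK.
- move=> i /=; have [l _ lE] := cob_end_edge dh (inl i).
  change (ingoing K i) with (cob_end K (inl i)).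
  rewrite lE i2E // => k [kl ks].
  suff : inr (s' k) = inl i :> 'I_(size a) + 'I_(size b) by [].
  by apply: (@cob_end_inj _ _ _ K); rewrite lE -kl /= -ks; exact: eE.
- move=> j; rewrite -{1}[j]sK eE -(i1E (s j)).
  by change (i1 (arc_end R (s j, ~~ letter (s j))) = i1 (arc_end R (s j, ~~ letter j))); rewrite sl.
Qed.

End Moves.

End Collars.

(** * Caps, cups and snakes *)

Section ElementaryCobordisms.
Variable R : realType.
Implicit Type M : omanifold R.

Section Table.
Variables (n : nat) (a b : word) (s : seq ('I_n * bool)).
Hypotheses (us : uniq s) (ss : size s = (n * 2)%N)
  (sg : [seq ks.2 | ks <- s] = a ++ [seq ~~ x | x <- b]).

Definition table_index (x : 'I_(size a) + 'I_(size b)) : nat :=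
  match x with inl i => i | inr j => (size a + j)%N end.

Lemma table_index_lt x : (table_index x < size s)%N.
Proof.
have -> : size s = (size a + size b)%N by rewrite -(size_map snd) sg size_cat size_map.
by case: x => [i|j] /=; [apply: ltn_addr|rewrite ltn_add2l].
Qed.

Definition table_iota x : 'I_n * bool := tnth (in_tuple s) (Ordinal (table_index_lt x)).

Lemma table_iotaE d x : table_iota x = nth d s (table_index x).
Proof. by rewrite /table_iota (tnth_nth d). Qed.

Lemma table_iota_inj : injective table_iota.
Proof.
move=> x y; rewrite (table_iotaE (table_iota x)) [RHS](table_iotaE (table_iota x)).
move/eqP; rewrite nth_uniq ?table_index_lt // => /eqP.
case: x y => [i|j] [i'|j'] /= E.
- by congr inl; apply: val_inj.
- by have := ltn_ord i; rewrite E ltnNge leq_addr.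
- by have := ltn_ord i'; rewrite -E ltnNge leq_addr.
- by congr inr; apply: val_inj; apply: addnI E.
Qed.

(** By counting: a duplicate-free list of length [n * 2] exhausts ['I_n * bool]. *)
Lemma table_iota_surj ks : exists x, table_iota x = ks.
Proof.
have sE : size s = (size a + size b)%N by rewrite -(size_map snd) sg size_cat size_map.
have ksin : ks \in s.
  have cE : #|s| = #|{: 'I_n * bool}|.
    by rewrite (card_uniqP us) ss card_prod card_ord card_bool.
  have /(subset_cardP cE) -> := subset_predT (mem s).
  by [].
have ik : (index ks s < size s)%N by rewrite index_mem.
have [ia|ia] := ltnP (index ks s) (size a).
  by exists (inl (Ordinal ia)); rewrite (table_iotaE ks) /= nth_index.
have ib : (index ks s - size a < size b)%N by rewrite ltn_subLR // -sE.
by exists (inr (Ordinal ib)); rewrite (table_iotaE ks) /= subnKC // nth_index.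
Qed.

Lemma table_iota_sign x : (table_iota x).2 = point_sign x.
Proof.
rewrite (table_iotaE (table_iota x)).
rewrite -(nth_map _ false) ?table_index_lt // sg nth_cat.
case: x => [i|j] /=; first by rewrite ltn_ord /letter (tnth_nth false).
rewrite ltnNge leq_addr /= addKn (nth_map false) //.
by rewrite /letter (tnth_nth false).
Qed.

(* [s] lists, ingoing points first, where the boundary points sit: [(k, true)] is the
   initial point of the [k]-th interval and [(k, false)] its terminal point. *)
Definition table_cob : cob R a b := arc_cob R table_iota_inj table_iota_surj table_iota_sign.

Lemma cob_end_table d x : cob_end table_cob x = arc_end R (nth d s (table_index x)).
Proof. by rewrite cob_end_arc (table_iotaE d). Qed.

End Table.

Lemma trace_arc_end n (k : 'I_n) ks :
  trace (@interval_path R n k) (arc_end R ks) <-> k = ks.1.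
Proof.
split => [[t t01 E]|->]; last by exists (endpoint R ks.2) => //; exact: endpoint_itv.
by have [] := arcs_inj (interval_path_decomposition R n) (@interval_path_arc R n) t01
  (endpoint_itv R _) E.
Qed.

Local Notation z2 := (@ord0 1).
Local Notation o2 := (@ord_max 1).

Definition cap_cob : cob R [:: true; false] [::] :=
  @table_cob 1 [:: true; false] [::] [:: (ord0, true); (ord0, false)] isT erefl erefl.
(** Outgoing letters are opposite to boundary signs, so the initial point of the arc is labelled by
    the negative letter. *)
Definition cup_cob : cob R [::] [:: false; true] :=
  @table_cob 1 [::] [:: false; true] [:: (ord0, true); (ord0, false)] isT erefl erefl.
(** The cup ends in the word -+ while the cap starts from +-; this variant closes the cup to a
    circle. *)
Definition twisted_cap_cob : cob R [:: false; true] [::] :=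
  @table_cob 1 [:: false; true] [::] [:: (ord0, false); (ord0, true)] isT erefl erefl.
Definition strand_pos : cob R [:: true] [:: true] :=
  @table_cob 1 [:: true] [:: true] [:: (ord0, true); (ord0, false)] isT erefl erefl.
Definition strand_neg : cob R [:: false] [:: false] :=
  @table_cob 1 [:: false] [:: false] [:: (ord0, false); (ord0, true)] isT erefl erefl.

(** The halves of the snakes are tabulated over two standard intervals, so that the maps of [zigzag]
    apply to them directly; [table_tensor] later shows that each is a strand next to a cap or a
    cup. *)
Definition cup_right_pos : cob R [:: true] [:: true; false; true] :=
  @table_cob 2 [:: true] [:: true; false; true]
    [:: (z2, true); (z2, false); (o2, true); (o2, false)] isT erefl erefl.
Definition cap_left_pos : cob R [:: true; false; true] [:: true] :=
  @table_cob 2 [:: true; false; true] [:: true]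
    [:: (z2, true); (z2, false); (o2, true); (o2, false)] isT erefl erefl.
Definition cup_left_neg : cob R [:: false] [:: false; true; false] :=
  @table_cob 2 [:: false] [:: false; true; false]
    [:: (o2, false); (z2, true); (z2, false); (o2, true)] isT erefl erefl.
Definition cap_right_neg : cob R [:: false; true; false] [:: false] :=
  @table_cob 2 [:: false; true; false] [:: false]
    [:: (z2, false); (o2, true); (o2, false); (z2, true)] isT erefl erefl.

(* The unit interval cut at 1/4, 1/2 and 3/4, with the pieces taken alternately. *)
Lemma zigzag : exists (i1 i2 : intervals_manifold R 2 -> intervals_manifold R 1),
  [/\ is_glued_from i1 i2,
    i1 (arc_end R (z2, true)) = arc_end R (ord0, true),
    i2 (arc_end R (o2, false)) = arc_end R (ord0, false)
  & forall x y, i1 x = i2 y <->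
    [\/ x = arc_end R (z2, false) /\ y = arc_end R (z2, true),
        x = arc_end R (o2, true) /\ y = arc_end R (z2, false)
      | x = arc_end R (o2, false) /\ y = arc_end R (o2, true)]].
Proof.
have d1 := interval_path_decomposition R 1; have a1 := @interval_path_arc R 1.
have d2 := interval_path_decomposition R 2; have a2 := @interval_path_arc R 2.
pose g := @interval_path R 1 ord0.
(* With [r = 0] the two intervals go to the first and third quarters, with [r = 1] to the second and
   fourth; [i1] and [i2] are these two cases. *)
pose A (k : 'I_2) (r : R) : R := if k == z2 then r / 4 else (2 + r) / 4.
pose f r k := subpath g (A k r) (A k (r + 1)).
have Alt k r : 0 <= r <= 1 -> [/\ 0 <= A k r, A k r < A k (r + 1) & A k (r + 1) <= 1].
  by move=> r01; rewrite /A; case: eqP => _; split; lra.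
have o2z : (o2 == z2) = false by [].
have k01 (k : 'I_2) : k = z2 \/ k = o2.
  by case: k => [[|[|//]] i]; [left|right]; apply: val_inj.
have r0 : 0 <= (0 : R) <= 1 by lra.
have r1 : 0 <= (1 : R) <= 1 by lra.
have lift r : 0 <= r <= 1 -> exists i : intervals_manifold R 2 -> intervals_manifold R 1,
   [/\ forall k t, 0 <= t <= 1 -> i (interval_path k t) = f r k t, continuous i & orientation_preserving i].
  move=> r01; have [|i iE] := dec_factor d2 (f := f r).
    by move=> k t u t01 u01 /(arcs_inj d2 a2 t01 u01)[_ ->].
  exists i; split => //.
    apply: (dec_continuous d2 iE) => k; apply: subpath_continuous.
    exact: edge_continuous (@interval_path_edge R _ _).
  apply: (dec_orientation d2 a2 iE) => k; have [? ? ?] := Alt k _ r01.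
  by apply: subpath_rising => //; exact: edge_rising (@interval_path_edge R _ _).
have key k l r q t u : 0 <= r <= 1 -> 0 <= q <= 1 -> 0 <= t <= 1 -> 0 <= u <= 1 ->
   f r k t = f q l u -> (if k == z2 then r + t else 2 + (r + t)) = (if l == z2 then q + u else 2 + (q + u)).
  move=> r01 q01 t01 u01 E.
  have I j r' t' : 0 <= r' <= 1 -> 0 <= t' <= 1 -> 0 <= A j r' + t' * (A j (r' + 1) - A j r') <= 1.
    by move=> ? ?; rewrite /A; case: eqP => _; lra.
  have [_] := arcs_inj d1 a1 (I k r t r01 t01) (I l q u q01 u01) E.
  by rewrite /A; case: eqP => _; case: eqP => _; lra.
have inj r (i : intervals_manifold R 2 -> intervals_manifold R 1) : 0 <= r <= 1 ->
    (forall k t, 0 <= t <= 1 -> i (interval_path k t) = f r k t) -> injective i.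
  move=> r01 iE x y; have [k [t [t01 <-]]] := dec_param d2 x; have [l [u [u01 <-]]] := dec_param d2 y.
  rewrite !iE // => /(key _ _ _ _ _ _ r01 r01 t01 u01).
  case: (k01 k) (k01 l) => -> [] ->; rewrite ?eqxx ?o2z => E.
  + by congr interval_path; lra.
  + by exfalso; lra.
  + by exfalso; lra.
  + by congr interval_path; lra.
have [i1 [i1E c1 or1]] := lift 0 r0.
have [i2 [i2E c2 or2]] := lift 1 r1.
exists i1, i2; split.
- apply: glued_intro => //; [exact: inj i1E|exact: inj i2E|].
  move=> x; have [k [t [t01 <-]]] := dec_param d1 x; rewrite [k]ord1.
  have fin r k' t' : g (A k' r + t' * (A k' (r + 1) - A k' r)) = f r k' t' by [].
  have [t1|t1] := ltrP t (1 / 4).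
    left; exists (interval_path z2 (4 * t)); rewrite i1E; last by lra.
    by rewrite -fin /A eqxx; congr g; lra.
  have [t2|t2] := ltrP t (1 / 2).
    right; exists (interval_path z2 (4 * t - 1)); rewrite i2E; last by lra.
    by rewrite -fin /A eqxx; congr g; lra.
  have [t3|t3] := ltrP t (3 / 4).
    left; exists (interval_path o2 (4 * t - 2)); rewrite i1E; last by lra.
    by rewrite -fin /A o2z; congr g; lra.
  right; exists (interval_path o2 (4 * t - 3)); rewrite i2E; last by lra.
  by rewrite -fin /A o2z; congr g; lra.
- rewrite /arc_end /= i1E // /f subpath0 /A eqxx mul0r //.
- by rewrite /arc_end /= i2E // /f subpath1 /A o2z; congr interval_path; lra.
move=> x y; split.
  have [k [t [t01 <-]]] := dec_param d2 x; have [l [u [u01 <-]]] := dec_param d2 y.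
  rewrite i1E // i2E // => /(key _ _ _ _ _ _ r0 r1 t01 u01).
  case: (k01 k) (k01 l) => -> [] ->; rewrite ?eqxx ?o2z => E.
  + by constructor 1; rewrite /arc_end /=; split; congr interval_path; lra.
  + by exfalso; lra.
  + by constructor 2; rewrite /arc_end /=; split; congr interval_path; lra.
  + by constructor 3; rewrite /arc_end /=; split; congr interval_path; lra.
case=> -[-> ->]; rewrite /arc_end /= i1E // i2E // /f ?subpath0 ?subpath1 /A ?eqxx ?o2z;
  by congr g; lra.
Qed.

Lemma ord3P (P : 'I_3 -> Prop) : (exists k, P k) <->
  [\/ P (@Ordinal 3 0 isT), P (@Ordinal 3 1 isT) | P (@Ordinal 3 2 isT)].
Proof.
split => [[[[|[|[|//]]] i] Pk]|[] Pk]; last 3 first.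
- by exists (@Ordinal 3 0 isT).
- by exists (@Ordinal 3 1 isT).
- by exists (@Ordinal 3 2 isT).
- by constructor 1; rewrite (bool_irrelevance isT i).
- by constructor 2; rewrite (bool_irrelevance isT i).
- by constructor 3; rewrite (bool_irrelevance isT i).
Qed.

Lemma snake_pos : is_composite cup_right_pos cap_left_pos strand_pos.
Proof.
have [i1 [i2 [gl s0 s1 i12]]] := zigzag.
exists i1, i2; split => //.
- move=> x y; rewrite i12.
  change ([\/ x = arc_end R (z2, false) /\ y = arc_end R (z2, true),
    x = arc_end R (o2, true) /\ y = arc_end R (z2, false)
    | x = arc_end R (o2, false) /\ y = arc_end R (o2, true)] <->
    exists k : 'I_3, x = outgoing cup_right_pos k /\ y = ingoing cap_left_pos k).
  rewrite ord3P.
  have E1 (k : 'I_3) : outgoing cup_right_pos k = cob_end cup_right_pos (inr k) by [].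
  have E2 (k : 'I_3) : ingoing cap_left_pos k = cob_end cap_left_pos (inl k) by [].
  by rewrite !E1 !E2 !(cob_end_table _ _ _ (z2, true)).
- move=> i; rewrite -[LHS]/(cob_end strand_pos (inl i)) -[X in i1 X]/(cob_end cup_right_pos (inl i)).
  by rewrite [i]ord1 (cob_end_table _ _ _ (ord0, true)) (cob_end_table _ _ _ (z2, true)) s0.
- move=> i; rewrite -[LHS]/(cob_end strand_pos (inr i)) -[X in i2 X]/(cob_end cap_left_pos (inr i)).
  by rewrite [i]ord1 (cob_end_table _ _ _ (ord0, true)) (cob_end_table _ _ _ (z2, true)) s1.
Qed.

(** The ingoing point of a negative strand is the terminal point of the interval, so the two maps of
    [zigzag] exchange their roles. *)
Lemma snake_neg : is_composite cup_left_neg cap_right_neg strand_neg.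
Proof.
have [i1 [i2 [gl s0 s1 i12]]] := zigzag.
exists i2, i1; split => //; first exact: glued_sym.
- move=> x y.
  change (i2 x = i1 y <->
    exists k : 'I_3, x = outgoing cup_left_neg k /\ y = ingoing cap_right_neg k).
  have -> : (i2 x = i1 y) = (i1 y = i2 x) by apply/propext; split.
  rewrite i12 ord3P.
  have E1 (k : 'I_3) : outgoing cup_left_neg k = cob_end cup_left_neg (inr k) by [].
  have E2 (k : 'I_3) : ingoing cap_right_neg k = cob_end cap_right_neg (inl k) by [].
  rewrite !E1 !E2 !(cob_end_table _ _ _ (z2, true)) /=.
  by split; case=> -[-> ->]; [constructor 1|constructor 2|constructor 3|constructor 1|constructor 2|constructor 3].
- move=> i; rewrite -[LHS]/(cob_end strand_neg (inl i)) -[X in i2 X]/(cob_end cup_left_neg (inl i)).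
  by rewrite [i]ord1 (cob_end_table _ _ _ (ord0, true)) (cob_end_table _ _ _ (z2, true)) s1.
- move=> i; rewrite -[LHS]/(cob_end strand_neg (inr i)) -[X in i1 X]/(cob_end cap_right_neg (inr i)).
  by rewrite [i]ord1 (cob_end_table _ _ _ (ord0, true)) (cob_end_table _ _ _ (z2, true)) s0.
Qed.

(** The loop is cut at the parameters 0 and 1/2. Its first half serves as the cup, its second half
    as the twisted cap; at one of the two gluing points the equation [h 0 = h 1] is used. *)
Lemma circle_composite (C : cob R [::] [::]) (h : 'I_1 -> R -> C) :
  edge_decomposition h -> h ord0 0 = h ord0 1 -> is_composite cup_cob twisted_cap_cob C.
Proof.
move=> dh hl.
have d1 := interval_path_decomposition R 1; have a1 := @interval_path_arc R 1.
have eh := dec_edge dh ord0.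
pose f r (k : 'I_1) := subpath (h ord0) r (r + 1 / 2).
have r0 : 0 <= (0 : R) <= 1 / 2 by lra.
have r1 : 0 <= (1 / 2 : R) <= 1 / 2 by lra.
have lift r : 0 <= r <= 1 / 2 -> exists i : intervals_manifold R 1 -> C,
   [/\ forall k t, 0 <= t <= 1 -> i (interval_path k t) = f r k t, continuous i & orientation_preserving i].
  move=> r01; have [|i iE] := dec_factor d1 (f := f r).
    by move=> k t u t01 u01 /(arcs_inj d1 a1 t01 u01)[_ ->].
  exists i; split => //.
    apply: (dec_continuous d1 iE) => k; apply: subpath_continuous; exact: edge_continuous eh.
  apply: (dec_orientation d1 a1 iE) => k.
  by apply: subpath_rising; [lra|lra|lra|exact: edge_rising eh].
have inj t u : 0 <= t <= 1 -> 0 <= u <= 1 -> h ord0 t = h ord0 u ->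
    [\/ t = u, t = 0 /\ u = 1 | t = 1 /\ u = 0].
  move=> t01 u01 E; case: (itv01P t01) => tE; last by constructor 1; exact: (edge_inj eh) E.
    case: (itv01P u01) => uE; [by constructor 1; rewrite tE|by constructor 2|].
    by constructor 1; apply/esym/(edge_inj eh).
  case: (itv01P u01) => uE; [by constructor 3|by constructor 1; rewrite tE|].
  by constructor 1; apply/esym/(edge_inj eh).
have key k l r q t u : 0 <= r <= 1 / 2 -> 0 <= q <= 1 / 2 -> 0 <= t <= 1 -> 0 <= u <= 1 ->
    f r k t = f q l u ->
    [\/ r + t / 2 = q + u / 2, r + t / 2 = 0 /\ q + u / 2 = 1 | r + t / 2 = 1 /\ q + u / 2 = 0].
  move=> r01 q01 t01 u01 /inj.
  have -> : r + t * (r + 1 / 2 - r) = r + t / 2 by lra.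
  have -> : q + u * (q + 1 / 2 - q) = q + u / 2 by lra.
  by apply; lra.
have injf r (i : intervals_manifold R 1 -> C) : 0 <= r <= 1 / 2 ->
    (forall k t, 0 <= t <= 1 -> i (interval_path k t) = f r k t) -> injective i.
  move=> r01 iE x y; have [k [t [t01 <-]]] := dec_param d1 x; have [l [u [u01 <-]]] := dec_param d1 y.
  rewrite !iE // => /(key _ _ _ _ _ _ r01 r01 t01 u01) E.
  by rewrite [k]ord1 [l]ord1; congr interval_path; case: E => E; lra.
have [i1 [i1E c1 or1]] := lift 0 r0.
have [i2 [i2E c2 or2]] := lift (1 / 2) r1.
exists i1, i2; split; last 2 first; try by case.
  apply: glued_intro => //; [exact: injf i1E|exact: injf i2E|].
  move=> x; have [k [t [t01 <-]]] := dec_param dh x; rewrite [k]ord1.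
  have [t1|t1] := ltrP t (1 / 2).
    left; exists (interval_path ord0 (2 * t)); rewrite i1E; last by lra.
    by rewrite /f /subpath; congr (h ord0 _); lra.
  right; exists (interval_path ord0 (2 * t - 1)); rewrite i2E; last by lra.
  by rewrite /f /subpath; congr (h ord0 _); lra.
move=> x y.
have E1 (k : 'I_2) : outgoing cup_cob k = cob_end cup_cob (inr k) by [].
have E2 (k : 'I_2) : ingoing twisted_cap_cob k = cob_end twisted_cap_cob (inl k) by [].
split.
  have [k [t [t01 <-]]] := dec_param d1 x; have [l [u [u01 <-]]] := dec_param d1 y.
  rewrite i1E // i2E // => /(key _ _ _ _ _ _ r0 r1 t01 u01) E.
  rewrite [k]ord1 [l]ord1; have [E'|E'] : (t = 1 /\ u = 0) \/ (t = 0 /\ u = 1).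
  + by case: E => E; [left|right|left]; lra.
  + exists o2; rewrite E1 E2 !(cob_end_table _ _ _ (ord0, true)).
    by rewrite /arc_end /=; case: E' => -> ->.
  + exists z2; rewrite E1 E2 !(cob_end_table _ _ _ (ord0, true)).
    by rewrite /arc_end /=; case: E' => -> ->.
move=> [k [-> ->]]; rewrite (E1 k) (E2 k) !(cob_end_table _ _ _ (ord0, true)) /arc_end /=.
have I s := endpoint_itv R s.
case: k => [[|[|//]] ?] /=; rewrite i1E ?i2E // ?lexx ?ler01 // /f /subpath.
  by rewrite !mul0r !mul1r !addr0 hl; congr (h ord0 _); lra.
by rewrite !mul0r !mul1r !addr0; congr (h ord0 _); lra.
Qed.

End ElementaryCobordisms.

(** * Circles *)

Section CircleComponents.
Variable R : realType.
Implicit Type M : omanifold R.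

Lemma within_comp (X Y Z : topologicalType) (A : set Y) (u : X -> Y) (phi : Y -> Z) :
  continuous u -> (forall x, A (u x)) -> {within A, continuous phi} ->
  continuous (phi \o u).
Proof.
move=> cu Au /subspace_continuousP cphi x W Wx.
have near : nbhs (u x) [set y | A y -> W (phi y)] := cphi (u x) (Au x) W Wx.
have nx : nbhs x (u @^-1` [set y | A y -> W (phi y)]) := cu x _ near.
change (nbhs x ((phi \o u) @^-1` W)); apply: filterS nx => s; exact.
Qed.

Lemma sqrt_expr_continuous (f : R -> R) : continuous f ->
  continuous (fun t => Num.sqrt (1 - f t ^+ 2)).
Proof.
move=> cf; apply: (@comp_continuous R R R (fun t => 1 - f t ^+ 2) Num.sqrt); last exact: sqrt_continuous.
apply: (@comp_continuous R R R f (fun s => 1 - s ^+ 2)) => // s.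
apply: (@continuousB R R^o R (fun=> 1) (fun s : R => s ^+ 2)); first exact: cst_continuous.
exact: exprn_continuous.
Qed.

Lemma pair_continuous (f g : R -> R) :
  continuous f -> continuous g -> continuous (fun t => (f t, g t) : R * R).
Proof.
move=> cf cg t; apply: (@cvg_pair R R R (nbhs t) (nbhs (f t)) (nbhs (g t))).
- exact: cf.
- exact: cg.
Qed.

(* On both half circles from (-1, 0) to (1, 0), [phi] takes the mean of its values there. *)
Lemma circle_not_line (phi : R * R -> R) :
  {within @circle R, continuous phi} -> ~ (forall x y, circle x -> circle y -> phi x = phi y -> x = y).
Proof.
move=> cphi inj.
pose x t : R := -1 + clamp t * 2.
have cx : continuous x.
  exact: (@comp_continuous R R R (@clamp R) (fun t => -1 + t * 2) (@clamp_continuous R) (@affine_continuous R _ _)).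
pose y t := Num.sqrt (1 - x t ^+ 2).
have cy : continuous y by exact: sqrt_expr_continuous.
have x2 t : 0 <= 1 - x t ^+ 2.
  by have /andP[c0 c1] := clamp_itv t; rewrite /x; nra.
have u_circle t : circle (x t, y t).
  by rewrite /circle /= sqr_sqrtr // addrC subrK.
have l_circle t : circle (x t, - y t).
  by rewrite /circle /= sqrrN sqr_sqrtr // addrC subrK.
have cyN : continuous (fun t => - y t).
  by move=> t; apply: (@continuousN R R^o R); apply: cy.
have cu := within_comp (pair_continuous cx cy) u_circle cphi.
have cl := within_comp (pair_continuous cx cyN) l_circle cphi.
have clamp0 : clamp 0 = 0 :> R by rewrite clamp_id // lexx ler01.
have clamp1 : clamp 1 = 1 :> R by rewrite clamp_id // lexx ler01.
have x0 : x 0 = -1 by rewrite /x clamp0 mul0r addr0.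
have x1 : x 1 = 1 by rewrite /x clamp1; lra.
have y0 : y 0 = 0 by rewrite /y x0 sqrrN expr1n subrr sqrtr0.
have y1 : y 1 = 0 by rewrite /y x1 expr1n subrr sqrtr0.
pose p := phi (-1, 0); pose q := phi (1, 0); pose m := (p + q) / 2.
have cm : Num.min p q <= m <= Num.max p q.
  by rewrite ge_min le_max /m; case: (lerP p q) => pq; apply/andP; split; apply/orP;
    first [left; lra|right; lra].
have [||t t01 tm] := @IVT R (fun t => phi (x t, y t)) 0 1 m ler01.
- exact: continuous_subspaceT.
- by rewrite x0 x1 y0 y1.
have [||u u01 um] := @IVT R (fun t => phi (x t, - y t)) 0 1 m ler01.
- exact: continuous_subspaceT.
- by rewrite x0 x1 y0 y1 oppr0.
(* Equal values force the two points to coincide. One is on or above the axis, the other on or below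
   it, so they are a common end of the half circles; there the mean equals an end value, which gives
   [p = q]. *)
have [xE yE] : x t = x u /\ y t = - y u.
  have [] : (x t, y t) = (x u, - y u) by apply: inj => //; rewrite tm um.
  by [].
have yt0 : y t = 0.
  have yu : y u = y t by rewrite /y xE.
  by rewrite yu in yE; lra.
have pq : p <> q.
  move=> E; have C1 : circle (-1, 0 : R) by rewrite /circle /= sqrrN expr1n expr0n addr0.
  have C2 : circle (1, 0 : R) by rewrite /circle /= expr1n expr0n addr0.
  have [] : (-1, 0) = (1, 0) :> R * R by apply: inj.
  by lra.
have xt : x t = -1 \/ x t = 1.
  have : 1 - x t ^+ 2 = 0 by rewrite -(sqr_sqrtr (x2 t)) -/(y t) yt0 expr0n.
  move/eqP; rewrite subr_eq0 eq_sym sqrf_eq1 => /orP[] /eqP; tauto.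
by case: xt => xt; rewrite xt yt0 in tm; apply: pq; move: tm; rewrite /m -/p -/q; lra.
Qed.

(** Starts at (1, 0), runs along the upper half circle to (-1, 0) and back along the lower one. As
    [Num.sqrt] vanishes on negative numbers, each root contributes on its own half of [0,1] only. *)
Definition circle_path (t : R) : R * R :=
  (`|4 * t - 2| - 1, Num.sqrt (1 - (1 - 4 * t) ^+ 2) - Num.sqrt (1 - (4 * t - 3) ^+ 2)).

Lemma circle_path_continuous : continuous circle_path.
Proof.
have c1 : continuous (fun t : R => 4 * t - 2).
  rewrite (_ : (fun t => _) = (fun t : R => -2 + t * 4)); first exact: affine_continuous.
  by apply/funext => t; rewrite addrC mulrC.
have c2 : continuous (fun t : R => 1 - 4 * t).
  rewrite (_ : (fun t => _) = (fun t : R => 1 + t * -4)); first exact: affine_continuous.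
  by apply/funext => t; rewrite mulrN mulrC.
have c3 : continuous (fun t : R => 4 * t - 3).
  rewrite (_ : (fun t => _) = (fun t : R => -3 + t * 4)); first exact: affine_continuous.
  by apply/funext => t; rewrite addrC mulrC.
apply: pair_continuous => [|t].
  apply: (@comp_continuous R R R (fun t => 4 * t - 2) (fun s => `|s| - 1)) => // s.
  apply: (@continuousB R R^o R (fun s : R => `|s|) (fun=> 1)); last exact: cst_continuous.
  exact: norm_continuous.
apply: (@continuousB R R^o R (fun t : R => Num.sqrt (1 - (1 - 4 * t) ^+ 2))
  (fun t : R => Num.sqrt (1 - (4 * t - 3) ^+ 2))); exact: sqrt_expr_continuous.
Qed.

Lemma circle_path_lower (t : R) : 0 <= t <= 1 / 2 ->
  circle_path t = (1 - 4 * t, Num.sqrt (1 - (1 - 4 * t) ^+ 2)).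
Proof.
move=> t01; rewrite /circle_path; congr pair.
  by rewrite ler0_norm; lra.
by rewrite [X in _ - X]ler0_sqrtr ?subr0 //; nra.
Qed.

Lemma circle_path_upper (t : R) : 1 / 2 <= t <= 1 ->
  circle_path t = (4 * t - 3, - Num.sqrt (1 - (4 * t - 3) ^+ 2)).
Proof.
move=> t01; rewrite /circle_path; congr pair.
  by rewrite ger0_norm; lra.
by rewrite [X in X - _]ler0_sqrtr ?sub0r //; nra.
Qed.

Lemma circle_path_circle t : 0 <= t <= 1 -> circle (circle_path t).
Proof.
move=> t01; have [th|th] := lerP t (1 / 2).
  rewrite circle_path_lower; last by lra.
  by rewrite /circle /= sqr_sqrtr; [rewrite addrC subrK|nra].
rewrite circle_path_upper; last by lra.
by rewrite /circle /= sqrrN sqr_sqrtr; [rewrite addrC subrK|nra].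
Qed.

Lemma circle_path_surj z : circle z -> exists2 t, 0 <= t <= 1 & circle_path t = z.
Proof.
case: z => x y; rewrite /circle /= => xy.
have x1 : -1 <= x <= 1 by apply/andP; split; nra.
have xE : 1 - x ^+ 2 = y ^+ 2 by lra.
have [y0|y0] := lerP 0 y.
  exists ((1 - x) / 4); first by lra.
  rewrite circle_path_lower; last by lra.
  have -> : 1 - 4 * ((1 - x) / 4) = x by lra.
  by rewrite xE sqrtr_sqr ger0_norm.
exists ((3 + x) / 4); first by lra.
rewrite circle_path_upper; last by lra.
have -> : 4 * ((3 + x) / 4) - 3 = x by lra.
by rewrite xE sqrtr_sqr ltr0_norm // opprK.
Qed.

Lemma circle_path_fiber t u : 0 <= t <= 1 -> 0 <= u <= 1 -> circle_path t = circle_path u ->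
  [\/ t = u, t = 0 /\ u = 1 | t = 1 /\ u = 0].
Proof.
have mixed (s r : R) : 0 <= s <= 1 / 2 -> 1 / 2 <= r <= 1 -> circle_path s = circle_path r ->
    s = r \/ s = 0 /\ r = 1.
  move=> s01 r01; rewrite circle_path_lower // circle_path_upper // => -[xE yE].
  rewrite -xE in yE.
  have s0 := sqrtr_ge0 (1 - (1 - 4 * s) ^+ 2).
  have : Num.sqrt (1 - (1 - 4 * s) ^+ 2) = 0 by lra.
  move/eqP; rewrite sqrtr_eq0 => le0.
  have : s = 0 \/ s = 1 / 2.
    have /eqP : s * (s - 1 / 2) = 0 by nra.
    by rewrite mulf_eq0 subr_eq0 => /orP[] /eqP; tauto.
  by case=> sE; [right|left]; lra.
move=> t01 u01; have [th|th] := lerP t (1 / 2); have [uh|uh] := lerP u (1 / 2).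
- rewrite !circle_path_lower; [|lra|lra] => -[E _]; by constructor 1; lra.
- move=> E; have [||->|[-> ->]] := mixed t u _ _ E; [lra|lra|by constructor 1|by constructor 2].
- move=> E; have [||->|[-> ->]] := mixed u t _ _ (esym E); [lra|lra|by constructor 1|by constructor 3].
- rewrite !circle_path_upper; [|lra|lra] => -[E _]; by constructor 1; lra.
Qed.

Section Components.
Variables (M : omanifold R) (n : nat) (h : 'I_n -> R -> M).
Hypothesis dh : edge_decomposition h.

(** A trace is connected, as the image of an interval, and clopen, so it contains every connected
    set that meets it. *)
Lemma component_trace k x : trace (h k) x ->
  connected_component [set: M] x = trace (h k).
Proof.
move=> kx; apply/seteqP; split; last first.
  apply: connected_component_max => //.
  have -> : trace (h k) = h k @` `[0, 1]%classic.
    by apply/seteqP; split => y [t t01 <-]; exists t.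
  apply: connected_continuous_connected.
    exact/connected_intervalP/interval_is_interval.
  exact/continuous_subspaceT/edge_continuous/(dec_edge dh).
have [clk opk] := trace_clopen dh [set k]; rewrite bigcup_set1 in clk opk.
have := @component_connected M [set: M] x; set C := connected_component _ _ => cC.
have Cx : C x by exact: connected_component_refl.
have <- : C `&` trace (h k) = C.
  apply: cC; first by exists x.
    by exists (trace (h k)).
  by exists (trace (h k)).
by move=> y [].
Qed.

(** On an arc the parameter is an injective continuous function, which [circle_not_line] forbids on
    a circle. On a loop [h k] and [circle_path] identify the same parameters, so each factors
    through the other. *)
Lemma loop_circle k : homeomorphic_sets (trace (h k)) (@circle R) <-> h k 0 = h k 1.
Proof.
have z01 : 0 <= (0 : R) <= 1 by rewrite lexx ler01.
have o01 : 0 <= (1 : R) <= 1 by rewrite lexx ler01.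
split.
  move=> [f [g [[cf fA] [cg gA] gf fg]]]; apply: contrapT => hk.
  have [|F FE] := dec_factor dh (f := fun l t => if l == k then t else 0).
    move=> l t u t01 u01; case: eqP => // -> E.
    exact: (arc_inj (dec_edge dh k) hk) E.
  have cF : continuous F.
    apply: (dec_continuous dh FE) => l; case: eqP => _ t; [exact: cvg_id|exact: cst_continuous].
  apply: (@circle_not_line (F \o g)).
    apply/subspace_continuousP => z Cz; move/subspace_continuousP : cg => cg.
    exact: cvg_comp (cg z Cz) (cF (g z)).
  move=> x y Cx Cy /=; have [t t01 tE] := gA x Cx; have [u u01 uE] := gA y Cy.
  rewrite -tE -uE !FE // eqxx => tu; rewrite -(fg x) // -(fg y) // -tE -uE.
  by rewrite tu.
move=> hk.
have fiber t u : 0 <= t <= 1 -> 0 <= u <= 1 -> (h k t = h k u <-> circle_path t = circle_path u).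
  move=> t01 u01; split => [E|/circle_path_fiber[]//].
  - have q01 : circle_path 0 = circle_path 1.
      rewrite circle_path_lower ?circle_path_upper; [|lra|lra].
      rewrite mulr0 subr0 expr1n subrr sqrtr0.
      have -> : 4 * 1 - 3 = 1 :> R by lra.
      by rewrite expr1n subrr sqrtr0 oppr0.
    case: (itv01P t01) => tE; last by rewrite (edge_inj (dec_edge dh k) tE u01 E).
      case: (itv01P u01) => uE; [by rewrite tE uE|by rewrite tE uE|].
      by rewrite (edge_inj (dec_edge dh k) uE t01 (esym E)).
    case: (itv01P u01) => uE; [by rewrite tE uE|by rewrite tE uE|].
    by rewrite (edge_inj (dec_edge dh k) uE t01 (esym E)).
  - by move=> ->.
  - by move=> [-> ->].
  - by move=> [-> ->].
have [|f fE] := dec_factor dh (f := fun l t => if l == k then circle_path t else (0, 0)).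
  by move=> l t u t01 u01; case: eqP => // ->; rewrite (fiber t u).
have cf : continuous f.
  apply: (dec_continuous dh fE) => l; case: eqP => _; first exact: circle_path_continuous.
  exact: cst_continuous.
have fk t : 0 <= t <= 1 -> f (h k t) = circle_path t by move=> t01; rewrite fE // eqxx.
have /choice[g gP] : forall z, exists y, forall t, 0 <= t <= 1 -> circle_path t = z -> y = h k t.
  move=> z; case: (pselect (circle z)) => [Cz|nC].
    have [t t01 tz] := circle_path_surj Cz; exists (h k t) => u u01 uz.
    by apply/fiber; rewrite // tz.
  by exists (h k 0) => t t01 tz; case: nC; rewrite -tz; apply: circle_path_circle.
exists f, g; split.
- split; first exact: continuous_subspaceT.
  by move=> _ [t t01 <-]; rewrite fk //; apply: circle_path_circle.
- split; last first.
    move=> z Cz; have [t t01 tz] := circle_path_surj Cz.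
    by exists t => //; apply/esym; apply: gP.
  (* Continuity of the inverse by compactness: the preimage of [C] under [g] is the image under [f]
     of a compact set. *)
  apply/continuous_closedP => C clC; apply/closed_subspaceP.
  exists (f @` (trace (h k) `&` C)).
    apply: compact_closed; first exact: norm_hausdorff.
      apply: continuous_compact; first exact: continuous_subspaceT.
      apply: subclosed_compact (@omanifold_compact R M) _ => //.
      by apply: closedI => //; exact/trace_closed/edge_continuous/(dec_edge dh).
    apply/seteqP; split => [z [[x [[t t01 tx] Cx] xz] Qz]|z [Cz Qz]]; split => //.
      have gz : g z = h k t by apply: gP => //; rewrite -fk // tx.
      by change (C (g z)); rewrite gz tx.
    have [t t01 tz] := circle_path_surj Qz.
    have gz := gP z t t01 tz.
    exists (h k t); last by rewrite fk.
    by split; [exists t|rewrite -gz; exact: Cz].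
- by move=> _ [t t01 <-]; rewrite fk //; apply: gP.
- move=> z Cz; have [t t01 tz] := circle_path_surj Cz.
  by rewrite (gP z t t01 tz) fk.
Qed.

End Components.

Section CobordismComponents.
Variables (a b : word) (K : cob R a b) (n : nat) (h : 'I_n -> R -> K).
Hypothesis dh : edge_decomposition h.

Lemma same_componentP x y : same_component K x y <->
  exists k, trace (h k) (cob_end K x) /\ trace (h k) (cob_end K y).
Proof.
rewrite /same_component; have [k kx] := dec_cover dh (cob_end K x).
rewrite (component_trace dh kx); split => [ky|[l [lx ly]]]; first by exists k.
by rewrite (dec_disjoint dh kx lx).
Qed.

Lemma num_circlesE : num_circles K = #|[pred k | `[< h k 0 = h k 1 >]]|.
Proof.
pose L : {set 'I_n} := [set k | `[< h k 0 = h k 1 >]]%SET.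
have tr_inj : injective (fun k => trace (h k)).
  move=> k l E; apply: (dec_disjoint dh (x := h k 0)); first exact: trace0.
  by rewrite -E; exact: trace0.
rewrite /num_circles.
have -> : [set C : set K | (exists x, C = connected_component [set: K] x) /\
    homeomorphic_sets C (@circle R)] = [set` [fset trace (h k) | k in L]%fset].
  apply/seteqP; split => [C [[x ->] hC]|C /= /imfsetP[k /= kL ->]].
    have [k kx] := dec_cover dh x; rewrite (component_trace dh kx) in hC *.
    apply/imfsetP; exists k => //=; rewrite inE; apply/asboolP.
    exact/(loop_circle dh).
  move: kL; rewrite inE => /asboolP kl; split; last exact/(loop_circle dh).
  by exists (h k 0); rewrite (component_trace dh (trace0 (h k))).
rewrite set_fsetK card_imfset //= -cardE.
by apply: eq_card => k; rewrite !inE.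
Qed.

End CobordismComponents.

End CircleComponents.

(** * Matrix entries *)

Section Entries.
Variable K : fieldType.

(* Natural number indices make entries insensitive to casts; out of range the value is 0. *)
Definition ent m n (A : 'M[K]_(m, n)) (i j : nat) : K :=
  match insub i : option 'I_m, insub j : option 'I_n with
  | Some i', Some j' => A i' j'
  | _, _ => 0
  end.

Lemma ent_ord m n (A : 'M[K]_(m, n)) (i : 'I_m) (j : 'I_n) : ent A i j = A i j.
Proof. by rewrite /ent !valK. Qed.

Lemma ent_lt m n (A : 'M[K]_(m, n)) i j (im : (i < m)%N) (jn : (j < n)%N) :
  ent A i j = A (Ordinal im) (Ordinal jn).
Proof. by rewrite -[i]/(val (Ordinal im)) -[j]/(val (Ordinal jn)) ent_ord. Qed.

Lemma ent_out m n (A : 'M[K]_(m, n)) i j : ~~ ((i < m)%N && (j < n)%N) -> ent A i j = 0.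
Proof.
rewrite /ent negb_and => /orP[] H; first by rewrite insubN.
by case: insub => // ?; rewrite insubN.
Qed.

Lemma ent_inj m n (A B : 'M[K]_(m, n)) :
  (forall i j, (i < m)%N -> (j < n)%N -> ent A i j = ent B i j) -> A = B.
Proof. by move=> AB; apply/matrixP => i j; rewrite -!ent_ord AB. Qed.

Lemma ent_cast m n m' n' (e : (m = m') * (n = n')) (A : 'M[K]_(m, n)) i j :
  ent (castmx e A) i j = ent A i j.
Proof. by case: e => e1 e2; subst m' n'; rewrite castmx_id. Qed.

Lemma ent_mul m n q (A : 'M[K]_(m, n)) (B : 'M[K]_(n, q)) i j :
  ent (A *m B) i j = \sum_(k < n) ent A i k * ent B k j.
Proof.
have [/andP[im jq]|nij] := boolP ((i < m)%N && (j < q)%N).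
  rewrite (ent_lt _ im jq) mxE; apply: eq_bigr => k _.
  by rewrite (ent_lt _ im (ltn_ord k)) (ent_lt _ (ltn_ord k) jq); congr (A _ _ * B _ _); apply: val_inj.
rewrite ent_out // big1 // => k _; move: nij; rewrite negb_and => /orP[] H.
  by rewrite ent_out ?mul0r // negb_and H.
by rewrite mulrC ent_out ?mul0r // negb_and H orbT.
Qed.

Lemma ent_1 n i j : (i < n)%N -> ent (1%:M : 'M[K]_n) i j = (i == j)%:R.
Proof.
move=> iN; have [jN|jN] := ltnP j n; first by rewrite (ent_lt _ iN jN) mxE.
rewrite ent_out ?iN -?leqNgt //; case: eqP => // ij; by rewrite -ij leqNgt iN in jN.
Qed.

Lemma ent_tens m1 n1 m2 n2 (A : 'M[K]_(m1, n1)) (B : 'M[K]_(m2, n2)) i j :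
  ent (A *t B) i j = ent A (i %/ m2) (j %/ n2) * ent B (i %% m2) (j %% n2).
Proof.
have ltM (a b c : nat) : (c < a * b)%N = (c %/ b < a)%N && (c %% b < b)%N.
  case: b => [|b]; first by rewrite muln0 modn0 divn0 !ltn0 andbF.
  by rewrite ltn_divLR // ltn_mod andbT.
have [/andP[im jn]|nij] := boolP ((i < m1 * m2)%N && (j < n1 * n2)%N).
  rewrite (ent_lt _ im jn) mxE.
  have := im; rewrite ltM => /andP[i1 i2]; have := jn; rewrite ltM => /andP[j1 j2].
  rewrite (ent_lt _ i1 j1) (ent_lt _ i2 j2).
  by congr (A _ _ * B _ _); apply: val_inj.
rewrite ent_out //; move: nij; rewrite !ltM !negb_and -!orbA => /or4P[] H.
- by rewrite ent_out ?mul0r // negb_and H.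
- by rewrite mulrC ent_out ?mul0r // negb_and H.
- by rewrite ent_out ?mul0r // negb_and H orbT.
- by rewrite mulrC ent_out ?mul0r // negb_and H orbT.
Qed.

Lemma ent_tens_block m1 n1 m2 n2 (A : 'M[K]_(m1, n1)) (B : 'M[K]_(m2, n2)) i1 i2 j1 j2 :
  (i2 < m2)%N -> (j2 < n2)%N ->
  ent (A *t B) (i1 * m2 + i2) (j1 * n2 + j2) = ent A i1 j1 * ent B i2 j2.
Proof.
move=> i2m j2n; rewrite ent_tens !divnMDl ?(leq_ltn_trans _ i2m) ?(leq_ltn_trans _ j2n) //.
by rewrite !divn_small // !addn0 !modnMDl !modn_small.
Qed.

Lemma sum_blocks (f : nat -> K) m n :
  \sum_(k < m * n) f k = \sum_(i < m) \sum_(j < n) f (i * n + j)%N.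
Proof.
rewrite pair_big (reindex (@mxtens_index m n)) //=; last first.
  exists (@mxtens_unindex m n) => i _; [exact: mxtens_indexK|exact: mxtens_unindexK].
Qed.

Lemma sum_delta (f : nat -> K) n i : (i < n)%N ->
  \sum_(k < n) f k * (k == i :> nat)%:R = f i.
Proof.
move=> iN; rewrite (bigD1 (Ordinal iN)) //= eqxx mulr1 big1 ?addr0 // => k ki.
by move: ki; rewrite -val_eqE /= => /negbTE ->; rewrite mulr0.
Qed.

Lemma block_lt m n i j : (i < m)%N -> (j < n)%N -> (i * n + j < m * n)%N.
Proof.
move=> im jn; have : (i.+1 * n <= m * n)%N by rewrite leq_mul2r im orbT.
by rewrite mulSn; lia.
Qed.

(** Shape of a snake identity in coordinates: the two deltas come from the identity strands and fix
    the outer indices, which leaves a matrix product over [y]. *)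
Lemma zigzag_sum m n (f g h : nat -> K) i j : (i < m)%N -> (j < m)%N ->
  (forall x y z, (x < m)%N -> (y < n)%N -> (z < m)%N ->
    f ((x * n + y) * m + z)%N = g (x * n + y)%N * h (y * m + z)%N * ((x == i)%:R * (z == j)%:R)) ->
  \sum_(k < m * n * m) f k = \sum_(y < n) g (i * n + y)%N * h (y * m + j)%N.
Proof.
move=> im jm fE; rewrite (sum_blocks f) (sum_blocks (fun k => \sum_(z < m) f (k * m + z)%N)).
rewrite -[RHS](sum_delta (fun x => \sum_(y < n) g (x * n + y)%N * h (y * m + j)%N) im).
apply: eq_bigr => x _; rewrite mulr_suml; apply: eq_bigr => y _.
rewrite -(sum_delta (fun z => g (x * n + y)%N * h (y * m + z)%N) jm) mulr_suml.
by apply: eq_bigr => z _; rewrite fE // mulrA mulrAC.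
Qed.

Lemma mulmx_castmx m m' n n' q q' (em : m = m') (en en' : n = n') (eq : q = q')
    (A : 'M[K]_(m, n)) (B : 'M[K]_(n, q)) :
  castmx (em, en) A *m castmx (en', eq) B = castmx (em, eq) (A *m B).
Proof. by subst m' n' q'; rewrite (eq_irrelevance en' erefl) !castmx_id. Qed.

Lemma tensmx11 m n : (1%:M : 'M[K]_m) *t (1%:M : 'M[K]_n) = 1%:M.
Proof.
apply/matrixP => i j; case: (mxtens_indexP i) => i1 i2; case: (mxtens_indexP j) => j1 j2.
rewrite tensmxE !mxE -natrM mulnb; congr (_%:R); congr nat_of_bool.
by rewrite (can_eq (@mxtens_indexK _ _)) xpair_eqE.
Qed.

(** Naturality of the symmetry of Mat, by which conjugation with theta preserves symmetries. *)
Lemma commutation_mulmx m1 n1 m2 n2 (A : 'M[K]_(m1, n1)) (B : 'M[K]_(m2, n2)) :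
  commutation_mx K m1 m2 *m (A *t B) = (B *t A) *m commutation_mx K n1 n2.
Proof.
apply/matrixP => i j; case: (mxtens_indexP i) => i2 i1; case: (mxtens_indexP j) => j1 j2.
rewrite !mxE (bigD1 (mxtens_index (i1, i2))) //= big1 ?addr0; last first.
  move=> k; case: (mxtens_indexP k) => k1 k2 kn; rewrite !mxE !mxtens_indexK /=.
  case: eqP => [e1|]; last by rewrite mul0r.
  case: eqP => [e2|]; last by rewrite mul0r.
  by rewrite e1 e2 eqxx in kn.
rewrite (bigD1 (mxtens_index (j2, j1))) //= big1 ?addr0; last first.
  move=> k; case: (mxtens_indexP k) => k1 k2 kn; rewrite !mxE !mxtens_indexK /=.
  case: eqP => [e1|]; last by rewrite mulr0.
  case: eqP => [e2|]; last by rewrite mulr0.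
  by rewrite e1 e2 eqxx in kn.
by rewrite !mxE !mxtens_indexK /= !eqxx mul1r mulr1 mulrC.
Qed.

Lemma ent_commutation m n i1 i2 j1 j2 : (i1 < m)%N -> (i2 < n)%N -> (j1 < m)%N -> (j2 < n)%N ->
  ent (commutation_mx K m n) (i2 * m + i1) (j1 * n + j2) = ((i1 == j1) && (i2 == j2))%:R.
Proof.
move=> h1 h2 h3 h4.
rewrite -[(i2 * m + i1)%N]/(val (mxtens_index (Ordinal h2, Ordinal h1))).
rewrite -[(j1 * n + j2)%N]/(val (mxtens_index (Ordinal h3, Ordinal h4))).
by rewrite ent_ord mxE !mxtens_indexK /= -!val_eqE /= andbC.
Qed.

End Entries.

(** * Base-p digit strings as matrix indices *)

Section Digits.
Variable p : nat.
Hypothesis p_gt0 : (0 < p)%N.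

Definition digits (n : nat) (s : seq nat) : bool := (size s == n) && all (fun x => x < p)%N s.

Fixpoint code (s : seq nat) : nat :=
  if s is x :: s' then (x * p ^ size s' + code s')%N else 0%N.

(** Concatenation of strings agrees with the block numbering of [ent_tens_block], so Kronecker
    products can be read off string by string. *)
Lemma code_cat s t : code (s ++ t) = (code s * p ^ size t + code t)%N.
Proof.
clear p_gt0; elim: s => //= x s ->; rewrite size_cat expnD mulnDl; lia.
Qed.

Lemma digits_size n s : digits n s -> size s = n.
Proof. by case/andP => /eqP. Qed.

Lemma digits_cat m n s t : size s = m -> digits (m + n) (s ++ t) = digits m s && digits n t.
Proof.
by move=> <-; rewrite /digits size_cat eqn_add2l all_cat eqxx /= andbCA.
Qed.

Lemma code_lt n s : digits n s -> (code s < p ^ n)%N.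
Proof.
case/andP => /eqP <-; elim: s => [|x s IH] //=.
move=> /andP[xp /IH cs]; rewrite expnS.
have : (x.+1 * p ^ size s <= p * p ^ size s)%N by rewrite leq_mul2r xp orbT.
by rewrite mulSn; lia.
Qed.

Lemma lex_fun_code n s u : digits n s -> (u < n)%N -> lex_fun p n (code s) u = nth 0%N s u.
Proof.
move=> ds un; have sn := digits_size ds.
have [x [s1 [s2 [sE us xE]]]] : exists x s1 s2, [/\ s = s1 ++ x :: s2, size s1 = u & nth 0%N s u = x].
  exists (nth 0%N s u), (take u s), (drop u.+1 s); split => //.
    by rewrite -drop_nth ?cat_take_drop // sn.
  by rewrite size_take sn un.
rewrite xE; have n2 : (n - u.+1)%N = size s2 by rewrite -sn sE size_cat us /=; lia.
have : digits n s by []; rewrite {1}sE /digits all_cat => /andP[_ /andP[_ /= /andP[xp s2p]]].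
have c2 : (code s2 < p ^ size s2)%N by apply: code_lt; rewrite /digits eqxx.
rewrite /lex_fun n2 sE code_cat /= expnS.
have -> : (code s1 * (p * p ^ size s2) + (x * p ^ size s2 + code s2) =
  (code s1 * p + x) * p ^ size s2 + code s2)%N by lia.
rewrite divnMDl ?expn_gt0 ?p_gt0 // divn_small // addn0 modnMDl modn_small //.
Qed.

Lemma code_inj n s t : digits n s -> digits n t -> code s = code t -> s = t.
Proof.
move=> ds dt st; have sn := digits_size ds; have tn := digits_size dt.
apply: (@eq_from_nth _ 0%N); first by rewrite sn tn.
by move=> u; rewrite sn => un; rewrite -(lex_fun_code ds un) st (lex_fun_code dt un).
Qed.

Lemma code_eq n s t : digits n s -> digits n t -> (code s == code t) = (s == t).
Proof.
by move=> ds dt; apply/eqP/eqP => [|->] //; exact: code_inj ds dt.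
Qed.

Lemma code_surj n i : (i < p ^ n)%N -> exists2 s, digits n s & code s = i.
Proof.
elim: n i => [|n IH] i; first by rewrite expn0 ltnS leqn0 => /eqP ->; exists [::].
have pn : (0 < p ^ n)%N by rewrite expn_gt0 p_gt0.
rewrite expnS => ip; have [s ds sE] := IH (i %% p ^ n)%N (ltn_pmod _ pn).
exists ((i %/ p ^ n)%N :: s); last by rewrite /= sE (digits_size ds) -divn_eq.
by move: ds; rewrite /digits /= eqSS => /andP[-> ->]; rewrite ltn_divLR // ip.
Qed.

Lemma digits_split m n s : digits (m + n) s ->
  exists s1 s2, [/\ s = s1 ++ s2, digits m s1 & digits n s2].
Proof.
clear p_gt0; move=> ds; have sn := digits_size ds.
have sm : size (take m s) = m by rewrite size_take sn; case: ltnP => //; lia.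
exists (take m s), (drop m s); rewrite cat_take_drop; split => //;
  by move: ds; rewrite -{1}(cat_take_drop m s) digits_cat // => /andP[].
Qed.

Lemma digits1 s : digits 1 s -> exists2 x, s = [:: x] & (x < p)%N.
Proof. by case: s => [|x [|y s]] //; rewrite /digits /= andbT => xp; exists x. Qed.

End Digits.

(** * Functors with the standard cap and cup *)

Section BlockSwaps.
Variable R : realType.
Implicit Type M : omanifold R.

Definition cat_map (a b c d : word) (s1 : 'I_(size a) -> 'I_(size b))
    (s2 : 'I_(size c) -> 'I_(size d)) (k : 'I_(size (a ++ c))) : 'I_(size (b ++ d)) :=
  match fintype.split (cast_ord (size_cat a c) k) with
  | inl i => lcat d (s1 i)
  | inr j => rcat b (s2 j)
  end.

Lemma split_lcat (a c : word) (i : 'I_(size a)) :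
  fintype.split (cast_ord (size_cat a c) (lcat c i)) = inl i.
Proof. by rewrite /lcat cast_ordKV -[lshift _ _]/(unsplit (inl i)) unsplitK. Qed.

Lemma split_rcat (a c : word) (j : 'I_(size c)) :
  fintype.split (cast_ord (size_cat a c) (rcat a j)) = inr j.
Proof. by rewrite /rcat cast_ordKV -[rshift _ _]/(unsplit (inr j)) unsplitK. Qed.

Lemma cat_map_lcat (a b c d : word) s1 s2 i :
  @cat_map a b c d s1 s2 (lcat c i) = lcat d (s1 i).
Proof. by rewrite /cat_map split_lcat. Qed.

Lemma cat_map_rcat (a b c d : word) s1 s2 j :
  @cat_map a b c d s1 s2 (rcat a j) = rcat b (s2 j).
Proof. by rewrite /cat_map split_rcat. Qed.

Lemma swap_lcat (a b : word) (i : 'I_(size a)) : swap_ord (lcat b i) = rcat b i.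
Proof. by rewrite /swap_ord split_lcat. Qed.

Lemma swap_rcat (a b : word) (j : 'I_(size b)) : swap_ord (rcat a j) = lcat a j.
Proof. by rewrite /swap_ord split_rcat. Qed.

Lemma swap_ordK (a b : word) : cancel (@swap_ord a b) (@swap_ord b a).
Proof.
by move=> k; case: (cat_ordP k) => -[i <-]; rewrite ?(swap_lcat, swap_rcat).
Qed.

Lemma cat_mapK (a b c d : word) s1 s2 s1' s2' : cancel s1 s1' -> cancel s2 s2' ->
  cancel (@cat_map a b c d s1 s2) (@cat_map b a d c s1' s2').
Proof.
move=> K1 K2 k; case: (cat_ordP k) => -[i <-];
  by rewrite ?(cat_map_lcat, cat_map_rcat) ?(K1, K2).
Qed.

(** A symmetry next to an identity. With [w] a single letter it brings that letter to the front. *)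
Definition block_swap (u w v : word) :
    'I_(size ((u ++ w) ++ v)) -> 'I_(size ((w ++ u) ++ v)) :=
  cat_map (@swap_ord u w) id.

Lemma block_swapK (u w v : word) : cancel (@block_swap u w v) (@block_swap w u v).
Proof. exact: cat_mapK (@swap_ordK u w) (@id_cancel _). Qed.

Lemma block_swap_letter (u w v : word) i : letter (@block_swap u w v i) = letter i.
Proof.
case: (cat_ordP i) => -[j <-]; rewrite /block_swap ?(cat_map_lcat, cat_map_rcat);
  rewrite ?(letter_lcat, letter_rcat) //.
by case: (cat_ordP j) => -[k <-]; rewrite ?(swap_lcat, swap_rcat) ?(letter_lcat, letter_rcat).
Qed.

Lemma nth_block_swap (T : Type) (d : T) (u w v : word) (gu gw gv : seq T) i :
  size gu = size u -> size gw = size w ->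
  nth d ((gw ++ gu) ++ gv) (@block_swap u w v i) = nth d ((gu ++ gw) ++ gv) i.
Proof.
move=> su sw; rewrite /block_swap; case: (cat_ordP i) => -[j <-]; last first.
  rewrite cat_map_rcat /= !nth_cat !size_cat su sw addnC.
  by rewrite !ltnNge leq_addl leq_addr /= !addnK addKn.
rewrite cat_map_lcat; case: (cat_ordP j) => -[k <-].
  rewrite swap_lcat /= !nth_cat !size_cat su sw ltn_add2l ltn_ord.
  by rewrite ltn_addr // ltnNge leq_addr addKn.
rewrite swap_rcat /= !nth_cat !size_cat su sw ltn_add2l ltn_ord.
by rewrite ltn_addr // ltnNge leq_addr addKn.
Qed.

Lemma sub_path (M : omanifold R) (A : set M) (oA : open A) (cA : closed A) (h : R -> M) :
  {within `[0, 1], continuous h} -> (forall t, 0 <= t <= 1 -> A (h t)) ->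
  exists g : R -> submanifold oA cA,
    {within `[0, 1], continuous g} /\ forall t, 0 <= t <= 1 -> subval (g t) = h t.
Proof.
move=> ch hA; have Ah t : A (h (clamp t)) by apply: hA; exact: clamp_itv.
pose g t : submanifold oA cA := SigSub (mem_set (Ah t)).
have gE t : 0 <= t <= 1 -> subval (g t) = h t.
  by move=> t01; rewrite -[LHS]/(h (clamp t)) clamp_id.
exists g; split => //; apply/subspace_continuousP => t t01 W /set_type_nbhs[O Ot OW].
have t01' : 0 <= t <= 1 by move: t01; rewrite /= in_itv.
move/subspace_continuousP : ch => /(_ t t01) ch.
have Ot' : nbhs (h t) O by rewrite -(gE t).
have nO : within `[0, 1]%classic (nbhs t) (h @^-1` O) := ch O Ot'.
change (within `[0, 1]%classic (nbhs t) (g @^-1` W)).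
rewrite /within /= in nO *; apply: filterS nO => s Os s01; apply: OW.
change (O (subval (g s))); rewrite gE; first exact: Os.
by move: s01; rewrite in_itv.
Qed.

(** The images of the strands of [a] form a clopen set, its complement being the finite union of the
    remaining images. Surjectivity of [s1] and [s2] puts every outgoing point on a strand of its own
    block. *)
Lemma split_intervals (a b c d : word) (K : cob R (a ++ c) (b ++ d)) s1 s2 :
  (forall j, exists i, s1 i = j) -> (forall j, exists i, s2 i = j) ->
  consists_of_intervals K (@cat_map a b c d s1 s2) ->
  exists (K1 : cob R a b) (K2 : cob R c d),
  [/\ is_tensor K1 K2 K, consists_of_intervals K1 s1 & consists_of_intervals K2 s2].
Proof.
move=> surj1 surj2 [h [hc hi hs h0 h1]].
have z01 : 0 <= (0 : R) <= 1 by rewrite lexx ler01.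
have o01 : 0 <= (1 : R) <= 1 by rewrite lexx ler01.
pose im k := h k @` `[0, 1]%classic.
have imP k t : 0 <= t <= 1 -> im k (h k t) by exists t; rewrite //= in_itv.
have im_cl m (f : 'I_m -> 'I_(size (a ++ c))) : closed (\bigcup_(i in [set: 'I_m]) im (f i)).
  apply: closed_bigcup => [|i _]; first exact: finite_finset.
  apply: compact_closed; first exact: omanifold_hausdorff.
  by apply: continuous_compact; [exact: hc|exact: segment_compact].
pose A := \bigcup_(i in [set: 'I_(size a)]) im (lcat c i).
pose B := \bigcup_(j in [set: 'I_(size c)]) im (rcat a j).
have cA : closed A := im_cl _ _.
have lr i j : lcat c i <> rcat a j.
  move=> /(congr1 val) /= E; have := ltn_ord i.
  by rewrite E ltnNge leq_addr.
have AB : ~` A = B.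
  apply/seteqP; split => [x nA|x [j _ [t t01 <-]] [i _ [u u01]]].
    have [k [t [t01 tx]]] := hs x; case: (cat_ordP k) => -[i iE].
      by case: nA; exists i => //; rewrite iE -tx; apply: imP.
    by exists i => //; rewrite iE -tx; apply: imP.
  rewrite /= !in_itv /= in t01 u01.
  by move=> /(hi _ _ _ _ u01 t01)[/lr].
have oA : open A by rewrite -[A]setCK AB openC; exact: im_cl.
have inA k : A (h k 0) -> exists i, k = lcat c i.
  case: (cat_ordP k) => -[i <-]; first by exists i.
  move=> Ah; have : (~` A) (h (rcat a i) 0) by rewrite AB; exists i => //; apply: imP.
  by case.
have il i : A (ingoing K (lcat c i)) by rewrite -h0; exists i => //; apply: imP.
have ir j : (~` A) (ingoing K (rcat a j)) by rewrite AB -h0; exists j => //; apply: imP.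
have ol j : A (outgoing K (lcat d j)).
  have [i <-] := surj1 j; rewrite -(cat_map_lcat s1 s2) -h1.
  by exists i => //; apply: imP.
have or j : (~` A) (outgoing K (rcat b j)).
  have [i <-] := surj2 j; rewrite -(cat_map_rcat s1 s2) -h1 AB.
  by exists i => //; apply: imP.
exists (left_part oA cA il ir ol or), (right_part oA cA il ir ol or); split.
- exact: split_tensor.
- have /choice[g gP] : forall i, exists g : R -> submanifold oA cA,
      {within `[0, 1], continuous g} /\ forall t, 0 <= t <= 1 -> subval (g t) = h (lcat c i) t.
    by move=> i; apply: sub_path => // t t01; exists i => //; apply: imP.
  have gE i t : 0 <= t <= 1 -> subval (g i t) = h (lcat c i) t by case: (gP i) => _; apply.
  exists g; split.
  + by move=> i; case: (gP i).
  + move=> i j t u t01 u01 /(congr1 (@subval _ _ _ _ _)); rewrite !gE //.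
    by move=> /(hi _ _ _ _ t01 u01)[/lcat_inj].
  + move=> x; have [k [t [t01 tx]]] := hs (subval x); have := subvalP x.
    rewrite -tx => -[i _ [u u01 E]]; rewrite /= in_itv /= in u01.
    exists i, u; split => //; apply: subval_inj; rewrite gE // E; exact: tx.
  + by move=> i; apply: subval_inj; rewrite gE // h0.
  + by move=> i; apply: subval_inj; rewrite gE // h1 cat_map_lcat.
- have /choice[g gP] : forall j, exists g : R -> submanifold (closed_openC cA) (open_closedC oA),
      {within `[0, 1], continuous g} /\ forall t, 0 <= t <= 1 -> subval (g t) = h (rcat a j) t.
    by move=> j; apply: sub_path => // t t01; rewrite AB; exists j => //; apply: imP.
  have gE i t : 0 <= t <= 1 -> subval (g i t) = h (rcat a i) t by case: (gP i) => _; apply.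
  exists g; split.
  + by move=> i; case: (gP i).
  + move=> i j t u t01 u01 /(congr1 (@subval _ _ _ _ _)); rewrite !gE //.
    by move=> /(hi _ _ _ _ t01 u01)[/rcat_inj].
  + move=> x; have [k [t [t01 tx]]] := hs (subval x).
    have : B (subval x) by rewrite -AB; exact: subvalP x.
    rewrite -tx => -[i _ [u u01 E]]; rewrite /= in_itv /= in u01.
    exists i, u; split => //; apply: subval_inj; rewrite gE // E; exact: tx.
  + by move=> i; apply: subval_inj; rewrite gE // h0.
  + by move=> i; apply: subval_inj; rewrite gE // h1 cat_map_rcat.
Qed.

(** On a given edge a boundary point is determined by its sign, and there are two signs. *)
Lemma edge_two_ends a b (K : cob R a b) n (h : 'I_n -> R -> K) k x y z :
  edge_decomposition h -> trace (h k) (cob_end K x) -> trace (h k) (cob_end K y) ->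
  trace (h k) (cob_end K z) -> x <> y -> z = x \/ z = y.
Proof.
move=> dh kx ky kz xy.
have E w : trace (h k) (cob_end K w) -> cob_end K w = h k (endpoint R (point_sign w)).
  move=> kw; have [l _ lE] := cob_end_edge dh w; rewrite lE.
  suff -> : l = k by [].
  apply: (dec_disjoint dh (x := cob_end K w)) => //; rewrite lE.
  by exists (endpoint R (point_sign w)) => //; exact: endpoint_itv.
have I w w' : trace (h k) (cob_end K w) -> trace (h k) (cob_end K w') ->
    point_sign w = point_sign w' -> w = w'.
  by move=> /E wE /E w'E ww'; apply: (@cob_end_inj _ _ _ K); rewrite wE w'E ww'.
have [xz|xz] := eqVneq (point_sign z) (point_sign x); first by left; apply: I.
right; have sxy : point_sign x <> point_sign y.
  by move=> sxy; case: xy; exact: (I x y kx ky sxy).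
apply: (I z y kz ky); move: sxy.
by case: (point_sign x) (point_sign y) (point_sign z) xz => [] [] [].
Qed.

End BlockSwaps.

(** * The Brauer formula, proved by peeling off edges *)

Section BrauerValues.
Variable R : realType.
Implicit Type M : omanifold R.

Section Evaluation.
Variables (K : fieldType) (p : nat).
Hypothesis p_gt0 : (0 < p)%N.
Variable G : forall a b : word, cob R a b -> 'M[K]_(p ^ size b, p ^ size a).

Hypothesis G_equiv : forall (a b : word) (M N : cob R a b), cob_equiv M N -> G M = G N.
Hypothesis G_id : forall (a : word) (M : cob R a a), is_identity M -> G M = 1%:M.
Hypothesis G_comp : forall (a b c : word) (M : cob R a b) (N : cob R b c) (L : cob R a c),
  is_composite M N L -> G L = G N *m G M.
Hypothesis G_tens : forall (a b c d : word) (M : cob R a b) (N : cob R c d)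
    (L : cob R (a ++ c) (b ++ d)), is_tensor M N L ->
  forall i1 i2 j1 j2, (i2 < p ^ size d)%N -> (j2 < p ^ size c)%N ->
  ent (G L) (i1 * p ^ size d + i2) (j1 * p ^ size c + j2) = ent (G M) i1 j1 * ent (G N) i2 j2.
Hypothesis G_sym : forall (a b : word) (M : cob R (a ++ b) (b ++ a)), is_symmetry M ->
  forall i1 i2 j1 j2, (i1 < p ^ size a)%N -> (i2 < p ^ size b)%N ->
    (j1 < p ^ size a)%N -> (j2 < p ^ size b)%N ->
  ent (G M) (i2 * p ^ size a + i1) (j1 * p ^ size b + j2) = ((i1 == j1) && (i2 == j2))%:R.
Hypothesis G_cap : forall x y, (x < p)%N -> (y < p)%N ->
  ent (G (cap_cob R)) (code p [::]) (code p [:: x; y]) = (x == y)%:R.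
Hypothesis G_cup : forall x y, (x < p)%N -> (y < p)%N ->
  ent (G (cup_cob R)) (code p [:: x; y]) (code p [::]) = (x == y)%:R.

Definition label (a b : word) (f g : seq nat) (x : 'I_(size a) + 'I_(size b)) : nat :=
  match x with inl i => nth 0%N g i | inr j => nth 0%N f j end.

Definition compatible a b (M : cob R a b) (f g : seq nat) : Prop :=
  forall x y, same_component M x y -> label f g x = label f g y.

(** The entry formula of B, asserted for the value of [G] at [M], with rows and columns indexed by
    digit strings. *)
Definition brauerian a b (M : cob R a b) : Prop :=
  forall f g, digits p (size b) f -> digits p (size a) g ->
  ent (G M) (code p f) (code p g) = p%:R ^+ num_circles M * `[< compatible M f g >]%:R.

Lemma perm_ent (u w v : word) (P : cob R ((u ++ w) ++ v) ((w ++ u) ++ v)) :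
  consists_of_intervals P (@block_swap u w v) ->
  forall fu fw fv gu gw gv, digits p (size u) fu -> digits p (size w) fw ->
  digits p (size v) fv -> digits p (size u) gu -> digits p (size w) gw -> digits p (size v) gv ->
  ent (G P) (code p ((fw ++ fu) ++ fv)) (code p ((gu ++ gw) ++ gv)) =
  [&& fu == gu, fw == gw & fv == gv]%:R.
Proof.
move=> Ps fu fw fv gu gw gv dfu dfw dfv dgu dgw dgv.
have [||P1 [P2 [T S I]]] := split_intervals _ _ Ps.
- by move=> j; exists (swap_ord j); rewrite swap_ordK.
- by move=> j; exists j.
rewrite !code_cat (digits_size dfv) (digits_size dgv) (G_tens T) ?code_lt //.
rewrite (digits_size dfu) (digits_size dgw).
have -> := G_sym S (code_lt p_gt0 dfu) (code_lt p_gt0 dfw) (code_lt p_gt0 dgu) (code_lt p_gt0 dgw).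
rewrite (G_id I) ent_1 ?code_lt // -natrM mulnb -andbA.
by rewrite (code_eq p_gt0 dfu dgu) (code_eq p_gt0 dfw dgw) (code_eq p_gt0 dfv dgv).
Qed.

(** The same entry as a delta in the row code and as a delta in the column code: the two forms in
    which [sum_delta] evaluates composition with a permutation on either side. *)
Lemma perm_ent_eq (u w v : word) (P : cob R ((u ++ w) ++ v) ((w ++ u) ++ v)) :
  consists_of_intervals P (@block_swap u w v) ->
  forall fu fw fv gu gw gv, digits p (size u) fu -> digits p (size w) fw ->
  digits p (size v) fv -> digits p (size u) gu -> digits p (size w) gw -> digits p (size v) gv ->
  ent (G P) (code p ((fw ++ fu) ++ fv)) (code p ((gu ++ gw) ++ gv)) =
  (code p ((fw ++ fu) ++ fv) == code p ((gw ++ gu) ++ gv))%:R /\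
  ent (G P) (code p ((fw ++ fu) ++ fv)) (code p ((gu ++ gw) ++ gv)) =
  (code p ((gu ++ gw) ++ gv) == code p ((fu ++ fw) ++ fv))%:R.
Proof.
move=> Ps fu fw fv gu gw gv dfu dfw dfv dgu dgw dgv; rewrite (perm_ent Ps) //.
have C n1 n2 n3 s1 s2 s3 : digits p n1 s1 -> digits p n2 s2 -> digits p n3 s3 ->
    digits p (n1 + n2 + n3) ((s1 ++ s2) ++ s3).
  by move=> d1 d2 d3; rewrite !digits_cat ?size_cat ?(digits_size d1) ?(digits_size d2) // d1 d2.
have cat_eq (s1 s2 s3 t1 t2 t3 : seq nat) : size s1 = size t1 -> size s2 = size t2 ->
    ((s1 ++ s2) ++ s3 == (t1 ++ t2) ++ t3) = [&& s1 == t1, s2 == t2 & s3 == t3].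
  by move=> e1 e2; rewrite eqseq_cat ?size_cat ?e1 ?e2 // eqseq_cat // -andbA.
have eu := etrans (digits_size dfu) (esym (digits_size dgu)).
have ew := etrans (digits_size dfw) (esym (digits_size dgw)).
rewrite (code_eq p_gt0 (C _ _ _ _ _ _ dfw dfu dfv) (C _ _ _ _ _ _ dgw dgu dgv)).
rewrite (code_eq p_gt0 (C _ _ _ _ _ _ dgu dgw dgv) (C _ _ _ _ _ _ dfu dfw dfv)).
rewrite !cat_eq //; split; congr (_%:R); congr nat_of_bool; first by rewrite andbCA.
by rewrite [gu == fu]eq_sym [gw == fw]eq_sym [gv == fv]eq_sym.
Qed.

Lemma digits3 (u w v : word) f : digits p (size ((u ++ w) ++ v)) f ->
  exists fu fw fv, [/\ f = (fu ++ fw) ++ fv, digits p (size u) fu,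
    digits p (size w) fw & digits p (size v) fv].
Proof.
rewrite !size_cat => /digits_split[fuw [fv [-> /digits_split[fu [fw [-> ? ?]]] ?]]].
by exists fu, fw, fv.
Qed.

Lemma digits3_cat (u w v : word) fu fw fv : digits p (size u) fu ->
  digits p (size w) fw -> digits p (size v) fv ->
  digits p (size ((u ++ w) ++ v)) ((fu ++ fw) ++ fv).
Proof.
move=> d1 d2 d3; rewrite !size_cat.
by rewrite !digits_cat ?size_cat ?(digits_size d1) ?(digits_size d2) // d1 d2.
Qed.

Section InMove.
Variables (u w v b : word) (M : cob R ((u ++ w) ++ v) b).

Definition in_swapped : cob R ((w ++ u) ++ v) b :=
  relabel M (@block_swapK w u v) (@block_swapK u w v) (@id_cancel _) (@id_cancel _)
    (@block_swap_letter w u v) (@id_letter b).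

Lemma in_swapped_end x : cob_end in_swapped x =
  cob_end M (relabel_map (@block_swap w u v) id x).
Proof. by case: x. Qed.

(** Composition with the permutation rearranges the column string, and labels are rearranged in the
    same way. The underlying manifold, hence its components and circles, is unchanged. *)
Lemma in_swapped_brauerian n (h : 'I_n -> R -> M) : edge_decomposition h ->
  (forall k, h k 0 <> h k 1) -> brauerian in_swapped -> brauerian M.
Proof.
move=> dh ha B f g df dg.
have comp := in_move dh ha (@block_swapK u w v) (@block_swapK w u v)
  (@block_swap_letter u w v) (@block_swap_letter w u v).
rewrite (G_comp comp) ent_mul.
have [gu [gw [gv [gE dgu dgw dgv]]]] := digits3 dg.
have dg' := digits3_cat dgw dgu dgv.
transitivity (ent (G in_swapped) (code p f) (code p ((gw ++ gu) ++ gv))).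
  rewrite -(sum_delta (fun k => ent (G in_swapped) (code p f) k) (code_lt p_gt0 dg')).
  apply: eq_bigr => k _; have [f' df' <-] := code_surj p_gt0 (ltn_ord k).
  have [fw [fu [fv [-> dfw dfu dfv]]]] := digits3 df'; congr (_ * _); rewrite gE.
  by have [->] := perm_ent_eq (perm_cob_intervals R (@block_swapK u w v) (@block_swapK w u v)
    (@block_swap_letter u w v)) dfu dfw dfv dgu dgw dgv.
rewrite (B _ _ df dg'); congr (_ * _); congr (_%:R); congr nat_of_bool.
apply: asbool_equiv_eq.
have lab x : label f ((gw ++ gu) ++ gv) x = label f g (relabel_map (@block_swap w u v) id x).
  case: x => [i|j] //=; rewrite gE.
  by rewrite (nth_block_swap _ _ _ (digits_size dgw) (digits_size dgu)).
split => C x y xy.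
  pose r (z : 'I_(size ((u ++ w) ++ v)) + 'I_(size b)) := relabel_map (@block_swap u w v) id z.
  have rK z : relabel_map (@block_swap w u v) id (r z) = z.
    by case: z => [i|j] //=; rewrite block_swapK.
  rewrite -(rK x) -(rK y) -!lab; apply: C.
  by move: xy; rewrite /same_component -!/(cob_end _ _) !in_swapped_end !rK.
rewrite !lab; apply: C.
by move: xy; rewrite /same_component -!/(cob_end _ _) !in_swapped_end.
Qed.

End InMove.

Section OutMove.
Variables (u w v a : word) (M : cob R a ((u ++ w) ++ v)).

Definition out_swapped : cob R a ((w ++ u) ++ v) :=
  relabel M (@id_cancel _) (@id_cancel _) (@block_swapK w u v) (@block_swapK u w v)
    (@id_letter a) (@block_swap_letter w u v).

Lemma out_swapped_end x : cob_end out_swapped x =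
  cob_end M (relabel_map id (@block_swap w u v) x).
Proof. by case: x. Qed.

Lemma out_swapped_brauerian n (h : 'I_n -> R -> M) : edge_decomposition h ->
  (forall k, h k 0 <> h k 1) -> brauerian out_swapped -> brauerian M.
Proof.
move=> dh ha B f g df dg.
have comp := out_move dh ha (@block_swapK u w v) (@block_swapK w u v)
  (@block_swap_letter u w v) (@block_swap_letter w u v).
rewrite (G_comp comp) ent_mul.
have [fu [fw [fv [fE dfu dfw dfv]]]] := digits3 df.
have df' := digits3_cat dfw dfu dfv.
transitivity (ent (G out_swapped) (code p ((fw ++ fu) ++ fv)) (code p g)).
  rewrite -(sum_delta (fun k => ent (G out_swapped) k (code p g)) (code_lt p_gt0 df')).
  apply: eq_bigr => k _; have [g' dg' <-] := code_surj p_gt0 (ltn_ord k).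
  have [gw [gu [gv [-> dgw dgu dgv]]]] := digits3 dg'; rewrite mulrC; congr (_ * _); rewrite fE.
  by have [_ ->] := perm_ent_eq (perm_cob_intervals R (@block_swapK w u v) (@block_swapK u w v)
    (@block_swap_letter w u v)) dfw dfu dfv dgw dgu dgv.
rewrite (B _ _ df' dg); congr (_ * _); congr (_%:R); congr nat_of_bool.
apply: asbool_equiv_eq.
have lab x : label ((fw ++ fu) ++ fv) g x = label f g (relabel_map id (@block_swap w u v) x).
  case: x => [i|j] //=; rewrite fE.
  by rewrite (nth_block_swap _ _ _ (digits_size dfw) (digits_size dfu)).
split => C x y xy.
  pose r (z : 'I_(size a) + 'I_(size ((u ++ w) ++ v))) := relabel_map id (@block_swap u w v) z.
  have rK z : relabel_map id (@block_swap w u v) (r z) = z.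
    by case: z => [i|j] //=; rewrite block_swapK.
  rewrite -(rK x) -(rK y) -!lab; apply: C.
  by move: xy; rewrite /same_component -!/(cob_end _ _) !out_swapped_end !rK.
rewrite !lab; apply: C.
by move: xy; rewrite /same_component -!/(cob_end _ _) !out_swapped_end.
Qed.

End OutMove.

Lemma word_split (a : word) (i : 'I_(size a)) : exists u x v,
  [/\ a = (u ++ [:: x]) ++ v, i = size u :> nat & letter i = x].
Proof.
exists (take i a), (letter i), (drop i.+1 a); split => //.
  rewrite -catA /= /letter (tnth_nth false) /= -drop_nth //.
  by rewrite cat_take_drop.
by rewrite size_take ltn_ord.
Qed.

(** The second half matters when two letters are fetched one after the other: the letter at the
    front moves to position 1. *)
Lemma block_swap_front (u v : word) x (i : 'I_(size ((u ++ [:: x]) ++ v))) :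
  (i = size u :> nat -> @block_swap u [:: x] v i = 0%N :> nat) /\
  ((i < size u)%N -> @block_swap u [:: x] v i = i.+1 :> nat).
Proof.
rewrite /block_swap; case: (cat_ordP i) => -[j <-]; last first.
  rewrite cat_map_rcat /=; split => E; first by move: E; rewrite size_cat /=; lia.
  by move: E; rewrite size_cat /=; lia.
rewrite cat_map_lcat; case: (cat_ordP j) => -[k <-].
  rewrite swap_lcat /=; split => E; last by lia.
  by have := ltn_ord k; rewrite E ltnn.
rewrite swap_rcat /= [k]ord1 /=; split => // E; lia.
Qed.

(** [m] follows the ingoing points through the move. The new word and cobordism are existential, so
    that the word literally begins with a letter and further moves can be chained. *)
Lemma in_front a b (M : cob R a b) n (h : 'I_n -> R -> M) (i : 'I_(size a)) :
  edge_decomposition h -> (forall k, h k 0 <> h k 1) ->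
  exists x (a' : word) (N : cob R (x :: a') b) (g : 'I_n -> R -> N)
    (m : 'I_(size a) -> 'I_(size (x :: a'))),
  [/\ edge_decomposition g, (forall k, g k 0 <> g k 1), brauerian N -> brauerian M,
    [/\ m i = 0%N :> nat, (forall j : 'I_(size a), (j < i)%N -> m j = j.+1 :> nat)
      & forall j, letter (m j) = letter j]
  & (forall j k, trace (g k) (cob_end N (inl (m j))) <-> trace (h k) (cob_end M (inl j))) /\
    (forall j k, trace (g k) (cob_end N (inr j)) <-> trace (h k) (cob_end M (inr j)))].
Proof.
move=> dh ha; have [u [x [v [aE iE _]]]] := word_split i; subst a.
exists x, (u ++ v), (in_swapped M), h, (@block_swap u [:: x] v); split => //.
- exact: in_swapped_brauerian dh ha.
- split; [exact: (block_swap_front i).1| |exact: block_swap_letter].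
  by move=> j ji; apply: (block_swap_front j).2; rewrite -iE.
split => j k; last by rewrite (in_swapped_end M (inr j)).
by rewrite (in_swapped_end M (inl (block_swap j))) /= block_swapK.
Qed.

Lemma out_front a b (M : cob R a b) n (h : 'I_n -> R -> M) (i : 'I_(size b)) :
  edge_decomposition h -> (forall k, h k 0 <> h k 1) ->
  exists x (b' : word) (N : cob R a (x :: b')) (g : 'I_n -> R -> N)
    (m : 'I_(size b) -> 'I_(size (x :: b'))),
  [/\ edge_decomposition g, (forall k, g k 0 <> g k 1), brauerian N -> brauerian M,
    [/\ m i = 0%N :> nat, (forall j : 'I_(size b), (j < i)%N -> m j = j.+1 :> nat)
      & forall j, letter (m j) = letter j]
  & (forall j k, trace (g k) (cob_end N (inr (m j))) <-> trace (h k) (cob_end M (inr j))) /\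
    (forall j k, trace (g k) (cob_end N (inl j)) <-> trace (h k) (cob_end M (inl j)))].
Proof.
move=> dh ha; have [u [x [v [bE iE _]]]] := word_split i; subst b.
exists x, (u ++ v), (out_swapped M), h, (@block_swap u [:: x] v); split => //.
- exact: out_swapped_brauerian dh ha.
- split; [exact: (block_swap_front i).1| |exact: block_swap_letter].
  by move=> j ji; apply: (block_swap_front j).2; rewrite -iE.
split => j k; last by rewrite (out_swapped_end M (inl j)).
by rewrite (out_swapped_end M (inr (block_swap j))) /= block_swapK.
Qed.

Lemma num_circles_lift a b (M : cob R a b) n (h : 'I_n.+1 -> R -> M) (k : 'I_n.+1) :
  edge_decomposition h ->
  num_circles M = (`[< h k 0%R = h k 1%R >] + #|[pred j : 'I_n | `[< h (lift k j) 0%R = h (lift k j) 1%R >]]|)%N.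
Proof.
move=> dh; rewrite (num_circlesE dh) -!sum1_card !big_mkcond (bigD1_ord k) //=.
by rewrite [in RHS]big_mkcond.
Qed.

Lemma label_left (a b c d : word) f1 f2 g1 g2 (x : 'I_(size a) + 'I_(size b)) :
  size f1 = size b -> size g1 = size a ->
  label (f1 ++ f2) (g1 ++ g2) (cat_end_left c d x) = label f1 g1 x.
Proof. by move=> sf sg; case: x => [i|j] /=; rewrite nth_cat ?sf ?sg ltn_ord. Qed.

Lemma label_right (a b c d : word) f1 f2 g1 g2 (x : 'I_(size c) + 'I_(size d)) :
  size f1 = size b -> size g1 = size a ->
  label (f1 ++ f2) (g1 ++ g2) (cat_end_right a b x) = label f2 g2 x.
Proof.
by move=> sf sg; case: x => [i|j] /=; rewrite nth_cat ?sf ?sg ltnNge leq_addr addKn.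
Qed.

Lemma cat_endP (a b c d : word) (x : 'I_(size (a ++ c)) + 'I_(size (b ++ d))) :
  (exists y, cat_end_left c d y = x) \/ (exists y, cat_end_right a b y = x).
Proof.
case: x => i; case: (cat_ordP i) => -[j <-].
- by left; exists (inl j).
- by right; exists (inl j).
- by left; exists (inr j).
- by right; exists (inr j).
Qed.

(** Both sides of the formula are multiplicative: circle numbers add, and compatibility splits
    because no component joins the two blocks. *)
Lemma peel (a b c d : word) (M : cob R (a ++ c) (b ++ d)) n (h : 'I_n.+1 -> R -> M) (k : 'I_n.+1) :
  edge_decomposition h ->
  (forall x, trace (h k) (cob_end M (cat_end_left c d x))) ->
  (forall x, ~ trace (h k) (cob_end M (cat_end_right a b x))) ->
  (forall (M1 : cob R a b) (h1 : 'I_1 -> R -> M1), edge_decomposition h1 ->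
    (h1 ord0 0 = h1 ord0 1 <-> h k 0 = h k 1) -> brauerian M1) ->
  (forall (M2 : cob R c d) (h2 : 'I_n -> R -> M2), edge_decomposition h2 ->
    (forall j, h2 j 0 = h2 j 1 <-> h (lift k j) 0 = h (lift k j) 1) -> brauerian M2) ->
  brauerian M.
Proof.
move=> dh hl hr B1 B2 f g df dg.
have [M1 [M2 [h1 [h2 [T dh1 dh2 l1 [l2 t2]]]]]] := split_edge dh hl hr.
have /digits_split[f1 [f2 [fE df1 df2]]] : digits p (size b + size d) f by rewrite -size_cat.
have /digits_split[g1 [g2 [gE dg1 dg2]]] : digits p (size a + size c) g by rewrite -size_cat.
rewrite fE gE !code_cat (digits_size df2) (digits_size dg2) (G_tens T) ?code_lt //.
rewrite (B1 _ _ dh1 l1 _ _ df1 dg1) (B2 _ _ dh2 l2 _ _ df2 dg2) mulrACA -exprD -natrM mulnb.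
have -> : (num_circles M1 + num_circles M2)%N = num_circles M.
  rewrite (num_circles_lift k dh) (num_circles_lift ord0 dh1) (num_circlesE dh2).
  congr (_ + _)%N; last first.
    by apply: eq_card => j; rewrite !inE; apply: asbool_equiv_eq; exact: l2.
  rewrite eq_card0 ?addn0; last by case.
  by congr nat_of_bool; apply: asbool_equiv_eq.
congr (_ * _); congr (_%:R); congr nat_of_bool; rewrite -asbool_and; apply: asbool_equiv_eq.
have ll x := label_left c d f2 g2 x (digits_size df1) (digits_size dg1).
have lr x := @label_right a b c d f1 f2 g1 g2 x (digits_size df1) (digits_size dg1).
have same1 x y : same_component M1 x y.
  apply/(same_componentP dh1); exists ord0.
  have [i xi] := dec_cover dh1 (cob_end M1 x); have [j yj] := dec_cover dh1 (cob_end M1 y).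
  by rewrite !ord1 in xi yj.
split => [[C1 C2] x y /(same_componentP dh)[l [lx ly]]|C]; last first.
  split => x y xy.
    by rewrite -!ll; apply: C; apply/(same_componentP dh); exists k.
  rewrite -!lr; apply: C; apply/(same_componentP dh).
  by have [j [/t2 jx /t2 jy]] := (same_componentP dh2 x y).1 xy; exists (lift k j).
have lk z : trace (h l) (cob_end M (cat_end_right a b z)) -> exists j, l = lift k j.
  by case: (unliftP k l) => [j ->|->]; [exists j|move/hr].
have kl z : trace (h l) (cob_end M (cat_end_left c d z)) -> l = k.
  by move=> lz; apply: (dec_disjoint dh lz).
case: (cat_endP x) lx => -[x' <-] lx; case: (cat_endP y) ly => -[y' <-] ly.
- by rewrite !ll; apply: C1.
- by have [j lj] := lk _ ly; have /eqP := kl _ lx; rewrite lj eq_sym (negbTE (neq_lift _ _)).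
- by have [j lj] := lk _ lx; have /eqP := kl _ ly; rewrite lj eq_sym (negbTE (neq_lift _ _)).
- have [j lj] := lk _ lx; rewrite !lr; apply: C2; apply/(same_componentP dh2).
  by exists j; split; apply/t2; rewrite -lj.
Qed.

Lemma edge_end_sign a b (M : cob R a b) n (h : 'I_n -> R -> M) k x y :
  edge_decomposition h -> trace (h k) (cob_end M x) -> trace (h k) (cob_end M y) ->
  point_sign x = point_sign y -> x = y.
Proof.
move=> dh kx ky; have [l _ lE] := cob_end_edge dh x; have [l' _ l'E] := cob_end_edge dh y.
have lk : l = k.
  by apply: (dec_disjoint dh (x := cob_end M x)) => //; rewrite lE;
    exists (endpoint R (point_sign x)) => //; exact: endpoint_itv.
have l'k : l' = k.
  by apply: (dec_disjoint dh (x := cob_end M y)) => //; rewrite l'E;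
    exists (endpoint R (point_sign y)) => //; exact: endpoint_itv.
by move=> sxy; apply: (@cob_end_inj _ _ _ M); rewrite lE l'E lk l'k sxy.
Qed.

Lemma num_circles_arcs a b (M : cob R a b) n (h : 'I_n -> R -> M) :
  edge_decomposition h -> (forall k, h k 0 <> h k 1) -> num_circles M = 0%N.
Proof.
move=> dh ha; rewrite (num_circlesE dh) eq_card0 // => k; rewrite !inE.
by apply/asboolP/ha.
Qed.

Lemma compatible1 a b (M : cob R a b) (h : 'I_1 -> R -> M) f g :
  edge_decomposition h -> compatible M f g <-> forall x y : 'I_(size a) + 'I_(size b), label f g x = label f g y.
Proof.
move=> dh; split => C x y; last by move=> _; apply: C.
apply: C; apply/(same_componentP dh); exists ord0.
have [i xi] := dec_cover dh (cob_end M x); have [j yj] := dec_cover dh (cob_end M y).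
by rewrite !ord1 in xi yj.
Qed.

Lemma brauerian_arc a b (M : cob R a b) (h : 'I_1 -> R -> M) :
  edge_decomposition h -> h ord0 0 <> h ord0 1 ->
  (forall f g, digits p (size b) f -> digits p (size a) g -> exists2 B : bool,
    ent (G M) (code p f) (code p g) = B%:R &
    (B <-> forall x y : 'I_(size a) + 'I_(size b), label f g x = label f g y)) ->
  brauerian M.
Proof.
move=> dh hn E f g df dg; have ha k : h k 0 <> h k 1 by rewrite ord1.
rewrite (num_circles_arcs dh ha) expr0 mul1r.
have [B -> BE] := E f g df dg; congr (_%:R); congr nat_of_bool.
by apply/idP/asboolP; rewrite (compatible1 _ _ dh) => /BE.
Qed.

Lemma digits2 g : digits p 2 g -> exists x y, [/\ g = [:: x; y], (x < p)%N & (y < p)%N].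
Proof.
case: g => [|x [|y [|z g]]] //; rewrite /digits /= andbT => /andP[xp yp].
by exists x, y.
Qed.

Lemma brauerian_strand x (M : cob R [:: x] [:: x]) (h : 'I_1 -> R -> M) :
  edge_decomposition h -> h ord0 0 <> h ord0 1 -> brauerian M.
Proof.
move=> dh hn; apply: (brauerian_arc dh hn) => f g df dg.
exists (f == g).
  by rewrite (G_id (arcs1_identity dh hn)) ent_1 ?code_lt // (code_eq p_gt0 df dg).
have [y fE yp] := digits1 df; have [z gE zp] := digits1 dg; rewrite fE gE.
split => [/eqP[->] [i|i] [j|j]|/(_ (inl ord0) (inr ord0)) /= -> //].
all: by rewrite /= ?[i]ord1 ?[j]ord1.
Qed.

Lemma brauerian_cap (M : cob R [:: true; false] [::]) (h : 'I_1 -> R -> M) :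
  edge_decomposition h -> h ord0 0 <> h ord0 1 -> brauerian M.
Proof.
move=> dh hn; apply: (brauerian_arc dh hn) => f g df dg.
have ME : G M = G (cap_cob R).
  apply: G_equiv; exact: (@arcs1_equiv R _ _ M (cap_cob R) h (@interval_path R 1) dh
    (interval_path_decomposition R 1) hn (@interval_path_arc R 1 ord0)).
have f0 : f = [::] by apply/size0nil/(digits_size df).
have [x [y [gE xp yp]]] := digits2 dg; rewrite f0 gE.
exists (x == y); first by rewrite ME G_cap.
split => [/eqP <- [[[|[|//]] i]|[]//] [[[|[|//]] j]|[]//] //|].
by move=> /(_ (inl ord0) (inl ord_max)) /= ->.
Qed.

Lemma brauerian_cup (M : cob R [::] [:: false; true]) (h : 'I_1 -> R -> M) :
  edge_decomposition h -> h ord0 0 <> h ord0 1 -> brauerian M.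
Proof.
move=> dh hn; apply: (brauerian_arc dh hn) => f g df dg.
have ME : G M = G (cup_cob R).
  apply: G_equiv; exact: (@arcs1_equiv R _ _ M (cup_cob R) h (@interval_path R 1) dh
    (interval_path_decomposition R 1) hn (@interval_path_arc R 1 ord0)).
have g0 : g = [::] by apply/size0nil/(digits_size dg).
have [x [y [fE xp yp]]] := digits2 df; rewrite g0 fE.
exists (x == y); first by rewrite ME G_cup.
split => [/eqP <- [[]//|[[|[|//]] i]] [[]//|[[|[|//]] j]] //|].
by move=> /(_ (inr ord0) (inr ord_max)) /= ->.
Qed.

(** Every boundary point lies on an edge, so without edges both words are empty, and [M] is the
    identity of the empty word. *)
Lemma brauerian_empty a b (M : cob R a b) (h : 'I_0 -> R -> M) :
  edge_decomposition h -> brauerian M.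
Proof.
move=> dh; have no (k : 'I_0) : False by case: k.
case: a M h dh => [|x a] M h dh; last by have [k] := cob_end_edge dh (inl ord0); case: (no k).
case: b M h dh => [|x b] M h dh; last by have [k] := cob_end_edge dh (inr ord0); case: (no k).
have I : is_identity M.
  exists (fun k _ => False_rect _ (no k)); split.
  1, 2, 4, 5: by move=> k; case: (no k).
  by move=> x; have [k _] := dec_cover dh x; case: (no k).
move=> f g df dg; rewrite (G_id I) ent_1 ?code_lt // (code_eq p_gt0 df dg).
rewrite (num_circles_arcs dh) ?expr0 ?mul1r; last by move=> k; case: (no k).
rewrite (size0nil (digits_size df)) (size0nil (digits_size dg)) eqxx.
by congr (_%:R); congr nat_of_bool; apply/esym/asboolP; case.
Qed.

Section Induction.
Variable n : nat.
Hypothesis IH : forall (a b : word) (M : cob R a b) (h : 'I_n -> R -> M),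
  edge_decomposition h -> (forall k, h k 0 <> h k 1) -> brauerian M.

Lemma peel_arc (a b c d : word) (M : cob R (a ++ c) (b ++ d)) (h : 'I_n.+1 -> R -> M) (k : 'I_n.+1) :
  edge_decomposition h -> (forall k, h k 0 <> h k 1) ->
  (forall x, trace (h k) (cob_end M (cat_end_left c d x))) ->
  (forall x, ~ trace (h k) (cob_end M (cat_end_right a b x))) ->
  (forall (M1 : cob R a b) (h1 : 'I_1 -> R -> M1), edge_decomposition h1 ->
    h1 ord0 0 <> h1 ord0 1 -> brauerian M1) ->
  brauerian M.
Proof.
move=> dh ha hl hr B1; apply: (peel dh hl hr).
  move=> M1 h1 dh1 l1; apply: (B1 _ _ dh1) => /l1; exact: ha.
by move=> M2 h2 dh2 l2; apply: (IH dh2) => j /l2; exact: ha.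
Qed.

Lemma strand_peel x y (a b : word) (M : cob R (x :: a) (y :: b)) (h : 'I_n.+1 -> R -> M) (k : 'I_n.+1) :
  edge_decomposition h -> (forall k, h k 0 <> h k 1) ->
  trace (h k) (cob_end M (inl ord0)) -> trace (h k) (cob_end M (inr ord0)) -> brauerian M.
Proof.
move=> dh ha k0 k1.
(* The two ends of an arc have opposite boundary signs, and the sign at an outgoing point is
   opposite to its letter. *)
have xy : x = y.
  have : letter (ord0 : 'I_(size (x :: a))) <> ~~ letter (ord0 : 'I_(size (y :: b))).
    by move/(@edge_end_sign _ _ M _ h k (inl ord0) (inr ord0) dh k0 k1).
  by rewrite /= /letter !(tnth_nth false) /=; case: (x); case: (y).
subst y; apply: (@peel_arc [:: x] [:: x] a b M h k dh ha).
- case=> i.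
    change (trace (h k) (cob_end M (inl (@lcat [:: x] a i)))).
    by have -> : @lcat [:: x] a i = (ord0 : 'I_(size (x :: a))) by apply: val_inj; rewrite [i]ord1.
  change (trace (h k) (cob_end M (inr (@lcat [:: x] b i)))).
  by have -> : @lcat [:: x] b i = (ord0 : 'I_(size (x :: b))) by apply: val_inj; rewrite [i]ord1.
- move=> z kz; have [] := edge_two_ends dh k0 k1 kz; first by [].
    by case: z {kz} => i //= [] /(congr1 val).
  by case: z {kz} => i //= [] /(congr1 val).
- by move=> M1 h1; exact: brauerian_strand.
Qed.

Lemma cap_peel (a b : word) (M : cob R [:: true, false & a] b) (h : 'I_n.+1 -> R -> M) (k : 'I_n.+1)
    (i0 i1 : 'I_(size [:: true, false & a])) :
  edge_decomposition h -> (forall k, h k 0 <> h k 1) -> i0 = 0%N :> nat -> i1 = 1%N :> nat ->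
  trace (h k) (cob_end M (inl i0)) -> trace (h k) (cob_end M (inl i1)) -> brauerian M.
Proof.
move=> dh ha e0 e1 k0 k1.
apply: (@peel_arc [:: true; false] [::] a b M h k dh ha).
- case=> [i|[]//]; change (trace (h k) (cob_end M (inl (@lcat [:: true; false] a i)))).
  have [->|->] : @lcat [:: true; false] a i = i0 \/ @lcat [:: true; false] a i = i1 => //.
  by case: i => [[|[|//]] i]; [left|right]; apply: val_inj; rewrite /= ?e0 ?e1.
- move=> z kz; have [] := edge_two_ends dh k0 k1 kz.
  + by case=> /(congr1 val); rewrite /= e0 e1.
  + by case: z {kz} => i //= [] /(congr1 val) /=; rewrite e0.
  + by case: z {kz} => i //= [] /(congr1 val) /=; rewrite e1.
- by move=> M1 h1; exact: brauerian_cap.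
Qed.

Lemma cup_peel (a b : word) (M : cob R a [:: false, true & b]) (h : 'I_n.+1 -> R -> M) (k : 'I_n.+1)
    (i0 i1 : 'I_(size [:: false, true & b])) :
  edge_decomposition h -> (forall k, h k 0 <> h k 1) -> i0 = 0%N :> nat -> i1 = 1%N :> nat ->
  trace (h k) (cob_end M (inr i0)) -> trace (h k) (cob_end M (inr i1)) -> brauerian M.
Proof.
move=> dh ha e0 e1 k0 k1.
apply: (@peel_arc [::] [:: false; true] a b M h k dh ha).
- case=> [[]//|i]; change (trace (h k) (cob_end M (inr (@lcat [:: false; true] b i)))).
  have [->|->] : @lcat [:: false; true] b i = i0 \/ @lcat [:: false; true] b i = i1 => //.
  by case: i => [[|[|//]] i]; [left|right]; apply: val_inj; rewrite /= ?e0 ?e1.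
- move=> z kz; have [] := edge_two_ends dh k0 k1 kz.
  + by case=> /(congr1 val); rewrite /= e0 e1.
  + by case: z {kz} => i //= [] /(congr1 val) /=; rewrite e0.
  + by case: z {kz} => i //= [] /(congr1 val) /=; rewrite e1.
- by move=> M1 h1; exact: brauerian_cup.
Qed.

Lemma strand_case a b (M : cob R a b) (h : 'I_n.+1 -> R -> M) (k : 'I_n.+1) i j :
  edge_decomposition h -> (forall k, h k 0 <> h k 1) ->
  trace (h k) (cob_end M (inl i)) -> trace (h k) (cob_end M (inr j)) -> brauerian M.
Proof.
move=> dh ha ki kj.
have [x [a' [N [g [m [dg ga BN [mi _ _] [tl tr]]]]]]] := in_front i dh ha; apply: BN.
have [y [b' [L [f [m' [df fa BL [mj _ _] [tr' tl']]]]]]] := out_front j dg ga; apply: BL.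
have E1 : m i = ord0 by apply: val_inj; exact: mi.
have E2 : m' j = ord0 by apply: val_inj; exact: mj.
apply: (@strand_peel x y a' b' L f k df fa).
  by apply/tl'; rewrite -E1; apply/tl.
by rewrite -E2; apply/tr'/tr.
Qed.

(** The negative point is fetched first and the positive one second, which pushes the former to
    position 1; the word then begins with +-, as the cap requires. *)
Lemma cap_case a b (M : cob R a b) (h : 'I_n.+1 -> R -> M) (k : 'I_n.+1) (i j : 'I_(size a)) :
  edge_decomposition h -> (forall k, h k 0 <> h k 1) -> letter i -> ~~ letter j ->
  trace (h k) (cob_end M (inl i)) -> trace (h k) (cob_end M (inl j)) -> brauerian M.
Proof.
move=> dh ha li lj ki kj.
have [x [a' [N [g [m [dg ga BN [mj _ ml] [tl _]]]]]]] := in_front j dh ha; apply: BN.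
have [y [a2 [L [f [m' [df fa BL [mi mlt ml'] [tl' _]]]]]]] := in_front (m i) dg ga; apply: BL.
have mi0 : (m j < m i)%N.
  rewrite mj lt0n; apply/eqP => mi0; move: lj; rewrite -ml.
  have -> : m j = m i by apply: val_inj; exact: etrans mj (esym mi0).
  by rewrite ml li.
have e1 := mlt _ mi0; rewrite mj in e1.
have l0 := ml' (m i); rewrite ml li /letter (tnth_nth false) mi in l0.
have l1 := ml' (m j); rewrite ml (negbTE lj) /letter (tnth_nth false) e1 in l1.
have lt1 := ltn_ord (m' (m j)); rewrite {1}e1 in lt1.
have T0 : trace (f k) (cob_end L (inl (m' (m i)))) by apply/tl'/tl.
have T1 : trace (f k) (cob_end L (inl (m' (m j)))) by apply/tl'/tl.
move: (m' (m i)) (m' (m j)) mi e1 T0 T1 => i0 i1 {ml' tl' mlt m'} mi e1.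
case: a2 L f i0 i1 df fa mi e1 l0 l1 lt1 => [//|z a2] L f i0 i1 df fa e0 e1 /= y1 z0 _ T0 T1.
subst y z; exact: (cap_peel df fa e0 e1 T0 T1).
Qed.

(** Here the positive point is fetched first, so that the outgoing word begins with -+. *)
Lemma cup_case a b (M : cob R a b) (h : 'I_n.+1 -> R -> M) (k : 'I_n.+1) (i j : 'I_(size b)) :
  edge_decomposition h -> (forall k, h k 0 <> h k 1) -> ~~ letter i -> letter j ->
  trace (h k) (cob_end M (inr i)) -> trace (h k) (cob_end M (inr j)) -> brauerian M.
Proof.
move=> dh ha li lj ki kj.
have [x [a' [N [g [m [dg ga BN [mj _ ml] [tl _]]]]]]] := out_front j dh ha; apply: BN.
have [y [a2 [L [f [m' [df fa BL [mi mlt ml'] [tl' _]]]]]]] := out_front (m i) dg ga; apply: BL.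
have mi0 : (m j < m i)%N.
  rewrite mj lt0n; apply/eqP => mi0; move: li; rewrite -ml.
  have -> : m i = m j by apply: val_inj; exact: etrans mi0 (esym mj).
  by rewrite ml lj.
have e1 := mlt _ mi0; rewrite mj in e1.
have l0 := ml' (m i); rewrite ml (negbTE li) /letter (tnth_nth false) mi in l0.
have l1 := ml' (m j); rewrite ml lj /letter (tnth_nth false) e1 in l1.
have lt1 := ltn_ord (m' (m j)); rewrite {1}e1 in lt1.
have T0 : trace (f k) (cob_end L (inr (m' (m i)))) by apply/tl'/tl.
have T1 : trace (f k) (cob_end L (inr (m' (m j)))) by apply/tl'/tl.
move: (m' (m i)) (m' (m j)) mi e1 T0 T1 => i0 i1 {ml' tl' mlt m'} mi e1.
case: a2 L f i0 i1 df fa mi e1 l0 l1 lt1 => [//|z a2] L f i0 i1 df fa e0 e1 /= y1 z0 _ T0 T1.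
subst y z; exact: (cup_peel df fa e0 e1 T0 T1).
Qed.

End Induction.

(** The initial point [x] and the terminal point [y] of the first arc may each be ingoing or
    outgoing: a cap, a positive strand, a negative strand or a cup. *)
Lemma brauerian_arcs n a b (M : cob R a b) (h : 'I_n -> R -> M) :
  edge_decomposition h -> (forall k, h k 0 <> h k 1) -> brauerian M.
Proof.
elim: n a b M h => [|n IH] a b M h dh ha; first exact: brauerian_empty dh.
have tr s : trace (h ord0) (h ord0 (endpoint R s)).
  by exists (endpoint R s) => //; exact: endpoint_itv.
have [x xs xE] := edge_cob_end dh true (ha ord0).
have [y ys yE] := edge_cob_end dh false (ha ord0).
have kx : trace (h ord0) (cob_end M x) by rewrite xE.
have ky : trace (h ord0) (cob_end M y) by rewrite yE.
case: x y xs ys kx ky {xE yE} => [i|i] [j|j] /= xs ys kx ky.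
- by apply: (cap_case IH dh ha _ _ kx ky); rewrite ?xs ?ys.
- exact: (strand_case IH dh ha kx ky).
- exact: (strand_case IH dh ha ky kx).
- by apply: (cup_case IH dh ha _ _ kx ky); rewrite ?xs //; move/negbFE: ys.
Qed.

(** The circle is the twisted cap after the cup. The former consists of an arc, so [brauerian_arcs]
    already evaluates it, and the composite counts the pairs with equal entries: p of them. *)
Lemma brauerian_circle (M : cob R [::] [::]) (h : 'I_1 -> R -> M) :
  edge_decomposition h -> h ord0 0 = h ord0 1 -> brauerian M.
Proof.
move=> dh hl f g df dg.
rewrite (size0nil (digits_size df)) (size0nil (digits_size dg)).
have -> : num_circles M = 1%N.
  rewrite (num_circles_lift ord0 dh) eq_card0; last by case.
  by rewrite (_ : `[< _ >]) //; apply/asboolP.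
have -> : `[< compatible M [::] [::] >] by apply/asboolP; case; case.
have dI := interval_path_decomposition R 1; have aI := @interval_path_arc R 1.
have Btw := @brauerian_arcs 1 _ _ (twisted_cap_cob R) (@interval_path R 1) dI aI.
rewrite expr1 mulr1 (G_comp (circle_composite dh hl)) ent_mul.
have digit2 x y : (x < p)%N -> (y < p)%N -> digits p 2 [:: x; y].
  by move=> xp yp; rewrite /digits /= xp yp.
(* An index below [p * p] is the code of the string of its quotient and remainder by [p]. *)
have E (k : nat) : (k < p * p)%N ->
    ent (G (twisted_cap_cob R)) (code p [::]) k * ent (G (cup_cob R)) k (code p [::]) =
    ((k %/ p)%N == (k %% p)%N)%:R.
  move=> kp; have xp : (k %/ p < p)%N by rewrite ltn_divLR.
  have yp : (k %% p < p)%N by rewrite ltn_mod.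
  have -> : k = code p [:: (k %/ p)%N; (k %% p)%N].
    by rewrite /= expn1 expn0 muln1 addn0 -divn_eq.
  rewrite G_cup // (Btw [::] [:: _; _]) ?digit2 //.
  rewrite (@num_circles_arcs _ _ (twisted_cap_cob R) 1 (@interval_path R 1) dI aI).
  rewrite expr0 mul1r /= expn1 expn0 muln1 addn0 -divn_eq.
  have [kk|kk] := eqVneq (k %/ p)%N (k %% p)%N; last by rewrite mulr0.
  rewrite mulr1 (_ : `[< _ >]) //; apply/asboolP.
  apply/(@compatible1 _ _ (twisted_cap_cob R) (@interval_path R 1) _ _ dI).
  by case=> [[[|[|//]] i]|[]//] [[[|[|//]] j]|[]//] /=; rewrite ?kk.
have pp : (p ^ size [:: false; true] = p * p)%N by rewrite /= expnS expn1.
transitivity (\sum_(k < p ^ size [:: false; true]) (((k %/ p)%N == (k %% p)%N)%:R : K)).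
  by apply: eq_bigr => k _; apply: E; rewrite -pp.
rewrite pp.
rewrite (sum_blocks (fun k => ((k %/ p)%N == (k %% p)%N)%:R)).
transitivity (\sum_(i < p) (1 : K)); last by rewrite sumr_const card_ord.
apply: eq_bigr => i _; rewrite -[RHS](sum_delta (fun=> 1) (ltn_ord i)).
by apply: eq_bigr => j _; rewrite mul1r divnMDl // divn_small // addn0 modnMDl modn_small // eq_sym.
Qed.

(** Loops go first: over empty left words they can be peeled in place, and when none is left
    [brauerian_arcs] may use collars. *)
Theorem all_brauerian a b (M : cob R a b) : brauerian M.
Proof.
have [n [h dh]] := edge_decomposition_exists M.
elim: n a b M h dh => [|n IH] a b M h dh; first exact: brauerian_empty dh.
case: (pselect (forall k, h k 0 <> h k 1)) => [ha|]; first exact: brauerian_arcs dh ha.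
move=> /existsNP[k /contrapT hk].
apply: (@peel [::] [::] a b M n h k dh).
- by case; case.
(* A loop contains no boundary point, since each of those lies on an arc. *)
- move=> x kx; have [l hl lE] := cob_end_edge dh (cat_end_right [::] [::] x).
  suff lk : l = k by rewrite lk in hl.
  apply: (dec_disjoint dh _ kx); rewrite lE.
  by exists (endpoint R (point_sign (cat_end_right [::] [::] x))) => //; exact: endpoint_itv.
- by move=> M1 h1 dh1 [_ /(_ hk) l1]; exact: brauerian_circle dh1 l1.
- by move=> M2 h2 dh2 _; exact: IH dh2.
Qed.

End Evaluation.

End BrauerValues.

(** * Values on cap and cup *)

Section SnakeIdentities.
Variable R : realType.
Implicit Type M : omanifold R.

(** The table shows which interval carries which boundary points; if interval [k] carries exactly
    the left block, [split_edge] applies. *)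
Lemma table_tensor (a b c d : word) (s : seq ('I_2 * bool)) (us : uniq s)
    (ss : size s = (2 * 2)%N)
    (sg : [seq ks.2 | ks <- s] = (a ++ c) ++ [seq ~~ x | x <- b ++ d]) k :
  (forall x, (nth (k, true) s (table_index (@cat_end_left a b c d x))).1 = k) ->
  (forall x, (nth (k, true) s (table_index (@cat_end_right a b c d x))).1 <> k) ->
  exists (K1 : cob R a b) (K2 : cob R c d) (h1 : 'I_1 -> R -> K1) (h2 : 'I_1 -> R -> K2),
  [/\ is_tensor K1 K2 (table_cob R us ss sg : cob R (a ++ c) (b ++ d)),
    edge_decomposition h1, edge_decomposition h2,
    h1 ord0 0 <> h1 ord0 1 & h2 ord0 0 <> h2 ord0 1].
Proof.
move=> sl sr; have d2 := interval_path_decomposition R 2.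
have a2 := @interval_path_arc R 2.
have [||K1 [K2 [h1 [h2 [T d1 d1' l1 [l2 _]]]]]] :=
    @split_edge R a b c d (table_cob R us ss sg) 1 (@interval_path R 2) k d2.
- by move=> x; rewrite (cob_end_table R us ss sg (k, true)); apply/trace_arc_end; rewrite sl.
- move=> x; rewrite (cob_end_table R us ss sg (k, true)) => /trace_arc_end E.
  exact: (sr x).
exists K1, K2, h1, h2; split => //.
  by move/l1; exact: a2.
by move/l2; exact: a2.
Qed.

Let d1 := interval_path_decomposition R 1.
Let a1 := @interval_path_arc R 1 ord0.

Lemma strand_pos_identity : is_identity (strand_pos R).
Proof. exact: (@arcs1_identity R true (strand_pos R) (@interval_path R 1) d1 a1). Qed.

Lemma strand_neg_identity : is_identity (strand_neg R).
Proof. exact: (@arcs1_identity R false (strand_neg R) (@interval_path R 1) d1 a1). Qed.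

Lemma cup_right_pos_tensor : exists (I : cob R [:: true] [:: true]) (C : cob R [::] [:: false; true]),
  [/\ is_identity I, cob_equiv C (cup_cob R)
    & @is_tensor R [:: true] [:: true] [::] [:: false; true] I C (cup_right_pos R)].
Proof.
have [||I [C [h1 [h2 [T e1 e2 n1 n2]]]]] := @table_tensor [:: true] [:: true] [::] [:: false; true]
  [:: (ord0, true); (ord0, false); (ord_max, true); (ord_max, false)] isT erefl erefl ord0.
- by case=> [[[|//] i]|[[|//] i]].
- by case=> [[]|[[|[|//]] i]].
exists I, C; split => //; first exact: arcs1_identity e1 n1.
exact: (@arcs1_equiv R _ _ C (cup_cob R) h2 (@interval_path R 1) e2 d1 n2 a1).
Qed.

Lemma cap_left_pos_tensor : exists (C : cob R [:: true; false] [::]) (I : cob R [:: true] [:: true]),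
  [/\ is_identity I, cob_equiv C (cap_cob R)
    & @is_tensor R [:: true; false] [::] [:: true] [:: true] C I (cap_left_pos R)].
Proof.
have [||C [I [h1 [h2 [T e1 e2 n1 n2]]]]] := @table_tensor [:: true; false] [::] [:: true] [:: true]
  [:: (ord0, true); (ord0, false); (ord_max, true); (ord_max, false)] isT erefl erefl ord0.
- by case=> [[[|[|//]] i]|[]].
- by case=> [[[|//] i]|[[|//] i]].
exists C, I; split => //; first exact: arcs1_identity e2 n2.
exact: (@arcs1_equiv R _ _ C (cap_cob R) h1 (@interval_path R 1) e1 d1 n1 a1).
Qed.

Lemma cup_left_neg_tensor : exists (C : cob R [::] [:: false; true]) (I : cob R [:: false] [:: false]),
  [/\ is_identity I, cob_equiv C (cup_cob R)
    & @is_tensor R [::] [:: false; true] [:: false] [:: false] C I (cup_left_neg R)].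
Proof.
have [||C [I [h1 [h2 [T e1 e2 n1 n2]]]]] := @table_tensor [::] [:: false; true] [:: false] [:: false]
  [:: (ord_max, false); (ord0, true); (ord0, false); (ord_max, true)] isT erefl erefl ord0.
- by case=> [[]|[[|[|//]] i]].
- by case=> [[[|//] i]|[[|//] i]].
exists C, I; split => //; first exact: arcs1_identity e2 n2.
exact: (@arcs1_equiv R _ _ C (cup_cob R) h1 (@interval_path R 1) e1 d1 n1 a1).
Qed.

Lemma cap_right_neg_tensor : exists (I : cob R [:: false] [:: false]) (C : cob R [:: true; false] [::]),
  [/\ is_identity I, cob_equiv C (cap_cob R)
    & @is_tensor R [:: false] [:: false] [:: true; false] [::] I C (cap_right_neg R)].
Proof.
have [||I [C [h1 [h2 [T e1 e2 n1 n2]]]]] := @table_tensor [:: false] [:: false] [:: true; false] [::]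
  [:: (ord0, false); (ord_max, true); (ord_max, false); (ord0, true)] isT erefl erefl ord0.
- by case=> [[[|//] i]|[[|//] i]].
- by case=> [[[|[|//]] i]|[]].
exists I, C; split => //; first exact: arcs1_identity e1 n1.
exact: (@arcs1_equiv R _ _ C (cap_cob R) h2 (@interval_path R 1) e2 d1 n2 a1).
Qed.

Section Snake.
Variables (K : fieldType) (F : functor_data R K).
Hypothesis FA : is_strict_symmetric_monoidal F.

Local Notation p := (ob F [:: true]).
Local Notation q := (ob F [:: false]).

Lemma mor_tensor_ent (a b c d : word) (M : cob R a b) (N : cob R c d)
    (L : cob R (a ++ c) (b ++ d)) : is_tensor M N L ->
  forall i1 i2 j1 j2, (i2 < ob F d)%N -> (j2 < ob F c)%N ->
  ent (mor F L) (i1 * ob F d + i2) (j1 * ob F c + j2) = ent (mor F M) i1 j1 * ent (mor F N) i2 j2.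
Proof.
by move=> /(mor_tensor FA) -> i1 i2 j1 j2 h1 h2; rewrite ent_cast ent_tens_block.
Qed.

(** E and H of the overview: the only row of the cap and the only column of the cup, reshaped by
    pairs of indices. *)
Definition cap_mx : 'M[K]_(p, q) := \matrix_(i, j) ent (mor F (cap_cob R)) 0 (i * q + j).
Definition cup_mx : 'M[K]_(q, p) := \matrix_(i, j) ent (mor F (cup_cob R)) (i * p + j) 0.

Lemma cap_cup : cap_mx *m cup_mx = 1%:M.
Proof.
have [I1 [C1 [i1 c1 t1]]] := cup_right_pos_tensor.
have [C2 [I2 [i2 c2 t2]]] := cap_left_pos_tensor.
have u1 : (0 < ob F [::])%N by rewrite ob_unit.
have := mor_composite FA (snake_pos R); rewrite (mor_identity FA strand_pos_identity) => S.
(* The entry [(i, j)] of this snake is the entry [(j, i)] of the product, hence the exchanged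
   names. *)
apply/matrixP => j i; rewrite !mxE eq_sym -(ent_1 K j (ltn_ord i)) S ent_mul.
have eo : ob F [:: true; false; true] = (p * q * p)%N.
  by rewrite (ob_cat F [:: true; false] [:: true]) (ob_cat F [:: true] [:: false]).
pose f k := ent (mor F (cap_left_pos R)) i k * ent (mor F (cup_right_pos R)) k j.
transitivity (\sum_(k < p * q * p) f k); last by rewrite -eo.
rewrite (@zigzag_sum K _ _ f (fun k => ent (mor F (cap_cob R)) 0 k)
  (fun k => ent (mor F (cup_cob R)) k 0) _ _ (ltn_ord j) (ltn_ord i)).
  by apply: eq_bigr => y _; rewrite !mxE.
move=> x y z xp yq zp; rewrite /f.
have := mor_tensor_ent t2 0 (x * q + y) (ltn_ord i) zp.
rewrite mul0n add0n => ->; rewrite (mor_equiv FA c2) (mor_identity FA i2) ent_1 //.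
have yz : (y * p + z < ob F [:: false; true])%N.
  rewrite (ob_cat F [:: false] [:: true]); exact: block_lt.
have jE : (j * ob F [::] + 0 = j)%N by rewrite (ob_unit F) muln1 addn0.
have kE : (x * ob F [:: false; true] + (y * p + z) = (x * q + y) * p + z)%N.
  by rewrite (ob_cat F [:: false] [:: true]) mulnA addnA -mulnDl.
have := mor_tensor_ent t1 x j yz u1; rewrite jE kE => ->.
rewrite (mor_equiv FA c1) (mor_identity FA i1) ent_1 // [i == z :> nat]eq_sym.
by rewrite [(x == j)%:R * _]mulrC mulrACA; congr (_ * _); exact: mulrC.
Qed.

Lemma cup_cap : cup_mx *m cap_mx = 1%:M.
Proof.
have [C1 [I1 [i1 c1 t1]]] := cup_left_neg_tensor.
have [I2 [C2 [i2 c2 t2]]] := cap_right_neg_tensor.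
have u1 : (0 < ob F [::])%N by rewrite ob_unit.
have := mor_composite FA (snake_neg R); rewrite (mor_identity FA strand_neg_identity) => S.
apply/matrixP => i j; rewrite !mxE -(ent_1 K j (ltn_ord i)) S ent_mul.
have eo : ob F [:: false; true; false] = (q * p * q)%N.
  by rewrite (ob_cat F [:: false; true] [:: false]) (ob_cat F [:: false] [:: true]).
pose f k := ent (mor F (cap_right_neg R)) i k * ent (mor F (cup_left_neg R)) k j.
transitivity (\sum_(k < q * p * q) f k); last by rewrite -eo.
rewrite (@zigzag_sum K _ _ f (fun k => ent (mor F (cup_cob R)) k 0)
  (fun k => ent (mor F (cap_cob R)) 0 k) _ _ (ltn_ord i) (ltn_ord j)).
  by apply: eq_bigr => y _; rewrite !mxE.
move=> x y z xq yp zq; rewrite /f.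
have := mor_tensor_ent t1 (x * p + y) 0 zq (ltn_ord j).
rewrite mul0n add0n => ->; rewrite (mor_equiv FA c1) (mor_identity FA i1) ent_1 //.
have yz : (y * q + z < ob F [:: true; false])%N.
  rewrite (ob_cat F [:: true] [:: false]); exact: block_lt.
have iE : (i * ob F [::] + 0 = i)%N by rewrite (ob_unit F) muln1 addn0.
have kE : (x * ob F [:: true; false] + (y * q + z) = (x * p + y) * q + z)%N.
  by rewrite (ob_cat F [:: true] [:: false]) mulnA addnA -mulnDl.
have := mor_tensor_ent t2 i x u1 yz; rewrite iE kE => ->.
rewrite (mor_equiv FA c2) (mor_identity FA i2) ent_1 // [i == x :> nat]eq_sym.
by rewrite [LHS]mulrC [(x == i)%:R * _]mulrC mulrACA; congr (_ * _); exact: mulrC.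
Qed.

End Snake.

End SnakeIdentities.

(** * The monoidal isomorphism and the conjugated functor *)

Section MonoidalIso.
Variable R : realType.
Implicit Type M : omanifold R.

Section Tower.
Variables (K : fieldType) (S T : functor_data R K).

(** Once the components at letters are given, [theta_unit] and [theta_cat] leave no other choice. *)
Fixpoint tower (h : forall x, 'M[K]_(ob T [:: x], ob S [:: x])) (a : word) :
    'M[K]_(ob T a, ob S a) :=
  match a return 'M_(ob T a, ob S a) with
  | [::] => castmx (esym (ob_unit T), esym (ob_unit S)) 1%:M
  | x :: a' => castmx (esym (ob_cat T [:: x] a'), esym (ob_cat S [:: x] a')) (h x *t tower h a')
  end.

Variable h : forall x, 'M[K]_(ob T [:: x], ob S [:: x]).

Lemma ent_tower0 i j : (i < 1)%N -> ent (tower h [::]) i j = (i == j)%:R.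
Proof. by move=> i1; rewrite ent_cast ent_1. Qed.

Lemma ent_tower_cons x (a : word) i j : ent (tower h (x :: a)) i j =
  ent (h x) (i %/ ob T a) (j %/ ob S a) * ent (tower h a) (i %% ob T a) (j %% ob S a).
Proof. by rewrite ent_cast ent_tens. Qed.

(** Associativity of the Kronecker product. On entries it becomes associativity of iterated
    quotients and remainders, free of casts. *)
Lemma tower_cat (a b : word) : tower h (a ++ b) =
  castmx (esym (ob_cat T a b), esym (ob_cat S a b)) (tower h a *t tower h b).
Proof.
elim: a b => [|x a IH] b; apply: ent_inj => i j ib jb; rewrite [RHS]ent_cast [RHS]ent_tens.
  by rewrite !divn_small // ent_tower0 // eqxx mul1r !modn_small.
rewrite -[(x :: a) ++ b]/(x :: (a ++ b)) !ent_tower_cons IH ent_cast ent_tens mulrA.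
have div_cat (U : functor_data R K) k :
    [/\ (k %/ ob U (a ++ b) = k %/ ob U b %/ ob U a)%N,
      (k %% ob U (a ++ b) %/ ob U b = (k %/ ob U b) %% ob U a)%N
    & (k %% ob U (a ++ b) = k %[mod ob U b])%N].
  by rewrite ob_cat modn_divl -divnMA [(ob U b * _)%N]mulnC modn_dvdm // dvdn_mull.
have [-> -> ->] := div_cat T i; by have [-> -> ->] := div_cat S j.
Qed.

Lemma tower1 x : tower h [:: x] = h x.
Proof.
apply: ent_inj => i j ix jx.
rewrite ent_tower_cons ent_tower0 ?ob_unit ?modn1 //.
by rewrite !divn1 mulr1.
Qed.

End Tower.

Lemma tower_inverse (K : fieldType) (S T : functor_data R K)
    (h : forall x, 'M[K]_(ob T [:: x], ob S [:: x]))
    (h' : forall x, 'M[K]_(ob S [:: x], ob T [:: x])) :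
  (forall x, h' x *m h x = 1%:M) -> forall a, tower h' a *m tower h a = 1%:M.
Proof.
have C m n (e : m = n) : castmx (e, e) (1%:M : 'M[K]_m) = 1%:M.
  by case: n / e; rewrite castmx_id.
move=> hh; elim=> [|x a IH] /=; first by rewrite mulmx_castmx mulmx1 C.
by rewrite mulmx_castmx tensmx_mul hh IH tensmx11 C.
Qed.

Section Conjugation.
Variables (K : fieldType) (F : functor_data R K).
Hypothesis FA : is_strict_symmetric_monoidal F.

Local Notation p := (ob F [:: true]).
Local Notation q := (ob F [:: false]).
Local Notation B := (brauer R K p).

Hypothesis p_gt0 : (0 < p)%N.

(** [p ^ 1] computes to [p], so [1%:M] and [cup_mx] have the required types without casts. *)
Definition letter_iso (x : bool) : 'M[K]_(ob F [:: x], ob B [:: x]) :=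
  if x is true then 1%:M else cup_mx F.

Definition letter_inv (x : bool) : 'M[K]_(ob B [:: x], ob F [:: x]) :=
  if x is true then 1%:M else cap_mx F.

Local Notation theta := (tower letter_iso).
Local Notation theta' := (tower letter_inv).

Lemma theta_left (a : word) : theta' a *m theta a = 1%:M.
Proof. by apply: tower_inverse => -[] /=; [exact: mul1mx|exact: cap_cup]. Qed.

Lemma theta_right (a : word) : theta a *m theta' a = 1%:M.
Proof. by apply: tower_inverse => -[] /=; [exact: mul1mx|exact: cup_cap]. Qed.

Definition conj_mor a b (M : cob R a b) : 'M[K]_(p ^ size b, p ^ size a) :=
  theta' b *m mor F M *m theta a.

Lemma conj_equiv a b (M N : cob R a b) : cob_equiv M N -> conj_mor M = conj_mor N.
Proof. by rewrite /conj_mor => /(mor_equiv FA) ->. Qed.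

Lemma conj_id (a : word) (M : cob R a a) : is_identity M -> conj_mor M = 1%:M.
Proof. by rewrite /conj_mor => /(mor_identity FA) ->; rewrite mulmx1 theta_left. Qed.

Lemma conj_comp (a b c : word) (M : cob R a b) (N : cob R b c) (L : cob R a c) :
  is_composite M N L -> conj_mor L = conj_mor N *m conj_mor M.
Proof.
rewrite /conj_mor => /(mor_composite FA) ->; rewrite !mulmxA.
by rewrite -[_ *m theta b *m theta' b]mulmxA theta_right mulmx1.
Qed.

Lemma conj_tens (a b c d : word) (M : cob R a b) (N : cob R c d)
    (L : cob R (a ++ c) (b ++ d)) : is_tensor M N L ->
  forall i1 i2 j1 j2, (i2 < p ^ size d)%N -> (j2 < p ^ size c)%N ->
  ent (conj_mor L) (i1 * p ^ size d + i2) (j1 * p ^ size c + j2) =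
  ent (conj_mor M) i1 j1 * ent (conj_mor N) i2 j2.
Proof.
move=> T i1 i2 j1 j2 h1 h2; rewrite -ent_tens_block // /conj_mor (mor_tensor FA T).
by rewrite !tower_cat !mulmx_castmx !tensmx_mul ent_cast.
Qed.

(** By [commutation_mulmx] the two factors of theta pass through the symmetry and cancel against
    those of theta'. *)
Lemma conj_sym (a b : word) (M : cob R (a ++ b) (b ++ a)) : is_symmetry M ->
  forall i1 i2 j1 j2, (i1 < p ^ size a)%N -> (i2 < p ^ size b)%N ->
    (j1 < p ^ size a)%N -> (j2 < p ^ size b)%N ->
  ent (conj_mor M) (i2 * p ^ size a + i1) (j1 * p ^ size b + j2) =
  ((i1 == j1) && (i2 == j2))%:R.
Proof.
move=> T i1 i2 j1 j2 h1 h2 h3 h4; rewrite /conj_mor (mor_symmetry FA T).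
rewrite !tower_cat !mulmx_castmx ent_cast -mulmxA commutation_mulmx mulmxA tensmx_mul.
by rewrite !theta_left tensmx11 mul1mx ent_commutation.
Qed.

Lemma ent_theta_pair x y u v i j : (u < ob F [:: y])%N -> (j < p)%N ->
  ent (theta [:: x; y]) (i * ob F [:: y] + u) (v * p + j) =
  ent (letter_iso x) i v * ent (letter_iso y) u j.
Proof.
move=> uy jp; rewrite (tower_cat letter_iso [:: x] [:: y]) !tower1 ent_cast.
by rewrite ent_tens_block.
Qed.

Lemma ent_theta'_pair x y u v i j : (u < p)%N -> (j < ob F [:: y])%N ->
  ent (theta' [:: x; y]) (i * p + u) (v * ob F [:: y] + j) =
  ent (letter_inv x) i v * ent (letter_inv y) u j.
Proof.
move=> uy jp; rewrite (tower_cat letter_inv [:: x] [:: y]) !tower1 ent_cast.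
by rewrite ent_tens_block.
Qed.

Lemma code_pair x y : code p [:: x; y] = (x * p + y)%N.
Proof. by rewrite /= expn1 expn0 muln1 addn0. Qed.

(** On the word +- theta is 1 next to H, which turns the cap, read as the matrix E, into E H = 1. *)
Lemma conj_cap x y : (x < p)%N -> (y < p)%N ->
  ent (conj_mor (cap_cob R)) (code p [::]) (code p [:: x; y]) = (x == y)%:R.
Proof.
move=> xp yp; rewrite code_pair /conj_mor ent_mul -[code p [::]]/0%N.
have ef k : ent (theta' [::] *m mor F (cap_cob R)) 0 k = ent (mor F (cap_cob R)) 0 k.
  rewrite ent_mul; transitivity (\sum_(l < ob F [::]) ent (mor F (cap_cob R)) l k * (l == 0 :> nat)%:R).
    by apply: eq_bigr => l _; rewrite ent_tower0 // mulrC eq_sym.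
  by rewrite (sum_delta (fun l => ent _ l k)) // ob_unit.
pose f k := ent (mor F (cap_cob R)) 0 k * ent (theta [:: true; false]) k (x * p + y).
transitivity (\sum_(k < ob F [:: true; false]) f k); first by apply: eq_bigr => k _; rewrite ef.
rewrite (ob_cat F [:: true] [:: false]) (sum_blocks f).
rewrite -(ent_1 K y xp) -(cap_cup FA) ent_mul.
pose g u := \sum_(v < q) ent (cap_mx F) u v * ent (cup_mx F) v y.
transitivity (g x) => //; rewrite -(sum_delta g xp); apply: eq_bigr => u _; rewrite mulr_suml; apply: eq_bigr => v _.
rewrite /f ent_theta_pair // /= ent_1 // !ent_ord.
by rewrite [cap_mx F u v]mxE mulrA mulrAC.
Qed.

(** On -+ the inverse of theta is E next to 1, so the cup H becomes E H = 1 as well. *)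
Lemma conj_cup x y : (x < p)%N -> (y < p)%N ->
  ent (conj_mor (cup_cob R)) (code p [:: x; y]) (code p [::]) = (x == y)%:R.
Proof.
move=> xp yp; rewrite code_pair /conj_mor -mulmxA ent_mul -[code p [::]]/0%N.
have ef k : ent (mor F (cup_cob R) *m theta [::]) k 0 = ent (mor F (cup_cob R)) k 0.
  rewrite ent_mul; transitivity (\sum_(l < ob F [::]) ent (mor F (cup_cob R)) k l * (l == 0 :> nat)%:R).
    by apply: eq_bigr => l _; rewrite ent_tower0 // -(ob_unit F).
  by rewrite (sum_delta (fun l => ent _ k l)) // ob_unit.
pose f k := ent (theta' [:: false; true]) (x * p + y) k * ent (mor F (cup_cob R)) k 0.
transitivity (\sum_(k < ob F [:: false; true]) f k); first by apply: eq_bigr => k _; rewrite ef.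
rewrite (ob_cat F [:: false] [:: true]) (sum_blocks f).
rewrite -(ent_1 K y xp) -(cap_cup FA) ent_mul; apply: eq_bigr => u _.
rewrite [in RHS](ent_lt _ (ltn_ord u) yp) mxE /=.
rewrite -(sum_delta (fun v => ent (mor F (cup_cob R)) (u * p + v) 0) yp) mulr_sumr.
apply: eq_bigr => v _; rewrite /f ent_theta'_pair // /= ent_1 // -mulrA eq_sym.
by congr (_ * _); rewrite mulrC.
Qed.

End Conjugation.

End MonoidalIso.

Lemma brauer_morE (R : realType) (K : fieldType) (p : nat) (p_gt0 : (0 < p)%N) (a b : word)
    (M : cob R a b) f g : digits p (size b) f -> digits p (size a) g ->
  ent (brauer_mor K p M) (code p f) (code p g) =
  p%:R ^+ num_circles M * `[< compatible M f g >]%:R.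
Proof.
move=> df dg; rewrite (ent_lt _ (code_lt p_gt0 df) (code_lt p_gt0 dg)) !mxE.
have lE (x : 'I_(size a) + 'I_(size b)) : brauer_label p (code p g) (code p f) x = label f g x.
  by case: x => u /=; [apply: (lex_fun_code p_gt0 dg)|apply: (lex_fun_code p_gt0 df)].
congr (_ * (nat_of_bool _)%:R); congr asbool; apply/propext.
by split=> C x y /C; rewrite !lE.
Qed.

Theorem proposition4p3 (R : realType) (K : fieldType) (p : nat)
    (charK0 : [pchar K]%R =i pred0)
    (F : strict_tqft R K) (p_ge2 : (2 <= p)%N) (Fp : ob F [:: true] = p) :
  exists theta : forall a : word, 'M[K]_(ob F a, ob (brauer R K p) a),
    is_monoidal_natural_iso theta.
Proof.
subst p; have p_gt0 : (0 < ob F [:: true])%N by exact: ltnW.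
have FA := tqft_axioms F.
exists (tower (letter_iso F)); split.
(* B and theta^-1 F theta have the same entries, by the Brauer formula at digit strings; multiplying
   by theta on the left gives naturality. *)
- move=> a b M; have -> : mor (brauer R K (ob F [:: true])) M = conj_mor F M.
    apply: ent_inj => i j /(code_surj p_gt0)[f df <-] /(code_surj p_gt0)[g dg <-].
    rewrite (brauer_morE _ p_gt0 M df dg); apply/esym.
    exact: (all_brauerian p_gt0 (conj_equiv FA) (conj_id FA) (conj_comp FA) (conj_tens FA)
      (conj_sym FA) (conj_cap FA) (conj_cup FA) M df dg).
  by rewrite /conj_mor !mulmxA theta_right // mul1mx.
- by move=> a; exists (tower (letter_inv F) a); rewrite theta_left ?theta_right.
- by apply: ent_inj => i j i1 j1; rewrite ent_cast ent_tower0 // ent_1.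
- by move=> a b; rewrite tower_cat.
Qed.
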